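(* Let $p$ be a prime, let $G=\prod_{j=1}^{r}C_{p^j}^{k_j}$ be a finite Abelian $p$-group with $k_1,\dots,k_r\ge 0$ and $k_r>0$, and let $q$ be a prime power with $p\nmid q$. Write $G\cong C_{p^r}\times G_0$ and let $|G_0|=p^{s}$. Let $d$ be the multiplicative order of $q$ modulo $p$ and $\lambda_i=v_p(q^{dp^i}-1)$ for $i\ge 0$. Suppose that either $p\geq 3$ or $\lambda_0\geq 2$. Define integers $l\ge 0$ and $a_l$ as follows: - if $\lambda_0>r+s$, then $l=0$ and $a_l=r+s-\lambda_0$; - if $r-s+2\leq \lambda_0\leq r+s$ and $r+s-\lambda_0$ is even, then $l=\frac{r+s-\lambda_0+2}{2}$ and $a_l=-2$; - if $r-s+2\leq \lambda_0\leq r+s$ and $r+s-\lambda_0$ is odd, then $l=\frac{r+s-\lambda_0+1}{2}$ and $a_l=-1$; - if $\lambda_0\leq r-s+1$, then $l=r-\lambda_0+1$ and $a_l=-r+s+\lambda_0-2$. Then for every integer $n\ge 0$, $$v_p(\#\operatorname{Hom}(G,GL_n(\mathbb{F}_q)))\geq \lambda_0\left\lfloor \frac{n}{d}\right\rfloor+\sum_{i=1}^{l}\left\lfloor \frac{n}{dp^i}\right\rfloor+a_l\left\lfloor \frac{n}{dp^l}\right\rfloor,$$ and equality holds whenever $dp^l\mid n$, except in the case $p=2$ and $a_l=-1$.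
   Context: $C_m$ denotes the cyclic group of order $m$. For a prime $p$ and a nonzero rational number $a$, $v_p(a)$ is the $p$-adic valuation (the exponent of $p$ in $a$). $\#\operatorname{Hom}(G,H)$ is the number of group homomorphisms from $G$ to $H$; $GL_n(\mathbb{F}_q)$ is the group of invertible $n\times n$ matrices over the field with $q$ elements. *)

(* Defs.v *)
From HB Require Import structures.
From mathcomp Require Import all_boot all_order all_fingroup all_algebra.

Set Implicit Arguments.
Unset Strict Implicit.
Unset Printing Implicit Defensive.

Import GRing.Theory.
Local Open Scope ring_scope.

(* The library's {'GL_n[F]} is the unit group of 'M[F]_n.-1.+1, so it is GL_1  *)
(* when n = 0. The group GL n F below is the trivial group GL_0 when n = 0.    *)
Definition GL (n : nat) (F : finFieldType) : Type :=
  {A : 'M[F]_n | A \in unitmx}.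

HB.instance Definition _ n F := SubType.on (GL n F).
HB.instance Definition _ n F := [Finite of GL n F by <:].

Section GLGroup.
Variables (n : nat) (F : finFieldType).
Implicit Types A B : GL n F.

Fact GL_one_subproof : (1%:M : 'M[F]_n) \in unitmx.
Proof. exact: unitmx1. Qed.

Fact GL_mul_subproof A B : val A *m val B \in unitmx.
Proof. by rewrite unitmx_mul (valP A) (valP B). Qed.

Fact GL_inv_subproof A : invmx (val A) \in unitmx.
Proof. by rewrite unitmx_inv (valP A). Qed.

Definition GL_one : GL n F := Sub 1%:M GL_one_subproof.
Definition GL_mul A B : GL n F := Sub (val A *m val B) (GL_mul_subproof A B).
Definition GL_inv A : GL n F := Sub (invmx (val A)) (GL_inv_subproof A).

Fact GL_mulA : associative GL_mul.
Proof. by move=> A B C; apply: val_inj; rewrite !SubK mulmxA. Qed.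

Fact GL_mul1 : left_id GL_one GL_mul.
Proof. by move=> A; apply: val_inj; rewrite !SubK mul1mx. Qed.

Fact GL_mulV : left_inverse GL_one GL_inv GL_mul.
Proof. by move=> A; apply: val_inj; rewrite !SubK mulVmx // (valP A). Qed.

HB.instance Definition _ :=
  Finite_isGroup.Build (GL n F) GL_mulA GL_mul1 GL_mulV.
End GLGroup.

Definition homs (gT hT : finGroupType) : {set {ffun gT -> hT}} :=
  [set f : {ffun gT -> hT} | morphic [set: gT] f].

(* The product over 1 <= j <= r of k_j copies of C_(p^j), with j = i + 1 for   *)
(* i : 'I_r. The cyclic group C_m is the additive group 'Z_m, of order m as    *)
(* soon as m > 1, which holds here when p is prime.                            *)
Definition abelian_pgroup (p r : nat) (k : nat -> nat) : finGroupType :=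
  {dffun forall x : {i : 'I_r & 'I_(k i.+1)}, 'Z_(p ^ (tag x).+1)}.

Definition lam (p q d i : nat) : nat := logn p (q ^ (d * p ^ i) - 1).

(* The pair (l, a_l), for lam0 standing for lambda_0. The condition            *)
(* r - s + 2 <= lam0 is written without the subtraction, which truncates in    *)
(* nat. The conditions lam0 > r + s and lam0 <= r - s + 1 overlap exactly when *)
(* s = 0 and lam0 = r + 1, and then both prescribe (0, -1).                    *)
Definition l_al (r s lam0 : nat) : nat * int :=
  if (r + s < lam0)%N then (0%N, (r + s)%:Z - lam0%:Z)
  else if (r + 2 <= lam0 + s)%N then
    if odd (r + s - lam0) then (((r + s - lam0 + 1) %/ 2)%N, -1)
    else (((r + s - lam0 + 2) %/ 2)%N, -2)
  else ((r + 1 - lam0)%N, - r%:Z + s%:Z + lam0%:Z - 2).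

(* Main.v *)
(* Let F_Q(y) be the sum of y^m / |GL_m(Q)|. Modules over the semisimple algebra
   F_q[A] of an abelian p-group A are sums of irreducibles, so the series with
   coefficients #Hom(A, GL_n(F_q)) / |GL_n(F_q)| is the product, over the
   Frobenius orbits of characters of A, of F_{q^e}(x^e), with e the size of the
   orbit; its logarithm is thus a sum over the characters of A.
   By Frobenius' theorem on the solutions of x^n = 1, the series of C_{p^t} x A
   is p-integral up to any given degree once t is large. Applied to C_{p^t}
   over the fields with Q and Q^p elements, this gives
     v_p([y^k] log F_Q) >= - v_p(Q - 1) - 2 v_p(k),
   with equality when k is a power of p. Applied to C_{p^t} x G_0, it shows
   that, in degrees up to n, the series of G = C_{p^r} x G_0 is a p-integral
   series times exp(theta), where theta collects the characters of C_{p^t} x G_0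
   whose first component has order larger than p^r. Then
     v_p([x^k] theta) >= r + s - lambda_0 - 2 v_p(k),
   with equality at k = d p^v, and the term of degree d p^l dominates: in all
   four cases a_l = r + s - lambda_0 - 2 l. *)

Require Import Defs.
From HB Require Import structures.
From mathcomp Require Import all_boot all_order all_fingroup all_algebra.
From mathcomp Require Import all_solvable finfield mxrepresentation.
From mathcomp Require Import zify ring lra.

Set Implicit Arguments.
Unset Strict Implicit.
Unset Printing Implicit Defensive.

Import Order.TTheory GRing.Theory Num.Theory GroupScope.

(** * Frobenius' theorem and homomorphisms from C_m x A *)

(** The loss of 2 v_p(k) in log F_Q arises one power of p at a time: passing from Q to Q^p raises
    v_p(Q - 1) by one, and the orbits of size p bring a factor 1/p. Put c_v = r + s - lambda_0 - 2
    v, the valuation of theta in degree d p^v. As theta is supported on the multiples of d p^i with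
    i = max(0, r + 1 - lambda_0), the four cases have one description: l is the least v >= i with
    c_v < 0, and a_l = c_l. Terms of theta with v_p(k) < l are therefore p-integral, and only the
    denominators of their exponentials have to be controlled. Terms of degree k = w d p^l with w > 1
    may have more negative valuation, but x^k then competes with the w-th power of the dominant
    term. The comparison is between 2 v_p(w) and -a_l (w - 1) + v_p(w!). The only tie is p = w = 2
    with a_l = -1, where c_(l+1) = -3 is also the valuation of c^2/2 for v_2(c) = -1: this is the
    excluded case. *)

Lemma homsP (gT hT : finGroupType) (f : {ffun gT -> hT}) :
  reflect (forall a b, f (a * b) = f a * f b) (f \in homs gT hT).
Proof.
rewrite inE; apply: (iffP morphicP) => h a b; last by move=> _ _; apply: h.
by rewrite h ?inE.
Qed.

Lemma homs1 (gT hT : finGroupType) (f : {ffun gT -> hT}) : f \in homs gT hT ->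
  f 1 = 1.
Proof. by move/homsP=> h; apply: (mulgI (f 1)); rewrite -h !mulg1. Qed.

Lemma homsX (gT hT : finGroupType) (f : {ffun gT -> hT}) : f \in homs gT hT ->
  forall a n, f (a ^+ n) = f a ^+ n.
Proof.
move=> fH a; elim=> [|n IH]; first by rewrite !expg0 homs1.
by rewrite !expgS -IH; apply/homsP.
Qed.

Section CyclicTimes.
Variables (m : nat) (A0 H : finGroupType).
Hypothesis m_gt1 : (1 < m)%N.

Definition cent_image (f : {ffun A0 -> H}) : {group H} :=
  'C([set f b | b : A0])%G.

Lemma cent_imageP (f : {ffun A0 -> H}) x : reflect (forall b, commute x (f b))
  (x \in cent_image f).
Proof.
apply: (iffP centP) => [h b|h y /imsetP[b _ ->]] //.
by apply: h; apply: imset_f.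
Qed.

(** Such a homomorphism amounts to its restriction f to [A0] and the image x of the generator of
    ['Z_m], subject to x^m = 1 and x centralizing the image of f. *)
Lemma card_homs_cyclic_times :
  #|homs ('Z_m * A0)%type H| =
    (\sum_(f in homs A0 H) #|'Ldiv_m(cent_image f)|)%N.
Proof.
have Zm : (Zp_trunc m).+2 = m by apply: Zp_cast.
pose res (h : {ffun 'Z_m * A0 -> H}) : {ffun A0 -> H} := [ffun b => h (1, b)].
rewrite -sum1_card (partition_big res (mem (homs A0 H))) /=; last first.
  move=> h /homsP hM; apply/homsP=> a b; rewrite !ffunE -hM; congr (h _).
  by congr (_, _); rewrite mulg1.
apply: eq_bigr => f fH; rewrite sum1dep_card.
pose ev (h : {ffun 'Z_m * A0 -> H}) := h (Zp1 : 'Z_m, 1).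
have powp k : ((Zp1 : 'Z_m, 1 : A0) ^+ k = (Zp1 ^+ k, 1)).
  by elim: k => [|k IH] //; rewrite !expgS IH; congr (_, _); rewrite mulg1.
have dec h : h \in homs ('Z_m * A0)%type H -> forall i b,
  h (i, b) = ev h ^+ i * res h b.
  move=> hH i b; rewrite /ev -homsX // ffunE; move/homsP: hH => <-; congr (h _).
  rewrite powp.
  by congr (_, _); rewrite ?mul1g // Zp1_expgz mulg1.
have inj : {in [set h | h \in homs ('Z_m * A0)%type H & res h == f] &,
  injective ev}.
  move=> h h'; rewrite !inE => /andP[hH /eqP rh] /andP[hH' /eqP rh'] e.
  by apply/ffunP=> -[i b]; rewrite !dec ?inE // rh rh' e.
rewrite -(card_in_imset inj); apply: eq_card => x; apply/imsetP/idP.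
  case=> h; rewrite inE => /andP[hH /eqP rh] ->.
  rewrite !inE; apply/andP; split.
    apply/cent_imageP=> b; rewrite -rh ffunE /ev /commute; move/homsP: hH => hM.
    by rewrite -!hM; congr (h (_, _)); rewrite ?mulg1 ?mul1g.
  rewrite /ev -homsX //; apply/eqP; rewrite -[RHS](homs1 hH); congr (h _).
  rewrite powp.
  congr (_, _); have := expg_order (Zp1 : 'Z_m).
  by rewrite order_Zp1 {1}Zm.
rewrite !inE => /andP[/cent_imageP xC /eqP xm].
pose h : {ffun 'Z_m * A0 -> H} := [ffun ib => x ^+ (ib.1 : 'Z_m) * f ib.2].
have fM := homsP _ fH.
exists h; last by rewrite /ev ffunE /= (homs1 fH) mulg1 /= ?expg1.
rewrite inE; apply/andP; split.
  apply/homsP=> -[i b] [j c]; rewrite !ffunE /= fM.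
  have -> : x ^+ ((i + j) %% (Zp_trunc m).+2) = x ^+ i * x ^+ j.
    by rewrite -expgD expg_mod // Zm.
  rewrite !mulgA; congr (_ * _); rewrite -!mulgA; congr (_ * _).
  exact/commute_sym/commuteX/commute_sym/xC.
apply/eqP/ffunP=> b; rewrite !ffunE /=.
by rewrite mul1g.
Qed.

(** [H] acts on [homs A0 H] by conjugation. With C = [cent_image f], the orbit of f contributes |H :
    C| times the number of solutions of x^m = 1 in C. The latter is divisible by |C|_p by Frobenius'
    theorem. *)
Lemma part_dvd_homs p t : prime p -> m = (p ^ t)%N -> (#|[set: H]|`_p %| m)%N ->
  (#|[set: H]|`_p %| #|homs ('Z_m * A0)%type H|)%N.
Proof.
move=> p_pr em Hm; rewrite card_homs_cyclic_times.
pose cj (f : {ffun A0 -> H}) x : {ffun A0 -> H} := [ffun b => f b ^ x].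
have cj1 f : cj f 1 = f by apply/ffunP=> b; rewrite ffunE conjg1.
have cjM f : act_morph cj f.
  by move=> x y; apply/ffunP=> b; rewrite !ffunE conjgM.
have cj1' : cj^~ 1 =1 id by [].
pose to := TotalAction cj1' cjM.
have actS : [acts [set: H], on homs A0 H | to].
  apply/subsetP=> x _; rewrite !inE; apply/subsetP=> f fH; rewrite inE.
  by apply/homsP=> a b; rewrite !ffunE (homsP _ fH) conjMg.
rewrite (set_partition_big _ (orbit_partition actS)).
apply: dvdn_sum => O /imsetP[f fH ->].
have cent_imageJ x : cent_image (cj f x) = (cent_image f :^ x)%G.
  apply/group_inj; rewrite /= -centJ; congr 'C(_); apply/setP=> y.
  apply/imsetP/imsetP=> [[b _ ->]|[z /imsetP[b _ ->] ->]].
    by exists (f b); rewrite ?ffunE ?imset_f.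
  by exists b; rewrite ?ffunE.
rewrite (eq_bigr (fun _ => #|'Ldiv_m(cent_image f)|)); last first.
  move=> g /imsetP[x _ ->]; rewrite [cent_image _](cent_imageJ x) /=.
  rewrite -(cardJg ('Ldiv_m(cent_image f)) x); apply: eq_card => y.
  by rewrite mem_conjg !inE mem_conjg -conjXg -{2}(conj1g x^-1)
    (inj_eq (conjg_inj _)).
rewrite sum_nat_const card_orbit.
have -> : 'C_[set: H][f | to] = cent_image f.
  rewrite setTI; apply/setP=> x; apply/astab1P/cent_imageP => [e b|h].
    have /ffunP/(_ b) := e; rewrite ffunE => /conjg_fixP.
    by move/commgP/commute_sym.
  apply/ffunP=> b; rewrite ffunE; apply/conjg_fixP.
  exact/commgP/commute_sym/h.
have [C eC] : exists C : {group H}, C = cent_image f by exists (cent_image f).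
rewrite -eC -(Lagrange (subsetT C)) partnM ?cardG_gt0 ?indexg_gt0 // mulnC.
apply: dvdn_mul; first exact: dvdn_part.
(* Frobenius' theorem wants an exponent dividing |C|. Since m is a p-power divisible by |H|_p,
   replacing m by |C|_p does not change the solutions in C. *)
have -> : 'Ldiv_m(C) = 'Ldiv_(#|C|`_p)(C).
  apply/setP=> x; rewrite !inE; case xC: (x \in C) => //=.
  rewrite -!order_dvdn; apply/idP/idP => [xm|xc].
    have xp : p.-nat #[x] by rewrite (pnat_dvd xm) // em pnatX pnat_id.
    by rewrite -(part_pnat_id xp) partn_dvd ?cardG_gt0 ?order_dvdG.
  apply: dvdn_trans Hm; apply: dvdn_trans xc _.
  by rewrite partn_dvd ?cardG_gt0 // cardSg ?subsetT.
by apply: Frobenius_Ldiv; apply: dvdn_part.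
Qed.
End CyclicTimes.

Local Open Scope ring_scope.

(** * p-adic valuation of rational numbers *)

Section Padic.
Variable p : nat.
Hypothesis p_pr : prime p.

(* [pint x]: x lies in the localization Z_(p); [vge e x]: v_p(x) >= e, which *)
(* holds for x = 0; [veq e x]: x <> 0 and v_p(x) = e.                        *)
Definition pint (x : rat) : Prop :=
  exists a m : int, ~~ (p %| m)%Z /\ x = a%:~R / m%:~R.

Definition vge (e : int) (x : rat) : Prop := pint (x * p%:R ^ (- e)).

Definition veq (e : int) (x : rat) : Prop :=
  [/\ x != 0, vge e x & vge (- e) x^-1].

Let pz : (p%:R : rat) != 0.
Proof. by rewrite pnatr_eq0 -lt0n prime_gt0. Qed.

Lemma ndvdz_neq0 m : ~~ (p %| m)%Z -> (m%:~R : rat) != 0.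
Proof. by apply: contraNneq => /eqP; rewrite intr_eq0 => /eqP->;
  rewrite dvdz0. Qed.

Lemma ndvdzM m n : ~~ (p %| m)%Z -> ~~ (p %| n)%Z -> ~~ (p %| m * n)%Z.
Proof. by rewrite !dvdzE abszM Euclid_dvdM // negb_or => -> ->. Qed.

Lemma ndvdz1 : ~~ (p %| 1)%Z.
Proof. by rewrite dvdzE /= dvdn1 neq_ltn prime_gt1 ?orbT. Qed.

Lemma pint_int (a : int) : pint a%:~R.
Proof. by exists a, 1; rewrite ndvdz1 divr1. Qed.

Lemma pint_nat (a : nat) : pint a%:R.
Proof. exact: (pint_int a). Qed.

Lemma pintM x y : pint x -> pint y -> pint (x * y).
Proof.
move=> [a [m [pm ->]]] [b [n [pn ->]]]; exists (a * b), (m * n); split.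
  exact: ndvdzM.
by rewrite !intrM invfM mulrACA.
Qed.

Lemma pintD x y : pint x -> pint y -> pint (x + y).
Proof.
move=> [a [m [pm ->]]] [b [n [pn ->]]]; exists (a * n + b * m), (m * n); split.
  exact: ndvdzM.
by rewrite addf_div ?ndvdz_neq0 // intrD !intrM.
Qed.

Lemma pintN x : pint x -> pint (- x).
Proof. by move=> h; rewrite -mulN1r; apply: pintM h;
  apply: (pint_int (-1)). Qed.

Lemma vgeM e f x y : vge e x -> vge f y -> vge (e + f) (x * y).
Proof. by move=> hx hy; rewrite /vge opprD expfzDr // mulrACA;
  apply: pintM. Qed.

Lemma vgeD e x y : vge e x -> vge e y -> vge e (x + y).
Proof. by move=> hx hy; rewrite /vge mulrDl; apply: pintD. Qed.

Lemma vge0 e : vge e 0.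
Proof. by rewrite /vge mul0r; apply: (pint_nat 0). Qed.

Lemma vgeN e x : vge e x -> vge e (- x).
Proof. by move=> h; rewrite /vge mulNr; apply: pintN. Qed.

Lemma vgeB e x y : vge e x -> vge e y -> vge e (x - y).
Proof. by move=> hx hy; apply: vgeD hx (vgeN hy). Qed.

Lemma vge_sum (I : Type) (r : seq I) (P : pred I) (f : I -> rat) e :
  (forall i, P i -> vge e (f i)) -> vge e (\sum_(i <- r | P i) f i).
Proof.
move=> h; elim/big_rec: _ => [|i x Pi hx]; first exact: vge0.
by apply: vgeD hx; apply: h.
Qed.

Lemma pint_vge x : pint x -> vge 0 x.
Proof. by rewrite /vge oppr0 expr0z mulr1. Qed.

Lemma vge_pint x : vge 0 x -> pint x.
Proof. by rewrite /vge oppr0 expr0z mulr1. Qed.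

Lemma vgeW e f x : e <= f -> vge f x -> vge e x.
Proof.
move=> le h; rewrite /vge (_ : - e = - f + (f - e)); last by lia.
rewrite expfzDr // mulrA; apply: pintM h _.
have [k ->] : exists k : nat, f - e = k by exists `|f - e|%N; lia.
by rewrite -exprnP -natrX; apply: pint_nat.
Qed.

Lemma vge_p e : vge e (p%:R ^ e).
Proof. by rewrite /vge -expfzDr // subrr expr0z; apply: (pint_nat 1). Qed.

Lemma veq_p e : veq e (p%:R ^ e).
Proof.
have nz := expfz_neq0 e pz; split=> //; first exact: vge_p.
have -> : (p%:R ^ e)^-1 = p%:R ^ (- e) :> rat.
  by apply: (mulfI nz); rewrite divff // -expfzDr // subrr.
exact: vge_p.
Qed.

Lemma veq_vge e x : veq e x -> vge e x. Proof. by case. Qed.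

Lemma veqM e f x y : veq e x -> veq f y -> veq (e + f) (x * y).
Proof.
move=> [x0 hx hx'] [y0 hy hy']; split; first by rewrite mulf_neq0.
  exact: vgeM.
by rewrite invfM opprD; apply: vgeM.
Qed.

Lemma veqV e x : veq e x -> veq (- e) x^-1.
Proof. by move=> [x0 hx hx']; split; rewrite ?invr_eq0 // opprK invrK. Qed.

Lemma veqN e x : veq e x -> veq e (- x).
Proof. by move=> [x0 hx hx']; split; rewrite ?oppr_eq0 ?invrN //;
  apply: vgeN. Qed.

Lemma veq_ndvd (n : nat) : ~~ (p %| n)%N -> veq 0 n%:R.
Proof.
move=> pn; have n0 : (n%:R : rat) != 0.
  by rewrite pnatr_eq0; apply: contraNneq pn => ->; rewrite dvdn0.
split=> //; first by apply: pint_vge; apply: pint_nat.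
by rewrite oppr0; apply: pint_vge; exists 1, (n : int); rewrite div1r.
Qed.

Lemma veq_nat (n : nat) : (0 < n)%N -> veq (logn p n)%:Z n%:R.
Proof.
move=> n0; have [m cop e] := pfactor_coprime p_pr n0.
rewrite {2}e natrM -[X in veq X]add0r; apply: veqM.
  by apply: veq_ndvd; rewrite -prime_coprime.
by rewrite natrX exprnP; apply: veq_p.
Qed.

(** All upper bounds on valuations, hence also their uniqueness, reduce to this. *)
Lemma not_vge_pos (k : nat) : ~ vge k.+1 1.
Proof.
rewrite /vge mul1r => -[a [m [pm e]]].
have mz := ndvdz_neq0 pm.
have : (m%:~R : rat) = (a * (p ^ k.+1)%:Z)%:~R.
  rewrite intrM -pmulrn natrX exprnP;
    apply: (mulIf (expfz_neq0 (- k.+1%:Z) pz)).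
  by rewrite -mulrA -expfzDr // subrr expr0z mulr1 e mulrC mulfVK.
move/intr_inj => em; move/negP: pm; apply; rewrite em.
by apply: dvdz_mull; rewrite dvdzE /= expnS dvdn_mulr.
Qed.

Lemma vge_le_veq e f x : veq e x -> vge f x -> f <= e.
Proof.
case=> x0 _ hx' hf; rewrite leNgt; apply/negP=> lt.
have := vgeM hf hx'; rewrite divff //.
have [k ->] : exists k : nat, f - e = k.+1 by exists `|f - e|.-1%N; lia.
exact: not_vge_pos.
Qed.

Lemma veq_inj e f x : veq e x -> veq f x -> e = f.
Proof.
move=> he hf; apply/eqP; rewrite eq_le.
by rewrite (vge_le_veq hf (veq_vge he)) (vge_le_veq he (veq_vge hf)).
Qed.

Lemma veq_1D z : vge 1 z -> veq 0 (1 + z).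
Proof.
rewrite /vge => -[a [m [pm e]]].
have mz := ndvdz_neq0 pm.
have ez : 1 + z = (m + a * p)%:~R / m%:~R.
  rewrite intrD mulrDl divff //; congr (_ + _).
  apply: (mulIf (expfz_neq0 (- 1) pz)); rewrite e intrM.
  by rewrite exprN1 -pmulrn [RHS]mulrAC mulfK.
have pmp : ~~ (p %| m + a * p)%Z by rewrite rpredDr // dvdz_mull.
have nz := ndvdz_neq0 pmp.
rewrite ez; split; first by rewrite mulf_neq0 ?invr_eq0.
  by apply: pint_vge; exists (m + a * p), m.
by rewrite oppr0 invf_div; apply: pint_vge; exists m, (m + a * p).
Qed.

Lemma veqD e x y : veq e x -> vge (e + 1) y -> veq e (x + y).
Proof.
move=> hx hy; have [x0 _ hx'] := hx.
have -> : x + y = x * (1 + y / x) by rewrite mulrDr mulr1 mulrC mulfVK.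
rewrite -[X in veq X]addr0; apply: veqM hx (veq_1D _).
by have := vgeM hy hx'; rewrite addrAC subrr add0r.
Qed.

End Padic.

(** * Power series and logarithmic derivatives *)

(** Power series are functions [nat -> rat]; this is their product. Statements are often restricted
    to degrees up to n, since integrality will only be known there. *)
Definition conv (f g : nat -> rat) (n : nat) : rat :=
  \sum_(i < n.+1) f i * g (n - i)%N.

(** The series f(x^D). *)
Definition subst (D : nat) (f : nat -> rat) (n : nat) : rat :=
  if (D %| n)%N then f (n %/ D)%N else 0.

(** The equation x f' = L f solved for the coefficient L_k, when f has constant term 1. The argument
    [m] is fuel for the course-of-values recursion; any m > k gives the same value
    ([logder_rec_fuel]). *)
Fixpoint logder_rec (m : nat) (f : nat -> rat) (k : nat) : rat :=
  if m is m'.+1 then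
    k%:R * f k - \sum_(i < k) logder_rec m' f i * f (k - i)%N
  else 0.

(* The coefficients of x f'(x) / f(x), for f 0 = 1. *)
Definition logder (f : nat -> rat) (k : nat) : rat := logder_rec k.+1 f k.

(** The coefficients of log f for f 0 = 1; at k = 0 the value is 0, as it should be. *)
Definition log_coef (f : nat -> rat) (k : nat) : rat := logder f k / k%:R.

(** Truncation to polynomials transfers commutativity and associativity from the polynomial ring. *)
Lemma convE (f g : nat -> rat) N n : (n < N)%N ->
  conv f g n = ((\poly_(i < N) f i) * (\poly_(i < N) g i))`_n.
Proof.
move=> nN; rewrite coefM; apply: eq_bigr => i _; rewrite !coef_poly.
have := ltn_ord i; rewrite ltnS => le_in.
by rewrite (leq_ltn_trans le_in nN) (leq_ltn_trans (leq_subr _ _) nN).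
Qed.

Lemma conv_cutoff (f f' g g' : nat -> rat) n :
    (forall k, (k <= n)%N -> f k = f' k) ->
      (forall k, (k <= n)%N -> g k = g' k) ->
  conv f g n = conv f' g' n.
Proof.
move=> ef eg; apply: eq_bigr => i _; rewrite ef ?eg ?leq_subr //.
by rewrite -ltnS.
Qed.

Lemma convC f g n : conv f g n = conv g f n.
Proof. by rewrite !(@convE _ _ n.+1) // mulrC. Qed.

Lemma convA f g h n : conv f (conv g h) n = conv (conv f g) h n.
Proof.
have aux (u v w : nat -> rat) : conv (conv u v) w n =
    ((\poly_(i < n.+1) u i) * (\poly_(i < n.+1) v i) *
      (\poly_(i < n.+1) w i))`_n.
  rewrite coefM; apply: eq_bigr => i _.
  rewrite (@convE _ _ n.+1) // coef_poly.
  by rewrite (leq_ltn_trans (leq_subr _ _) (ltnSn n)).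
by rewrite convC !aux; congr (_`_n); rewrite mulrC mulrA.
Qed.

Lemma conv0 f g : conv f g 0 = f 0%N * g 0%N.
Proof. by rewrite /conv big_ord1 subnn. Qed.

Lemma convDl f f' g n : conv (fun k => f k + f' k) g n = conv f g n +
  conv f' g n.
Proof. by rewrite -big_split; apply: eq_bigr => i _; rewrite mulrDl. Qed.

Lemma logder_rec_fuel m f k : (k < m)%N -> logder_rec m f k = logder f k.
Proof.
suff aux m1 m2 j : (j < m1)%N -> (j < m2)%N ->
  logder_rec m1 f j = logder_rec m2 f j.
  by move=> km; apply: aux.
elim: m1 m2 j => // m1 IH [//|m2] j; rewrite !ltnS => h1 h2 /=.
congr (_ - _); apply: eq_bigr => i _; congr (_ * _).
by apply: IH; apply: leq_trans (ltn_ord i) _.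
Qed.

Lemma logderE f k : f 0%N = 1 -> k%:R * f k = conv (logder f) f k.
Proof.
move=> f0; rewrite /conv big_ord_recr /= subnn f0 mulr1 {2}/logder /=.
rewrite [X in _ + (_ - X)](eq_bigr (fun i : 'I_k => logder f i * f (k - i)%N))
  => [|i _].
  by rewrite addrC subrK.
by rewrite logder_rec_fuel.
Qed.

Lemma logder_0 f : logder f 0 = 0.
Proof. by rewrite /logder /= mul0r big_ord0 subr0. Qed.

Lemma conv_cancel f b c n : f 0%N = 1 ->
    (forall k, (k <= n)%N -> conv b f k = conv c f k) ->
  forall k, (k <= n)%N -> b k = c k.
Proof.
move=> f0 h k; elim/ltn_ind: k => k IH kn.
have := h k kn; rewrite /conv !big_ord_recr /= subnn f0 !mulr1.
rewrite (eq_bigr (fun i : 'I_k => c i * f (k - i)%N)) => [/addrI //|i _].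
by rewrite IH // ltnW // (leq_trans (ltn_ord i)).
Qed.

(** The way to compute a logarithmic derivative: guess it and check the equation up to degree n. *)
Lemma logder_unique f b n : f 0%N = 1 ->
    (forall k, (k <= n)%N -> k%:R * f k = conv b f k) ->
  forall k, (k <= n)%N -> logder f k = b k.
Proof.
move=> f0 h; apply: (@conv_cancel f _ _ n f0) => k kn.
by rewrite -h // logderE.
Qed.

Lemma eq_logder f g n : (forall k, (k <= n)%N -> f k = g k) -> g 0%N = 1 ->
  forall k, (k <= n)%N -> logder f k = logder g k.
Proof.
move=> e g0; apply: logder_unique => [|k kn]; first by rewrite e.
rewrite e // logderE //; apply: conv_cutoff => // j jk.
by rewrite e // (leq_trans jk).
Qed.

Lemma logder_conv f g : f 0%N = 1 -> g 0%N = 1 ->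
  forall n, logder (conv f g) n = logder f n + logder g n.
Proof.
move=> f0 g0 n; apply: (@logder_unique (conv f g)
  (fun k => logder f k + logder g k) n) => //.
  by rewrite conv0 f0 g0 mulr1.
move=> k _; rewrite convDl.
transitivity (conv (fun i => i%:R * f i) g k + conv f (fun i => i%:R * g i) k).
  rewrite /conv mulr_sumr -big_split; apply: eq_bigr => i _ /=.
  have := ltn_ord i; rewrite ltnS => le_ik.
  by rewrite -{1}(subnKC le_ik) natrD; ring.
congr (_ + _).
  rewrite convA; apply: conv_cutoff => // j _; exact: logderE.
rewrite [RHS]convC -convA; apply: conv_cutoff => // j _.
by rewrite convC; apply: logderE.
Qed.

Lemma logder_inj f g n : f 0%N = 1 -> g 0%N = 1 ->
    (forall k, (k <= n)%N -> logder f k = logder g k) ->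
  forall k, (k <= n)%N -> f k = g k.
Proof.
move=> f0 g0 e k; elim/ltn_ind: k => -[_ _|k IH kn]; first by rewrite f0 g0.
have nz : (k.+1%:R : rat) != 0 by rewrite pnatr_eq0.
apply: (mulfI nz); rewrite !logderE // /conv [LHS]big_ord_recl [RHS]big_ord_recl
  /= !logder_0 !mul0r.
congr (_ + _); apply: eq_bigr => i _; rewrite /bump /= e ?IH //; last first.
- by have := ltn_ord i; lia.
- by have := ltn_ord i; lia.
- by have := ltn_ord i; lia.
Qed.

Lemma subst0 D f : subst D f 0 = f 0%N.
Proof. by rewrite /subst dvdn0 div0n. Qed.

Lemma sum_subst D f (G : nat -> rat) n : (0 < D)%N ->
  \sum_(i < n.+1) subst D f i * G i = \sum_(h < n.+1 | (D * h <= n)%N) f h *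
    G (D * h)%N.
Proof.
move=> D0; rewrite -(big_mkord xpredT (fun i => subst D f i * G i)).
rewrite -(big_mkord (fun h => (D * h <= n)%N) (fun h => f h * G (D * h)%N)).
rewrite (bigID (fun i => D %| i)%N) /= addrC big1 ?add0r; last first.
  by move=> i /negPf nd; rewrite /subst nd mul0r.
rewrite -[LHS]big_filter -[RHS]big_filter.
have -> : [seq i <- index_iota 0 n.+1 | D %| i]%N =
   map (muln D) [seq h <- index_iota 0 n.+1 | D * h <= n]%N.
  apply: (@irr_sorted_eq _ ltn) => //.
  - exact: ltn_trans.
  - by move=> x; rewrite /= ltnn.
  - by apply: sorted_filter (iota_ltn_sorted _ _); apply: ltn_trans.
  - rewrite sorted_map; apply: sub_sorted (_ : sorted ltn _) => [x y|].
      by rewrite /= ltn_pmul2l.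
    by apply: sorted_filter (iota_ltn_sorted _ _); apply: ltn_trans.
  move=> i; rewrite mem_filter mem_index_iota leq0n andTb; apply/andP/mapP.
    case=> /dvdnP[h ->] lt; exists h; last by rewrite mulnC.
    rewrite mem_filter mem_index_iota mulnC -ltnS lt /=.
    by apply: leq_ltn_trans lt; rewrite leq_pmulr.
  case=> h; rewrite mem_filter => /andP[lt _] ->.
  by rewrite dvdn_mulr // ltnS.
rewrite big_map; apply: eq_bigr => h _.
by rewrite /subst dvdn_mulr // mulKn.
Qed.

Lemma conv_substl D f g n : (0 < D)%N ->
  conv (subst D f) g n = \sum_(h < n.+1 | (D * h <= n)%N) f h * g (n - D * h)%N.
Proof. by move=> D0; rewrite /conv (sum_subst f (fun i => g (n - i)%N)). Qed.

Lemma logder_subst D f k : (0 < D)%N -> f 0%N = 1 ->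
  logder (subst D f) k = if (D %| k)%N then D%:R * logder f (k %/ D)%N else 0.
Proof.
move=> D0 f0; pose b := subst D (fun j => D%:R * logder f j).
apply: (@logder_unique _ b k) => // [|n _]; first by rewrite subst0.
rewrite conv_substl // {1}/subst; case: ifPn => [/dvdnP[m ->]|nd].
  rewrite mulnK // natrM mulrAC logderE // mulrC mulr_sumr /conv.
  rewrite (big_ord_widen (m * D).+1
    (fun i => D%:R * (logder f i * f (m - i)%N))) ?ltnS ?leq_pmulr //.
  apply: eq_big => i; first by rewrite ltnS -(leq_pmul2l D0) [(D * m)%N]mulnC.
  move=> le; rewrite mulrA; congr (_ * _).
  by rewrite [(D * i)%N]mulnC -mulnBl /subst dvdn_mull // mulnK.
rewrite mulr0 big1 // => h le.
rewrite /subst ifN ?mulr0 //; apply: contra nd => dv.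
by rewrite -(subnK le) dvdn_add ?dvdn_mulr.
Qed.

Lemma log_coef_subst D f k : (0 < D)%N -> f 0%N = 1 ->
  log_coef (subst D f) k = if (D %| k)%N then log_coef f (k %/ D)%N else 0.
Proof.
move=> D0 f0; rewrite /log_coef logder_subst //; case: ifP => [/dvdnP[m ->]|_];
  last by rewrite mul0r.
have nz : (D%:R : rat) != 0 by rewrite pnatr_eq0 -lt0n.
by rewrite mulnK // natrM invfM [m%:R^-1 * _]mulrC [D%:R * _]mulrC -mulrA
  mulVKf.
Qed.

Lemma log_coef_conv f g n : f 0%N = 1 -> g 0%N = 1 ->
  log_coef (conv f g) n = log_coef f n + log_coef g n.
Proof. by move=> f0 g0; rewrite /log_coef logder_conv // mulrDl. Qed.

Lemma log_coef_inj f g n : f 0%N = 1 -> g 0%N = 1 ->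
    (forall k, (0 < k <= n)%N -> log_coef f k = log_coef g k) ->
  forall k, (k <= n)%N -> f k = g k.
Proof.
move=> f0 g0 e; apply: logder_inj => // -[_|k kn]; first by rewrite !logder_0.
have nz : (k.+1%:R : rat)^-1 != 0 by rewrite invr_eq0 pnatr_eq0.
by apply: (mulIf nz); apply: e.
Qed.

(** * Counting representations by peeling off irreducibles *)

Section Intertwiners.
Variables (aT : finGroupType) (F : finFieldType).

(** A boolean on plain functions, so that the representations of a given degree, 0 included, form a
    finite set to be counted. *)
Definition is_rep n (X : aT -> 'M[F]_n) : bool :=
  (X 1%g == 1%:M) && [forall a, forall b, X (a * b)%g == X a *m X b].

Definition mxhom m n (X : aT -> 'M[F]_m) (Y : aT -> 'M[F]_n) :
    {set 'M[F]_(m, n)} :=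
  [set B | [forall a, X a *m B == B *m Y a]].

Definition irred n (X : aT -> 'M[F]_n) : Prop :=
  [/\ is_rep X, (0 < n)%N &
    forall U : 'M[F]_n, (forall a, (U *m X a <= U)%MS) -> U != 0 -> row_full U].

Definition dsum m n (X : aT -> 'M[F]_m) (Y : aT -> 'M[F]_n) a : 'M[F]_(m + n) :=
  block_mx (X a) 0 0 (Y a).

Lemma is_repP n (X : aT -> 'M[F]_n) :
  reflect (X 1%g = 1%:M /\ forall a b, X (a * b)%g = X a *m X b) (is_rep X).
Proof.
apply: (iffP andP) => -[/eqP X1 XM]; split; rewrite ?X1 //.
  by move=> a b; apply/eqP; move/forallP/(_ a)/forallP: XM.
by apply/forallP=> a; apply/forallP=> b; rewrite XM.
Qed.

Lemma mxhomP m n (X : aT -> 'M[F]_m) (Y : aT -> 'M[F]_n) B :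
  reflect (forall a, X a *m B = B *m Y a) (B \in mxhom X Y).
Proof. by rewrite inE; apply: (iffP forallP) => h a; apply/eqP. Qed.

Lemma mxhom0 m n (X : aT -> 'M[F]_m) (Y : aT -> 'M[F]_n) : 0 \in mxhom X Y.
Proof. by apply/mxhomP=> a; rewrite mulmx0 mul0mx. Qed.

Lemma mxhomD m n (X : aT -> 'M[F]_m) (Y : aT -> 'M[F]_n) B C :
  B \in mxhom X Y -> C \in mxhom X Y -> B + C \in mxhom X Y.
Proof.
by move=> /mxhomP hB /mxhomP hC; apply/mxhomP=> a;
  rewrite mulmxDr mulmxDl hB hC.
Qed.

Lemma mxhomB m n (X : aT -> 'M[F]_m) (Y : aT -> 'M[F]_n) B C :
  B \in mxhom X Y -> C \in mxhom X Y -> B - C \in mxhom X Y.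
Proof.
by move=> /mxhomP hB /mxhomP hC; apply/mxhomP=> a;
  rewrite mulmxBr mulmxBl hB hC.
Qed.

Lemma mxhom_comp m n p (X : aT -> 'M[F]_m) (Y : aT -> 'M[F]_n)
    (Z : aT -> 'M[F]_p) B C :
  B \in mxhom X Y -> C \in mxhom Y Z -> B *m C \in mxhom X Z.
Proof.
move=> /mxhomP hB /mxhomP hC; apply/mxhomP=> a.
by rewrite mulmxA hB -mulmxA hC mulmxA.
Qed.

Lemma mxhom1 m (X : aT -> 'M[F]_m) : 1%:M \in mxhom X X.
Proof. by apply/mxhomP=> a; rewrite mulmx1 mul1mx. Qed.

Lemma is_rep_dsum m n (X : aT -> 'M[F]_m) (Y : aT -> 'M[F]_n) :
  is_rep (dsum X Y) = is_rep X && is_rep Y.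
Proof.
apply/is_repP/andP.
  case; rewrite {1}/dsum scalar_mx_block => /eq_block_mx[X1 _ _ Y1] M.
  split; apply/is_repP; split=> // a b; have := M a b; rewrite mulmx_block;
  by rewrite !(mul0mx, mulmx0, addr0, add0r) => /eq_block_mx[].
case=> /is_repP[X1 XM] /is_repP[Y1 YM]; split.
  by rewrite /dsum X1 Y1 -scalar_mx_block.
move=> a b; rewrite /dsum mulmx_block XM YM.
by rewrite !(mul0mx, mulmx0, addr0, add0r).
Qed.

Lemma card_mxhom_dsumr l m n (Z : aT -> 'M[F]_l) (X : aT -> 'M[F]_m)
    (Y : aT -> 'M[F]_n) :
  #|mxhom Z (dsum X Y)| = (#|mxhom Z X| * #|mxhom Z Y|)%N.
Proof.
rewrite -cardsX.
have inj : injective (fun BC : 'M[F]_(l, m) * 'M[F]_(l, n) => row_mx BC.1 BC.2).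
  by move=> [B C] [B' C'] /= /eq_row_mx[-> ->].
rewrite -(card_imset _ inj); apply: eq_card => B.
rewrite -[B]hsubmxK; set B1 := lsubmx B; set B2 := rsubmx B.
have -> : (row_mx B1 B2 \in mxhom Z (dsum X Y)) =
    (B1 \in mxhom Z X) && (B2 \in mxhom Z Y).
  apply/mxhomP/andP=> [h | [/mxhomP h1 /mxhomP h2] a].
    split; apply/mxhomP=> a; have := h a;
      rewrite /dsum mul_mx_row mul_row_block;
    by rewrite !(mul0mx, mulmx0, addr0, add0r) => /eq_row_mx[].
  rewrite /dsum mul_mx_row mul_row_block.
  by rewrite !(mul0mx, mulmx0, addr0, add0r) h1 h2.
apply/idP/imsetP => [h | [[C1 C2]]]; first by exists (B1, B2); rewrite ?in_setX.
by rewrite in_setX /= => h /eq_row_mx[-> ->].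
Qed.

Lemma card_mxhom_dsuml l m n (Z : aT -> 'M[F]_l) (X : aT -> 'M[F]_m)
    (Y : aT -> 'M[F]_n) :
  #|mxhom (dsum X Y) Z| = (#|mxhom X Z| * #|mxhom Y Z|)%N.
Proof.
rewrite -cardsX.
have inj : injective (fun BC : 'M[F]_(m, l) * 'M[F]_(n, l) => col_mx BC.1 BC.2).
  by move=> [B C] [B' C'] /= /eq_col_mx[-> ->].
rewrite -(card_imset _ inj); apply: eq_card => B.
rewrite -[B]vsubmxK; set B1 := usubmx B; set B2 := dsubmx B.
have -> : (col_mx B1 B2 \in mxhom (dsum X Y) Z) =
    (B1 \in mxhom X Z) && (B2 \in mxhom Y Z).
  apply/mxhomP/andP=> [h | [/mxhomP h1 /mxhomP h2] a].
    split; apply/mxhomP=> a; have := h a;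
      rewrite /dsum mul_block_col mul_col_mx;
    by rewrite !(mul0mx, mulmx0, addr0, add0r) => /eq_col_mx[].
  rewrite /dsum mul_block_col mul_col_mx.
  by rewrite !(mul0mx, mulmx0, addr0, add0r) h1 h2.
apply/idP/imsetP => [h | [[C1 C2]]]; first by exists (B1, B2); rewrite ?in_setX.
by rewrite in_setX /= => h /eq_col_mx[-> ->].
Qed.

Definition conjr n (g : 'M[F]_n) (X : aT -> 'M[F]_n) a := g *m X a *m invmx g.

Lemma is_rep_conjr n (g : 'M[F]_n) X :
  g \in unitmx -> is_rep X -> is_rep (conjr g X).
Proof.
move=> ug /is_repP[X1 XM]; apply/is_repP; rewrite /conjr; split.
  by rewrite X1 mulmx1 mulmxV.
by move=> a b; rewrite XM !mulmxA mulmxKV.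
Qed.

Lemma mxhom_conjr n (g : 'M[F]_n) X : g \in unitmx -> g \in mxhom (conjr g X) X.
Proof. by move=> ug; apply/mxhomP=> a; rewrite /conjr mulmxKV. Qed.

Lemma mxhom_conjrV n (g : 'M[F]_n) X :
  g \in unitmx -> invmx g \in mxhom X (conjr g X).
Proof. by move=> ug; apply/mxhomP=> a;
  rewrite /conjr !mulmxA mulVmx ?mul1mx. Qed.

Lemma card_mxhomr_iso m n (Z : aT -> 'M[F]_m) (X Y : aT -> 'M[F]_n) g :
  g \in unitmx -> g \in mxhom X Y -> #|mxhom Z X| = #|mxhom Z Y|.
Proof.
move=> ug hg.
have hg' : invmx g \in mxhom Y X.
  apply/mxhomP=> a; have /mxhomP/(_ a) h := hg.
  by rewrite -[LHS](mulKmx ug) [g *m _]mulmxA -h mulmxK.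
have inj (h : 'M_n) : h \in unitmx ->
  injective (fun B : 'M[F]_(m, n) => B *m h).
  by move=> uh B C /(can_inj (mulmxK uh)).
apply/eqP; rewrite eqn_leq; apply/andP; split.
  rewrite -(card_imset _ (inj _ ug)); apply/subset_leq_card/subsetP=> C.
  by case/imsetP=> B hB ->; apply: mxhom_comp hg.
have ug' : invmx g \in unitmx by rewrite unitmx_inv.
rewrite -(card_imset _ (inj _ ug')); apply/subset_leq_card/subsetP=> C.
by case/imsetP=> B hB ->; apply: mxhom_comp hg'.
Qed.

Lemma card_mxhoml_iso m n (Z : aT -> 'M[F]_m) (X Y : aT -> 'M[F]_n) g :
  g \in unitmx -> g \in mxhom X Y -> #|mxhom Y Z| = #|mxhom X Z|.
Proof.
move=> ug hg.
have hg' : invmx g \in mxhom Y X.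
  apply/mxhomP=> a; have /mxhomP/(_ a) h := hg.
  by rewrite -[LHS](mulKmx ug) [g *m _]mulmxA -h mulmxK.
have inj (h : 'M_n) : h \in unitmx ->
  injective (fun B : 'M[F]_(n, m) => h *m B).
  by move=> uh B C /(can_inj (mulKmx uh)).
apply/eqP; rewrite eqn_leq; apply/andP; split.
  rewrite -(card_imset _ (inj _ ug)); apply/subset_leq_card/subsetP=> C.
  by case/imsetP=> B hB ->; apply: mxhom_comp hg _.
have ug' : invmx g \in unitmx by rewrite unitmx_inv.
rewrite -(card_imset _ (inj _ ug')); apply/subset_leq_card/subsetP=> C.
by case/imsetP=> B hB ->; apply: mxhom_comp hg' _.
Qed.

Section Maschke.
Hypothesis nzA : #|aT|%:R != 0 :> F.

(** Maschke's averaging, which turns any matrix into an intertwiner. *)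
Definition avg m n (X : aT -> 'M[F]_m) (Y : aT -> 'M[F]_n) B :=
  #|aT|%:R^-1 *: \sum_a X a *m B *m Y a^-1%g.

Lemma avg_hom m n (X : aT -> 'M[F]_m) (Y : aT -> 'M[F]_n) B :
  is_rep X -> is_rep Y -> avg X Y B \in mxhom X Y.
Proof.
move=> /is_repP[X1 XM] /is_repP[Y1 YM]; apply/mxhomP=> b.
rewrite /avg -scalemxAr -scalemxAl; congr (_ *: _).
rewrite mulmx_sumr mulmx_suml (reindex_inj (mulgI b^-1%g)) /=.
apply: eq_bigr => a _.
by rewrite invMg invgK YM XM !mulmxA -XM mulgV X1 mul1mx.
Qed.

Lemma avg_compl l m n (W : aT -> 'M[F]_l) (X : aT -> 'M[F]_m)
  (Y : aT -> 'M[F]_n) B C :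
  C \in mxhom W X -> C *m avg X Y B = avg W Y (C *m B).
Proof.
move=> /mxhomP hC; rewrite /avg -scalemxAr mulmx_sumr; congr (_ *: _).
by apply: eq_bigr => a _; rewrite !mulmxA -hC.
Qed.

Lemma avg_compr l m n (W : aT -> 'M[F]_l) (X : aT -> 'M[F]_m)
  (Y : aT -> 'M[F]_n) B C :
  C \in mxhom Y W -> avg X Y B *m C = avg X W (B *m C).
Proof.
move=> /mxhomP hC; rewrite /avg -scalemxAl mulmx_suml; congr (_ *: _).
by apply: eq_bigr => a _; rewrite -!mulmxA hC.
Qed.

Lemma avg1 m (X : aT -> 'M[F]_m) : is_rep X -> avg X X 1%:M = 1%:M.
Proof.
move=> /is_repP[X1 XM]; rewrite /avg.
under eq_bigr => a _ do rewrite mulmx1 -XM mulgV X1.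
by rewrite sumr_const -scaler_nat scalerA mulVf ?scale1r.
Qed.

Lemma mxhom_retract m n (X : aT -> 'M[F]_m) (Y : aT -> 'M[F]_n) B :
    is_rep X -> is_rep Y -> B \in mxhom X Y -> row_free B ->
  exists2 C, C \in mxhom Y X & B *m C = 1%:M.
Proof.
move=> rX rY hB /row_freeP[C BC].
by exists (avg Y X C); [apply: avg_hom | rewrite (avg_compl _ _ hB) BC avg1].
Qed.

Lemma mxhom_section m n (X : aT -> 'M[F]_m) (Y : aT -> 'M[F]_n) C :
    is_rep X -> is_rep Y -> C \in mxhom Y X -> row_full C ->
  exists2 B, B \in mxhom X Y & B *m C = 1%:M.
Proof.
move=> rX rY hC /row_fullP[B BC].
by exists (avg X Y B); [apply: avg_hom | rewrite (avg_compr _ _ hC) BC avg1].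
Qed.

End Maschke.

(** Schur's lemma: the kernel of an intertwiner is invariant. *)
Lemma irred_mxhom_free m n (X : aT -> 'M[F]_m) (Y : aT -> 'M[F]_n) B :
  irred X -> B \in mxhom X Y -> B != 0 -> row_free B.
Proof.
case=> _ _ irX /mxhomP hB nzB; rewrite -kermx_eq0; apply: contraR nzB => nzK.
have/irX : forall a, (kermx B *m X a <= kermx B)%MS.
  by move=> a; apply/sub_kermxP; rewrite -mulmxA hB mulmxA mulmx_ker mul0mx.
move/(_ nzK)=> fK; rewrite -[B]mul1mx; apply/eqP/sub_kermxP.
by rewrite submx_full.
Qed.

Lemma irred_mxhom_full m n (X : aT -> 'M[F]_m) (Y : aT -> 'M[F]_n) C :
  irred X -> C \in mxhom Y X -> C != 0 -> row_full C.
Proof.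
case=> _ _ irX /mxhomP hC nzC; have/irX : forall a, (<<C>> *m X a <= <<C>>)%MS.
  by move=> a; rewrite (eqmxMr _ (genmxE _)) -hC genmxE submxMl.
rewrite -mxrank_eq0 genmxE mxrank_eq0 => /(_ nzC).
by rewrite /row_full genmxE.
Qed.

Lemma irred_mxhom_unit m (X : aT -> 'M[F]_m) B :
  irred X -> B \in mxhom X X -> B != 0 -> B \in unitmx.
Proof. by rewrite -row_free_unit; apply: irred_mxhom_free. Qed.

(** As B C = 1, the rows of B and a basis W of the kernel of C together form a basis of the whole
    space; in it B and C are the standard inclusion and projection. *)
Lemma split_form m n (B : 'M[F]_(m, m + n)) (C : 'M[F]_(m + n, m)) :
  B *m C = 1%:M -> exists2 g : 'M[F]_(m + n), g \in unitmx &
    B = row_mx 1%:M 0 *m g /\ C = invmx g *m col_mx 1%:M 0.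
Proof.
move=> BC.
have rC : \rank C = m.
  by apply/eqP; rewrite eqn_leq rank_leq_col -{1}(mxrank1 F m) -BC mxrankM_maxr.
have rK : \rank (kermx C) = n by rewrite mxrank_ker rC addKn.
have: exists2 W : 'M[F]_(\rank (kermx C), m + n), W *m C = 0 & row_free W.
  exists (row_base (kermx C)); rewrite ?row_base_free //.
  by apply/sub_kermxP; rewrite eq_row_base.
rewrite rK => -[W WC fW].
have ug : col_mx B W \in unitmx.
  rewrite -row_free_unit -kermx_eq0; apply/rowV0P=> v /sub_kermxP.
  rewrite -[v]hsubmxK mul_row_col => h.
  have h1 : lsubmx v = 0.
    have := congr1 (fun A => A *m C) h.
    by rewrite mulmxDl -!mulmxA BC WC mulmx1 mulmx0 addr0 mul0mx.
  have h2 : rsubmx v = 0.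
    by apply: (row_free_inj fW); move: h; rewrite h1 !mul0mx add0r.
  by rewrite h1 h2 row_mx0.
exists (col_mx B W) => //; split.
  by rewrite mul_row_col mul1mx mul0mx addr0.
apply: (canRL (mulKmx ug)).
by rewrite mul_col_mx BC WC.
Qed.

Lemma dsum_form m n (X : aT -> 'M[F]_m) (Y : aT -> 'M[F]_(m + n)) :
    row_mx 1%:M 0 \in mxhom X Y -> col_mx 1%:M 0 \in mxhom Y X ->
  Y =1 dsum X (fun a => drsubmx (Y a)).
Proof.
move=> /mxhomP hB /mxhomP hC a; have := hB a; have := hC a.
rewrite /dsum -{1 2 3}[Y a]submxK.
rewrite mul_mx_row mul_row_block mul_block_col mul_col_mx.
rewrite !(mul0mx, mulmx0, mulmx1, mul1mx, addr0, add0r).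
by move=> /eq_col_mx[-> ->] /eq_row_mx[_ <-].
Qed.

Lemma mxhom_split m n (X : aT -> 'M[F]_m) (Y : aT -> 'M[F]_(m + n)) B C :
    is_rep Y -> B \in mxhom X Y -> C \in mxhom Y X -> B *m C = 1%:M ->
  exists g (Y' : aT -> 'M[F]_n), [/\ g \in unitmx, is_rep Y',
    B = row_mx 1%:M 0 *m g, C = invmx g *m col_mx 1%:M 0
    & conjr g Y =1 dsum X Y'].
Proof.
move=> rY hB hC /split_form[g ug [dB dC]].
have eY : conjr g Y =1 dsum X (fun a => drsubmx (conjr g Y a)).
  apply: dsum_form.
    have -> : row_mx 1%:M 0 = B *m invmx g by rewrite dB mulmxK.
    exact: mxhom_comp hB (mxhom_conjrV _ ug).
  have -> : col_mx 1%:M 0 = g *m C by rewrite dC mulKVmx.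
  exact: mxhom_comp (mxhom_conjr _ ug) hC.
exists g, (fun a => drsubmx (conjr g Y a)); split=> //.
have: is_rep (dsum X (fun a => drsubmx (conjr g Y a))).
  have /is_repP[Y1 YM] := is_rep_conjr ug rY.
  by apply/is_repP; split=> [|a b]; rewrite -!eY.
by rewrite is_rep_dsum => /andP[].
Qed.

End Intertwiners.

(** * Endomorphisms of irreducible representations of abelian groups *)

Section Abelian.
Variables (aT : finGroupType) (F : finFieldType).
Hypothesis cA : abelian [set: aT].

Lemma rep_comm n (X : aT -> 'M[F]_n) : is_rep X ->
  forall a b, X a *m X b = X b *m X a.
Proof.
case/is_repP=> _ XM a b; rewrite -!XM; congr X.
by apply: (centsP cA); rewrite inE.
Qed.

Lemma rep_in_hom n (X : aT -> 'M[F]_n) : is_rep X -> forall a,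
  X a \in mxhom X X.
Proof. by move=> rX a; apply/mxhomP=> b; apply: rep_comm. Qed.

Lemma mxhom_lincomb n (X : aT -> 'M[F]_n) (c : aT -> F) :
  is_rep X -> \sum_a c a *: X a \in mxhom X X.
Proof.
move=> rX; apply/mxhomP=> b; rewrite mulmx_sumr mulmx_suml;
  apply: eq_bigr => a _.
by rewrite -scalemxAr -scalemxAl rep_comm.
Qed.

Lemma irred_cyclic n (X : aT -> 'M[F]_n) (v : 'rV_n) : irred X -> v != 0 ->
  forall w, exists c : aT -> F, w = v *m \sum_a c a *: X a.
Proof.
case=> rX n_gt0 irX nzv w.
pose U := \matrix_(i < #|aT|) (v *m X (enum_val i)).
have vU : (v <= U)%MS.
  have <-: row (enum_rank 1%g) U = v.
    by rewrite rowK enum_rankK; case/is_repP: rX => -> _; rewrite mulmx1.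
  exact: row_sub.
have fU : row_full <<U>>%MS.
  apply: irX => [a|].
    rewrite (eqmxMr _ (genmxE _)) genmxE; apply/row_subP=> i.
    rewrite row_mul rowK -mulmxA; case/is_repP: rX => _ <-.
    by rewrite (_ : v *m _ = row (enum_rank (enum_val i * a)%g) U) ?row_sub //
      rowK enum_rankK.
  by apply: contraNneq nzv => U0; move: vU; rewrite -(genmxE U) U0 submx0.
have /submxP[c ->] : (w <= U)%MS by rewrite -(genmxE U) submx_full.
exists (fun a => c 0 (enum_rank a)).
rewrite mulmx_sumr mulmx_sum_row (reindex (@enum_rank aT)) /=; last first.
  by apply: onW_bij; apply: enum_rank_bij.
by apply: eq_bigr => a _; rewrite rowK enum_rankK -scalemxAr.
Qed.

(** Some combination of the X a agrees with B on a nonzero vector v, by cyclicity. It is an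
    intertwiner because the group is abelian, so its difference with B is a non-invertible
    intertwiner, hence 0. *)
Lemma irred_end n (X : aT -> 'M[F]_n) (B : 'M_n) : irred X -> B \in mxhom X X ->
  exists c : aT -> F, B = \sum_a c a *: X a.
Proof.
move=> irX hB; have [rX n_gt0 _] := irX.
pose v : 'rV[F]_n := delta_mx 0 (Ordinal n_gt0).
have nzv : v != 0.
  by apply/eqP => /rowP/(_ (Ordinal n_gt0)) /eqP; rewrite !mxE !eqxx oner_eq0.
have [c vB] := irred_cyclic irX nzv (v *m B).
exists c; apply/eqP; rewrite -subr_eq0; apply: contraNT nzv => nz.
have u := irred_mxhom_unit irX (mxhomB hB (mxhom_lincomb c rX)) nz.
by rewrite -[v](mulmxK u) mulmxBr vB subrr mul0mx.
Qed.

Lemma irred_end_comm n (X : aT -> 'M[F]_n) (B C : 'M_n) :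
  irred X -> B \in mxhom X X -> C \in mxhom X X -> B *m C = C *m B.
Proof.
move=> irX hB /(irred_end irX)[c ->].
rewrite mulmx_sumr mulmx_suml; apply: eq_bigr => a _.
by rewrite -scalemxAr -scalemxAl; move/mxhomP: hB => ->.
Qed.

(** Evaluation at a nonzero vector is a bijection from the endomorphisms to F^n. *)
Lemma card_irred_end n (X : aT -> 'M[F]_n) :
  irred X -> #|mxhom X X| = (#|F| ^ n)%N.
Proof.
move=> irX; have [rX n_gt0 _] := irX.
pose v : 'rV[F]_n := delta_mx 0 (Ordinal n_gt0).
have nzv : v != 0.
  by apply/eqP => /rowP/(_ (Ordinal n_gt0)) /eqP; rewrite !mxE !eqxx oner_eq0.
have inj : {in mxhom X X &, injective (fun B => v *m B)}.
  move=> B C hB hC /= e; apply/eqP; rewrite -subr_eq0;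
    apply: contraNT nzv => nz.
  have u := irred_mxhom_unit irX (mxhomB hB hC) nz.
  by rewrite -[v](mulmxK u) mulmxBr e subrr mul0mx.
rewrite -(card_in_imset inj) -[n in RHS]mul1n -card_mx -cardsT.
apply: eq_card => w; rewrite inE; apply/imsetP.
have [c ->] := irred_cyclic irX nzv w.
by exists (\sum_a c a *: X a) => //; apply: mxhom_lincomb.
Qed.

End Abelian.

(** * Multiplicity of an irreducible *)

Section Multiplicity.
Variables (aT : finGroupType) (F : finFieldType).
Hypothesis nzA : #|aT|%:R != 0 :> F.
Variables (D : nat) (rho : aT -> 'M[F]_D).
Hypothesis irr_rho : irred rho.

Let rrho : is_rep rho. Proof. by case: irr_rho. Qed.

Lemma mxhom_lr_trivial n (X : aT -> 'M[F]_n) :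
  is_rep X -> mxhom rho X = [set 0] -> mxhom X rho = [set 0].
Proof.
move=> rX h0; apply/eqP; rewrite eqEsubset sub1set mxhom0 andbT.
apply/subsetP=> C hC; rewrite inE; apply/negP=> /negP nz.
have [B hB BC] := mxhom_section nzA rrho rX hC (irred_mxhom_full irr_rho hC nz).
move: hB BC; rewrite h0 inE => /eqP->; rewrite mul0mx.
case: irr_rho => _ D_gt0 _ /matrixP/(_ (Ordinal D_gt0) (Ordinal D_gt0))/eqP.
by rewrite !mxE eqxx eq_sym oner_eq0.
Qed.

(** A nonzero map from rho is injective and has a retraction. The equation n = D + n' is there to be
    substituted, so that X gets the type required by [mxhom_split]. *)
Lemma mxhom_nontrivial_split n (X : aT -> 'M[F]_n) :
    is_rep X -> mxhom rho X != [set 0] ->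
  exists n' (e : n = (D + n')%N), exists B C, [/\ B \in mxhom rho X,
     C \in mxhom X rho & B *m C = 1%:M].
Proof.
move=> rX nt.
have [B hB nzB] : exists2 B, B \in mxhom rho X & B != 0.
  apply/exists_inP; apply: contraR nt; rewrite negb_exists_in => /forall_inP h.
  rewrite eqEsubset sub1set mxhom0 andbT; apply/subsetP=> B /h.
  by rewrite negbK inE.
have [C hC BC] := mxhom_retract nzA rrho rX hB
  (irred_mxhom_free irr_rho hB nzB).
exists (n - D)%N, (esym (subnKC (mulmx1_min BC))), B, C; by split.
Qed.

Hypothesis end_card : #|mxhom rho rho| = (#|F| ^ D)%N.

(** The exponent h is the multiplicity of rho in X: each copy of rho split off contributes a factor
    |End rho| to both sets. *)
Lemma card_mxhom_mult n (X : aT -> 'M[F]_n) : is_rep X ->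
  exists h, #|mxhom rho X| = ((#|F| ^ D) ^ h)%N /\ #|mxhom X rho| =
    ((#|F| ^ D) ^ h)%N.
Proof.
have [k] := ubnP n; elim: k => // k IH in n X *; rewrite ltnS => le_nk rX.
have [h0|nt] := eqVneq (mxhom rho X) [set 0].
  by exists 0%N; rewrite (mxhom_lr_trivial rX h0) h0 !cards1 expn0.
have [n' [e [B [C [hB hC BC]]]]] := mxhom_nontrivial_split rX nt.
subst n; have [g [X' [ug rX' _ _ eX]]] := mxhom_split rX hB hC BC.
have D_gt0 : (0 < D)%N by case: irr_rho.
have [|h [h1 h2]] := IH n' X' _ rX'.
  by apply: leq_trans le_nk; rewrite -add1n leq_add2r.
exists h.+1; have hg := mxhom_conjrV X ug; have ug' : invmx g \in unitmx.
  by rewrite unitmx_inv.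
have eq_hom : mxhom rho (conjr g X) = mxhom rho (dsum rho X').
  by apply/setP=> E; apply/mxhomP/mxhomP=> H a; rewrite H eX.
have eq_hom' : mxhom (conjr g X) rho = mxhom (dsum rho X') rho.
  by apply/setP=> E; apply/mxhomP/mxhomP=> H a; rewrite -H eX.
rewrite (card_mxhomr_iso rho ug' hg) -(card_mxhoml_iso rho ug' hg).
rewrite eq_hom eq_hom' card_mxhom_dsumr card_mxhom_dsuml.
by rewrite end_card h1 h2 expnS.
Qed.

End Multiplicity.

Lemma card_const_fibers (T U : finType) (A : {set T}) (B : {set U})
    (f : T -> U) c :
    {in A, forall x, f x \in B} ->
    {in B, forall y, #|[set x in A | f x == y]| = c} ->
  #|A| = (#|B| * c)%N.
Proof.
move=> fA fB; rewrite -sum1_card (partition_big f (mem B)) //=.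
rewrite (eq_bigr (fun _ => c)) ?sum_nat_const // => y By.
by rewrite sum1dep_card -(fB y By); apply: eq_card => x; rewrite !inE.
Qed.

Section Peel.
Variables (aT : finGroupType) (F : finFieldType).
Hypothesis nzA : #|aT|%:R != 0 :> F.

Lemma card_mxhom_conj_dsum l m n (Z : aT -> 'M[F]_l) (X : aT -> 'M[F]_(m + n))
    (X1 : aT -> 'M[F]_m) (X2 : aT -> 'M[F]_n) g : g \in unitmx ->
    conjr g X =1 dsum X1 X2 ->
  #|mxhom Z X| = (#|mxhom Z X1| * #|mxhom Z X2|)%N.
Proof.
move=> ug e; rewrite -card_mxhom_dsumr.
have ug' : invmx g \in unitmx by rewrite unitmx_inv.
rewrite (card_mxhomr_iso Z ug' (mxhom_conjrV X ug)); apply: eq_card => B.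
by apply/mxhomP/mxhomP=> H a; rewrite H e.
Qed.

Definition GLset n : {set 'M[F]_n} := [set g | g \in unitmx].

Section OneIrrep.
Variables (D : nat) (rho : aT -> 'M[F]_D).
Hypothesis irr_rho : irred rho.
Hypothesis end_card : #|mxhom rho rho| = (#|F| ^ D)%N.
Let Q := (#|F| ^ D)%N.

Let rrho : is_rep rho. Proof. by case: irr_rho. Qed.
Let D_gt0 : (0 < D)%N. Proof. by case: irr_rho. Qed.

Definition splittings n (X : aT -> 'M[F]_n) : {set 'M[F]_(D, n) * 'M[F]_(n, D)}
  :=
  [set BC | [&& BC.1 \in mxhom rho X, BC.2 \in mxhom X rho
              & BC.1 *m BC.2 == 1%:M]].

Lemma splittingsP n (X : aT -> 'M[F]_n) BC :
  reflect [/\ BC.1 \in mxhom rho X, BC.2 \in mxhom X rho & BC.1 *m BC.2 = 1%:M]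
    (BC \in splittings X).
Proof.
rewrite [BC \in _]in_set.
apply: (iffP and3P) => -[? ? /eqP ?]; split=> //. Qed.

Lemma mulmx1_neq0 n (B : 'M[F]_(D, n)) C : B *m C = 1%:M -> B != 0.
Proof.
move=> BC; apply: contra_eq_neq BC => ->; rewrite mul0mx eq_sym.
apply/eqP=> /matrixP/(_ (Ordinal D_gt0) (Ordinal D_gt0))/eqP.
by rewrite !mxE eqxx oner_eq0.
Qed.

Lemma Q_gt0 : (0 < Q)%N.
Proof. by rewrite expn_gt0 (ltnW (finNzRing_gt1 F)). Qed.

(** Each of the Q^(h+1) - 1 nonzero maps B is injective, and its retractions make up a fraction 1/Q
    of the Q^(h+1) maps from X to rho. *)
Lemma card_splittings n (X : aT -> 'M[F]_n) h :
    is_rep X -> #|mxhom rho X| = (Q ^ h.+1)%N ->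
  #|splittings X| = ((Q ^ h.+1 - 1) * Q ^ h)%N.
Proof.
move=> rX hX.
have hX' : #|mxhom X rho| = (Q ^ h.+1)%N.
  have [h' [h1 ->]] := card_mxhom_mult nzA irr_rho end_card rX.
  by rewrite -hX h1.
pose S := mxhom rho X :\ 0.
have cS : #|S| = (Q ^ h.+1 - 1)%N.
  by rewrite -hX (cardsD1 0 (mxhom rho X)) mxhom0 addKn.
rewrite -cS; apply: (@card_const_fibers _ _ _ _ fst) => [[B C]|B].
  move=> /splittingsP[/= hB hC BC].
  by rewrite in_setD1 hB (mulmx1_neq0 BC).
rewrite in_setD1 => /andP[nzB hB].
have [C1 hC1 BC1] := mxhom_retract nzA rrho rX hB
  (irred_mxhom_free irr_rho hB nzB).
pose T := [set C in mxhom X rho | B *m C == 1%:M].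
transitivity #|T|.
  have injp : injective (pair B : 'M[F]_(n, D) -> _) by move=> C C' [].
  rewrite -(card_imset _ injp); apply: eq_card => -[B' C].
  rewrite [_ \in _](in_set) /=; apply/andP/imsetP => /=.
    by case=> /splittingsP[/= _ hC BC] /eqP e; subst B'; exists C;
       rewrite // [C \in T]in_set hC BC eqxx.
  case=> C'; rewrite [C' \in T]in_set => /andP[hC /eqP BC] [-> ->]; split => //.
  exact/splittingsP.
(* Hom(X, rho) is in bijection with T x End(rho) through C + C1 E: multiplication by B returns 1 +
   E. *)
have inj : {in setX T (mxhom rho rho) &, injective (fun p => p.1 + C1 *m p.2)}.
  case=> C E [C' E'] /=; rewrite !in_setX [_ \in T]in_set [C' \in T]in_set /=.
  move=> /andP[/andP[_ /eqP BC] _] /andP[/andP[_ /eqP BC'] _] e.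
  have := congr1 (fun Z => B *m Z) e.
  rewrite !mulmxDr !mulmxA BC1 BC BC' !mul1mx => /addrI eE.
  by move: e; rewrite eE => /addIr ->.
have := card_in_imset inj; rewrite cardsX end_card -/Q.
have -> : [set p.1 + C1 *m p.2 | p in setX T (mxhom rho rho)] = mxhom X rho.
  apply/setP=> C; apply/imsetP/idP.
    case=> -[C' E]; rewrite in_setX [_ \in T]in_set /= =>
      /andP[/andP[hC' _] hE] ->.
    by apply: mxhomD hC' (mxhom_comp hC1 hE).
  move=> hC; pose E := B *m C - 1%:M.
  have hE : E \in mxhom rho rho by apply: mxhomB;
    [apply: mxhom_comp hC | apply: mxhom1].
  exists (C - C1 *m E, E); last by rewrite /= subrK.
  rewrite in_setX [_ \in T]in_set /=
    hE (mxhomB hC (mxhom_comp hC1 hE)) andbT /=.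
  by rewrite mulmxBr mulmxA BC1 mul1mx /E opprB addrC subrK.
rewrite hX' expnS mulnC => /eqP; rewrite eqn_pmul2r ?Q_gt0 //.
by move/eqP.
Qed.

Lemma eq_is_rep n (X Y : aT -> 'M[F]_n) : X =1 Y -> is_rep X = is_rep Y.
Proof.
move=> e; rewrite /is_rep e; congr (_ && _); apply: eq_forallb => a.
by apply: eq_forallb => b; rewrite !e.
Qed.

Lemma eq_mxhom m n (X X' : aT -> 'M[F]_m) (Y Y' : aT -> 'M[F]_n) :
  X =1 X' -> Y =1 Y' -> mxhom X Y = mxhom X' Y'.
Proof. by move=> e e'; apply/setP=> B; apply/mxhomP/mxhomP=> H a; move: (H a);
  rewrite e e'. Qed.

Variable P : forall n, (aT -> 'M[F]_n) -> bool.
Hypothesis P_dsum : forall n (X : aT -> 'M[F]_(D + n)) X2 g, g \in unitmx ->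
  conjr g X =1 dsum rho X2 -> P X = P X2.
Hypothesis P_eq : forall n (X X' : aT -> 'M[F]_n), X =1 X' -> P X = P X'.

(** The cardinality Q^h says that rho has multiplicity h in X. The property [P] constrains the other
    constituents; it will be [avoiding S]. *)
Definition multset h n : {set {ffun aT -> 'M[F]_n}} :=
  [set X : {ffun aT -> 'M[F]_n} |
    [&& is_rep X, P X & #|mxhom rho X| == Q ^ h]%N].

Lemma multsetP h n (X : {ffun aT -> 'M[F]_n}) :
  reflect [/\ is_rep X, P X & #|mxhom rho X| = Q ^ h]%N (X \in multset h n).
Proof.
by rewrite [X \in _]in_set; apply: (iffP and3P) => -[? ? /eqP ?]; split=> //.
Qed.

Definition blockr n (k : 'M[F]_n) : 'M[F]_(D + n) := block_mx 1%:M 0 0 k.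

Lemma blockr_unit n (k : 'M[F]_n) : (blockr k \in unitmx) = (k \in unitmx).
Proof. by rewrite !unitmxE det_ublock det1 mul1r. Qed.

(** The stabilizer of the standard inclusion and projection is a copy of GL_n, which accounts for
    the factor [GLset n] in [peel_count]. *)
Lemma stab_blockr n (u : 'M[F]_(D + n)) :
    row_mx 1%:M 0 *m u = row_mx 1%:M 0 -> u *m col_mx 1%:M 0 = col_mx 1%:M 0 ->
  u = blockr (drsubmx u).
Proof.
rewrite /blockr -{1 2 3}[u]submxK mul_row_block mul_block_col.
rewrite !(mul0mx, mulmx0, mulmx1, mul1mx, addr0, add0r).
by move=> /eq_row_mx[-> ->] /eq_col_mx[_ ->].
Qed.

Lemma blockr_dsum n (k : 'M[F]_n) (X Y : aT -> 'M[F]_n) a :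
  (blockr k *m dsum rho X a == dsum rho Y a *m blockr k) =
    (k *m X a == Y a *m k).
Proof.
rewrite /blockr /dsum !mulmx_block.
rewrite !(mul0mx, mulmx0, mulmx1, mul1mx, addr0, add0r).
by apply/eqP/eqP=> [/eq_block_mx[] // | ->].
Qed.

(* Both sides count triples (X, B, C) with B : rho -> X, C : X -> rho and
   B *m C = 1: such a triple is conjugate to rho + X' in the standard position. *)
Lemma peel_count h n :
  (#|multset h.+1 (D + n)| * ((Q ^ h.+1 - 1) * Q ^ h) * #|GLset n| =
   #|GLset (D + n)| * #|multset h n|)%N.
Proof.
pose Sig := [set t : {ffun aT -> 'M[F]_(D + n)} *
  ('M[F]_(D, D + n) * 'M[F]_(D + n, D))
  | (t.1 \in multset h.+1 (D + n)) && (t.2 \in splittings t.1)].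
have SigP X BC : ((X, BC) \in Sig) = (X \in multset h.+1 (D + n)) &&
  (BC \in splittings X).
  by rewrite [_ \in Sig]in_set.
have <- : #|Sig| = (#|multset h.+1 (D + n)| * ((Q ^ h.+1 - 1) * Q ^ h))%N.
  apply: (@card_const_fibers _ _ _ _ fst) => [[X BC]|X XM].
    by rewrite SigP => /andP[].
  have /multsetP[rX _ hX] := XM; rewrite -(card_splittings rX hX).
  have injp : injective (pair X : _ ->
    _ * ('M[F]_(D, D + n) * 'M[F]_(D + n, D))).
    by move=> C C' [].
  rewrite -(card_imset _ injp); apply: eq_card => -[X' BC].
  rewrite [in LHS]in_set SigP /=; apply/andP/imsetP.
    by case=> /andP[_ hBC] /eqP e; subst X'; exists BC.
  by case=> BC' hBC [-> ->]; rewrite XM hBC eqxx.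
(* The conjugate of rho + X' by g^-1, with the inclusion and projection transported along. *)
pose f (t : 'M[F]_(D + n) * {ffun aT -> 'M[F]_n}) :=
  ([ffun a => conjr (invmx t.1) (dsum rho t.2) a],
   (row_mx 1%:M 0 *m t.1, invmx t.1 *m col_mx 1%:M 0)).
rewrite -[RHS]cardsX; apply/esym; apply: (@card_const_fibers _ _ _ _ f).
  case=> g X'; rewrite in_setX inE => /andP[/= ug /multsetP[rX' PX' hX']].
  have ug' : invmx g \in unitmx by rewrite unitmx_inv.
  set X := conjr (invmx g) (dsum rho X').
  have eX : finfun X =1 X by move=> a; rewrite ffunE.
  have cX : conjr g X =1 dsum rho X'.
    by move=> a; rewrite /X /conjr invmxK !mulmxA mulmxV // mul1mx -mulmxA
      mulmxV // mulmx1.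
  rewrite /f /= SigP; apply/andP; split.
    apply/multsetP; rewrite (eq_is_rep eX) (eq_mxhom (frefl rho) eX) (P_eq eX).
    split; first by apply: is_rep_conjr => //; rewrite is_rep_dsum rrho.
      by rewrite (P_dsum ug cX).
    by rewrite (card_mxhom_conj_dsum rho ug cX) hX' end_card -/Q expnS.
  apply/splittingsP; rewrite /=
    (eq_mxhom (frefl rho) eX) (eq_mxhom eX (frefl rho)).
  split; last 1 first.
  - by rewrite mulmxA mulmxK // mul_row_col mulmx1 mul0mx addr0.
  - apply: mxhom_comp (_ : g \in mxhom (dsum rho X') _).
      by apply/mxhomP=> a; rewrite /dsum mul_row_block mul_mx_row
        !(mul0mx, mulmx0, mulmx1, mul1mx, addr0, add0r).
    by apply/mxhomP=> a; rewrite /X /conjr invmxK !mulmxA mulmxV // mul1mx.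
  apply: mxhom_comp (_ : invmx g \in mxhom _ (dsum rho X')) _.
    by apply/mxhomP=> a; rewrite /X /conjr invmxK mulmxK.
  by apply/mxhomP=> a; rewrite /dsum mul_block_col mul_col_mx
    !(mul0mx, mulmx0, mulmx1, mul1mx, addr0, add0r).
case=> X [B C]; rewrite SigP =>
  /andP[/multsetP[rX PX hX] /splittingsP[/= hB hC BC]].
have [g0 [Y0 [ug0 rY0 dB dC eX]]] := mxhom_split rX hB hC BC.
have ug0' : invmx g0 \in unitmx by rewrite unitmx_inv.
have hY0 : #|mxhom rho Y0| = (Q ^ h)%N.
  move: hX; rewrite (card_mxhom_conj_dsum rho ug0 eX) end_card -/Q expnS.
  by move/eqP; rewrite eqn_pmul2l ?Q_gt0 // => /eqP.
(* The fibre over (X, B, C) is the orbit of one decomposition (g0, Y0) under GL_n. *)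
pose e k := (blockr k *m g0, [ffun a => conjr k Y0 a] : {ffun aT -> 'M[F]_n}).
have inje : {in GLset n &, injective e}.
  move=> k k' _ _ [/(can_inj (mulmxK ug0))/eq_block_mx[_ _ _ ->]] //.
rewrite -(card_in_imset inje); apply: eq_card => -[g X'].
rewrite inE in_setX [g \in _]inE /=.
apply/idP/imsetP => [/andP[/andP[ug /multsetP[rX' PX' hX']]] | [k]].
  case/eqP=> eX' eB eC.
  have : g *m invmx g0 = blockr (drsubmx (g *m invmx g0)).
    apply: stab_blockr; first by rewrite mulmxA eB dB mulmxK.
    by rewrite -mulmxA -dC -eC mulKVmx.
  set k := drsubmx _ => egk;
    have eg : g = blockr k *m g0 by rewrite -egk mulmxKV.
  have uk : k \in unitmx by rewrite -blockr_unit -egk unitmx_mul ug.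
  exists k; first by rewrite inE.
  rewrite /e -eg; congr (_, _); apply/ffunP=> a; rewrite ffunE /conjr.
  apply: (canRL (mulmxK uk)); apply/eqP; rewrite eq_sym -blockr_dsum -egk -eX.
  rewrite /conjr; have -> : X a = invmx g *m dsum rho X' a *m g.
    by rewrite -eX' ffunE /conjr invmxK.
  by rewrite !mulmxA mulmxKV // mulmxV // mul1mx.
rewrite inE => uk [eg eX'];
  have ubk : blockr k \in unitmx by rewrite blockr_unit.
have ug : g \in unitmx by rewrite eg unitmx_mul ubk.
have cX : conjr g X =1 dsum rho X'.
  move=> a; apply: (canLR (mulmxK ug)).
  have /eqP : blockr k *m dsum rho Y0 a == dsum rho X' a *m blockr k.
    by rewrite blockr_dsum eX' ffunE /conjr mulmxKV.
  by rewrite -eX /conjr => h1; rewrite eg mulmxA -h1 -!mulmxA mulVmx // mulmx1.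
rewrite ug /=; apply/andP; split.
  apply/multsetP; split.
  - have := is_rep_conjr ug rX;
    rewrite (eq_is_rep cX) is_rep_dsum => /andP[] //.
  - by rewrite -(P_dsum ug cX).
  move: hX; rewrite (card_mxhom_conj_dsum rho ug cX) end_card -/Q expnS.
  by move/eqP; rewrite eqn_pmul2l ?Q_gt0 // => /eqP.
apply/eqP; rewrite /f /=; congr (_, (_, _)).
- apply/ffunP=> a; rewrite ffunE {1}/conjr -cX /conjr invmxK !mulmxA mulVmx //.
  by rewrite mul1mx mulmxKV.
- by rewrite eg mulmxA mul_row_block !(mul0mx, mulmx0, mulmx1, addr0, add0r).
rewrite dC; apply: (canLR (mulKmx ug)).
by rewrite eg mulmxA mulmxK // mul_block_col
  !(mul0mx, mulmx0, mul1mx, mulmx1, addr0, add0r).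
Qed.

End OneIrrep.
End Peel.

(** The order of GL_m over the field with Q elements, with factors arranged so that the passage from
    m to m + 1 multiplies by the number found in [card_splittings]. *)
Definition gl_order (Q m : nat) : nat :=
  (\prod_(i < m) ((Q ^ i.+1 - 1) * Q ^ i))%N.

Definition gl_series (Q m : nat) : rat := (gl_order Q m)%:R^-1.

Lemma gl_orderS Q m : gl_order Q m.+1 =
  (gl_order Q m * ((Q ^ m.+1 - 1) * Q ^ m))%N.
Proof. by rewrite /gl_order big_ord_recr. Qed.

Lemma gl_order0 Q : gl_order Q 0 = 1%N.
Proof. by rewrite /gl_order big_ord0. Qed.

Lemma gl_series0 Q : gl_series Q 0 = 1.
Proof. by rewrite /gl_series gl_order0 invr1. Qed.

Lemma gl_order_gt0 Q m : (1 < Q)%N -> (0 < gl_order Q m)%N.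
Proof.
move=> Q1; apply: prodn_gt0 => i; rewrite muln_gt0 expn_gt0 (ltnW Q1) andbT.
by rewrite subn_gt0 -(exp1n i.+1) ltn_exp2r.
Qed.

Lemma card_GLset (F : finFieldType) n : #|GLset F n| = gl_order #|F| n.
Proof.
case: n => [|n].
  rewrite gl_order0 -(cards1 (0 : 'M[F]_0)); apply: eq_card => A.
  by rewrite !inE [A]flatmx0 eqxx unitmxE det_mx00 unitr1.
have -> : #|GLset F n.+1| = #|'GL_n.+1[F]|.
  rewrite -[RHS](card_imset _ val_inj); apply: eq_card => A; rewrite inE.
  apply/idP/imsetP => [uA | [g _ ->]]; last by rewrite (valP g).
  by exists (FinRing.unit _ uA : {'GL_n.+1[F]}).
rewrite card_GL // /gl_order big_split /=
  mulnC -(big_mkord xpredT (fun i => #|F| ^ i.+1 - 1)%N).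
rewrite -(big_mkord xpredT (fun i => #|F| ^ i)%N) -expn_sum.
by rewrite -bin2_sum big_add1 /= .
Qed.

(** * The generating series as a product over the irreducibles *)

Section GenProd.
Variables (aT : finGroupType) (F : finFieldType).
Hypothesis nzA : #|aT|%:R != 0 :> F.
Variables (I : finType) (dg : I -> nat) (sg : forall i, aT -> 'M[F]_(dg i)).
Hypothesis irr_sg : forall i, irred (sg i).
Hypothesis end_sg : forall i, #|mxhom (sg i) (sg i)| = (#|F| ^ dg i)%N.
Hypothesis sg_inj : forall i j, i != j -> #|mxhom (sg i) (sg j)| = 1%N.
Hypothesis sg_complete : forall n (X : aT -> 'M[F]_n), is_rep X -> (0 < n)%N ->
  exists i, #|mxhom (sg i) X| != 1%N.

Let q := #|F|.
Let q_gt1 : (1 < q)%N. Proof. exact: finNzRing_gt1. Qed.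

Definition avoiding (S : {set I}) n (X : aT -> 'M[F]_n) : bool :=
  [forall j in S, #|mxhom (sg j) X| == 1%N].

(* Up to isomorphism and weighted by 1 / |Aut|: the representations of degree n
   with no constituent sg j for j in S. *)
Definition mass (S : {set I}) n : rat :=
  #|[set X : {ffun aT -> 'M[F]_n} | is_rep X & avoiding S X]|%:R /
    (gl_order q n)%:R.

(** Sort the representations by the multiplicity h of sg i: the part isomorphic to h copies of sg i
    has automorphism group GL_h(Q), and the rest avoids i as well. *)
Lemma mass_peel (S : {set I}) i : i \notin S -> forall n,
  mass S n = conv (subst (dg i) (gl_series (q ^ dg i))) (mass (i |: S)) n.
Proof.
move=> iS n; have irr_i := irr_sg i; have end_i := end_sg i.
have D0 : (0 < dg i)%N by case: irr_i.
set D := dg i in D0 *; set Q := (q ^ D)%N.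
have Q1 : (1 < Q)%N by rewrite -(exp1n D) ltn_exp2r.
have Pd m (X : aT -> 'M[F]_(D + m)) X2 g : g \in unitmx ->
    conjr g X =1 dsum (sg i) X2 -> avoiding S X = avoiding S X2.
  move=> ug e; apply: eq_forallb_in => j jS.
  rewrite (card_mxhom_conj_dsum _ ug e) sg_inj ?mul1n //.
  by apply: contraNneq iS => <-.
have Pe m (X X' : aT -> 'M[F]_m) : X =1 X' -> avoiding S X = avoiding S X'.
  by move=> e; apply: eq_forallb_in => j jS; rewrite (eq_mxhom (frefl _) e).
pose ms h m := #|multset (sg i) (@avoiding S) h m|.
pose mh h m : rat := (ms h m)%:R / (gl_order q m)%:R.
have glnz Q' m : (1 < Q')%N -> ((gl_order Q' m)%:R : rat) != 0.
  by move=> Q'1; rewrite pnatr_eq0 -lt0n gl_order_gt0.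
have mhS h m : mh h.+1 (D + m)%N = mh h m / ((Q ^ h.+1 - 1) * Q ^ h)%N%:R.
  have := peel_count nzA irr_i end_i Pd Pe h m.
  rewrite !card_GLset -/q -/Q -/(ms _ _) -/(ms _ _) =>
    /(congr1 (fun k => k%:R : rat)).
  rewrite !natrM => e; rewrite /mh.
  have nz1 := glnz q m q_gt1; have nz2 := glnz q (D + m)%N q_gt1.
  have nz3 := glnz Q h.+1 Q1;
    rewrite gl_orderS !natrM !mulf_eq0 !negb_or in nz3.
  case/and3P: nz3 => _ nz3 nz4.
  rewrite -[RHS]mulrA -invfM; apply/eqP; rewrite eqr_div ?mulf_neq0 //;
    apply/eqP.
  by rewrite [RHS]mulrC -e; ring.
have ms0 m X : X \in multset (sg i) (@avoiding S) 0 m = is_rep X &&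
  avoiding (i |: S) X.
  apply/multsetP/andP => [[rX PX hX]|[rX /forall_inP PX]]; split=> //.
  - apply/forall_inP=> j; rewrite in_setU1 => /orP[/eqP->|jS];
    first by rewrite hX.
    by move/forall_inP: PX; apply.
  - by apply/forall_inP=> j jS; apply: PX; rewrite in_setU1 jS orbT.
  by rewrite expn0; apply/eqP/PX; rewrite setU11.
have mh0 m : mh 0%N m = mass (i |: S) m.
  by rewrite /mh /mass; congr (_%:R / _); apply: eq_card => X; rewrite ms0 inE.
have mh_lt h m : (m < D)%N -> mh h.+1 m = 0.
  move=> lt; rewrite /mh /ms (_ : multset _ _ _ _ = set0) ?cards0 ?mul0r //.
  apply/setP=> X; rewrite [RHS]inE; apply/multsetP=> -[rX _ hX].
  have : mxhom (sg i) X != [set 0].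
    apply: contra_eq_neq hX => ->; rewrite cards1 neq_ltn.
    by rewrite -(exp1n h.+1) ltn_exp2r ?Q1.
  case/(mxhom_nontrivial_split nzA irr_i rX)=> n' [e _].
  by move: lt; rewrite e ltnNge leq_addr.
(* Iterating [mhS]: the h denominators multiply up to |GL_h(Q)|. *)
have mhE h m : mh h m = if (D * h <= m)%N then mh 0%N (m - D * h)%N *
  gl_series Q h else 0.
  elim: h m => [|h IH] m; first by rewrite muln0 subn0 gl_series0 mulr1.
  have [lt|le] := ltnP m D.
    rewrite mh_lt // ifN // -ltnNge (leq_trans lt) // mulnS leq_addr //.
  rewrite -{1}(subnKC le) mhS IH mulnS leq_subRL // -subnDA.
  case: ifP => _; last by rewrite mul0r.
  by rewrite -mulrA; congr (_ * _);
    rewrite /gl_series gl_orderS [in RHS]natrM [in RHS]invfM.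
(* The multiplicity is at most m, because Hom(sg i, X) lies in a space of Q^m matrices. *)
have massE m : mass S m = \sum_(h < m.+1) mh h m.
  rewrite /mh -mulr_suml -natr_sum; congr (_%:R / _).
  have hex (X : aT -> 'M[F]_m) : is_rep X ->
      exists h : 'I_m.+1, #|mxhom (sg i) X| == (Q ^ h)%N.
    move=> rX; have [h [hX _]] := card_mxhom_mult nzA irr_i end_i rX.
    suff lt : (h < m.+1)%N by exists (Ordinal lt); rewrite hX.
    by rewrite ltnS -(leq_exp2l _ _ Q1) -hX -expnM -card_mx max_card.
  rewrite -sum1_card (partition_big (fun X : {ffun aT -> 'M[F]_m} =>
    odflt ord0 [pick h : 'I_m.+1 | #|mxhom (sg i) X| == (Q ^ h)%N]) xpredT) //=.
  apply: eq_bigr => h _; rewrite sum1dep_card; apply: eq_card => X.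
  rewrite [LHS]inE; apply/andP/multsetP.
    rewrite inE => -[/andP[rX aX] /eqP e]; split=> //.
    case: pickP e => [h' /eqP e' /= <- //|no _].
    by have [h' hX] := hex X rX; rewrite no in hX.
  case=> rX aX hX; rewrite inE rX aX; split=> //.
  case: pickP => [h' /eqP/= e'|no]; last by have := no h; rewrite hX eqxx.
  by apply/eqP/val_inj/(@expnI Q); rewrite -?e' -?hX.
rewrite massE conv_substl // [RHS]big_mkcond; apply: eq_bigr => h _.
by rewrite mhE mh0 mulrC.
Qed.

Lemma mass_at0 S : mass S 0 = 1.
Proof.
rewrite /mass gl_order0 divr1 (_ : #|_| = 1%N) //.
rewrite -(cards1 (finfun (fun _ : aT => 0 : 'M[F]_0))); apply: eq_card => X.
rewrite !inE.
have -> : X == [ffun=> 0] by apply/eqP/ffunP=> a; rewrite ffunE flatmx0.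
apply/andP; split; first by apply/is_repP; split=> *;
  rewrite [LHS]flatmx0 flatmx0.
apply/forall_inP=> j _; rewrite -(cards1 (0 : 'M[F]_(dg j, 0))); apply/eqP.
apply: eq_card => B; rewrite [B]thinmx0 mxhom0 inE eqxx //.
Qed.

Lemma mass_setT n : mass setT n.+1 = 0.
Proof.
rewrite /mass (_ : [set X | _ & _] = set0) ?cards0 ?mul0r //.
apply/setP=> X; rewrite !inE; apply/negP=> /andP[rX /forall_inP h].
by have [i /negP[]] := sg_complete rX (ltn0Sn n); apply: h; rewrite inE.
Qed.

(** The irreducibles are peeled off one by one; by completeness, once all are excluded only the
    series 1 remains. *)
Lemma log_coef_mass k : log_coef (mass set0) k =
  \sum_i log_coef (subst (dg i) (gl_series (q ^ dg i))) k.
Proof.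
have log_coef_eq f g : f =1 g -> g 0%N = 1 -> log_coef f k = log_coef g k.
  by move=> e g0; rewrite /log_coef (@eq_logder f g k).
rewrite -big_enum /=; have : uniq (enum I) := enum_uniq _.
have -> : set0 = [set i : I | i \notin enum I].
  by apply/setP=> i; rewrite !inE mem_enum.
elim: (enum I) => [_|i s IH /= /andP[i_s u_s]].
  rewrite big_nil /log_coef (@eq_logder _ (fun n => (n == 0%N)%:R) k) // =>
    [|n _].
    clear log_coef_eq; case: k => [|k]; first by rewrite logder_0 mul0r.
    rewrite (@logder_unique _ (fun=> 0) k.+1) ?mul0r // => n _.
    rewrite /conv big1 => [|j _]; last by rewrite mul0r.
    by case: n => [|n]; rewrite ?mul0r ?mulr0.
  have -> : [set i : I | i \notin [::]] = setT by apply/setP=> i; rewrite !inE.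
  by case: n => [|n]; rewrite ?mass_at0 ?mass_setT.
have iS : i \notin [set j | j \notin i :: s] by rewrite inE mem_head.
have eS : i |: [set j | j \notin i :: s] = [set j | j \notin s].
  apply/setP=> j; rewrite !inE; case: eqVneq => // ->.
  by rewrite (negPf i_s).
rewrite big_cons -IH // (log_coef_eq _ _ (mass_peel iS)); last first.
  by rewrite conv0 subst0 gl_series0 mass_at0 mulr1.
by rewrite log_coef_conv ?subst0 ?gl_series0 ?mass_at0 // eS.
Qed.

End GenProd.

(** * A complete system of irreducibles *)

Lemma finField_socleType (F : finFieldType) (aT : finGroupType) (G : {group aT})
  n
  (rG : mx_representation F G n) : socleType rG.
Proof.
pose simpleb (M : 'M[F]_n) := [&& mxmodule rG M, M != 0
  & [forall U : 'M[F]_n, [&& mxmodule rG U, (U <= M)%MS & U != 0] ==>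
    (M <= U)%MS]].
have simplebP M : reflect (mxsimple rG M) (simpleb M).
  apply: (iffP and3P) => -[modM nzM minM]; split=> //.
    by move=> U mU sU nzU; move/forallP/(_ U): minM; rewrite mU sU nzU.
  by apply/forallP=> U; apply/implyP=> /and3P[]; apply: minM.
exists (enum simpleb) => M; first by rewrite mem_enum => /simplebP.
move=> simM; apply/hasP; exists M; first by rewrite mem_enum; apply/simplebP.
by apply/mxsimple_isoP => //; apply: mx_iso_refl.
Qed.

(** The components of the regular representation: in coprime characteristic, every simple module is
    isomorphic to one of them, and every nonzero X has a simple submodule. *)
Lemma irreps_exist (aT : finGroupType) (F : finFieldType) :
    #|aT|%:R != 0 :> F ->
  exists (I : finType) (dg : I -> nat) (sg : forall i, aT -> 'M[F]_(dg i)),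
  [/\ forall i, irred (sg i),
      forall i j, i != j -> #|mxhom (sg i) (sg j)| = 1%N
    & forall n (X : aT -> 'M[F]_n), is_rep X -> (0 < n)%N ->
        exists i, #|mxhom (sg i) X| != 1%N].
Proof.
move=> nzA; pose G := [set: aT]%G.
have F'G : [pchar F]^'.-group G by rewrite /pgroup pcharf'_nat cardsT.
pose sG := finField_socleType (regular_repr F G).
have inG x : x \in G by rewrite inE.
have irr_sg (i : sG) : irred (irr_repr i).
  have [n_gt0 irri] := (mx_irrP _).1 (socle_irr i); split=> //.
    apply/is_repP; split; first exact: repr_mx1.
    by move=> a b; rewrite repr_mxM.
  by move=> U sU; apply: irri; apply/mxmoduleP.
exists sG, (fun i : sG => irr_degree i), (fun i : sG => irr_repr i); split=> //.
  move=> i j ij; rewrite -(cards1 (0 : 'M[F]_(irr_degree i, irr_degree j)));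
    apply: eq_card => B.
  rewrite [RHS]inE; apply/idP/eqP => [hB|->]; last exact: mxhom0.
  apply: contraNeq ij => nzB; apply/socle_rsimP.
  have fB := irred_mxhom_free (irr_sg i) hB nzB.
  have fB' := irred_mxhom_full (irr_sg j) hB nzB.
  exists B => //; last by move=> x _; move/mxhomP: hB.
  by rewrite -(eqnP fB) -[RHS](eqnP fB').
move=> n X rX n_gt0; have /is_repP[X1 XM] := rX.
have rX' : mx_repr G X by split=> // a b _ _; apply: XM.
pose rG := MxRepresentation rX'.
have nz1 : (1%:M : 'M[F]_n) != 0 by rewrite -mxrank_eq0 mxrank1 -lt0n.
apply/existsP; apply: (mxsimple_exists (mxmodule1 rG) nz1) => -[V simV _];
  apply/existsP.
have [modV _ _] := simV; have irrV := (submod_mx_irr modV).2 simV.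
have [f e fB hf] := mx_rsim_sym (rsim_irr_comp_pchar sG F'G irrV).
set i := irr_comp _ _ in f e fB hf *; exists i.
(* An isomorphism from the component to the simple submodule V, followed by the inclusion of V in
   X. *)
pose B := f *m val_submod (1%:M : 'M_(\rank V)).
have hB : B \in mxhom (irr_repr i) X.
  apply/mxhomP=> a; rewrite /B mulmxA hf // -[_ *m X a]mulmxA.
  rewrite -[val_submod 1%:M *m X a](val_submodJ modV 1%:M) ?inE // mul1mx.
  by rewrite -mulmxA -val_submodE.
have nzB : B != 0.
  have [_ D0 _] := irr_sg i.
  rewrite -mxrank_eq0 mxrankMfree.
    by rewrite (eqnP fB) -lt0n.
  by rewrite /row_free val_submod1.
apply: contraNneq nzB => /eqP/cards1P[Z eZ].
move: (mxhom0 (irr_repr i) X) hB; rewrite eZ !inE => /eqP-> //.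
Qed.

(** * Degrees of the irreducibles *)

Lemma finField_card_pnat (F : finFieldType) p : p \in [pchar F] ->
  exists w, #|F| = (p ^ w)%N.
Proof.
move=> pF; have := pprimeChar_pgroup pF; rewrite /pgroup cardsT => h.
by exists (logn p #|F|); rewrite -p_part part_pnat_id.
Qed.

(** The exponent is a power of the characteristic, so this is an iterated Frobenius map on commuting
    matrices. *)
Lemma mx_comm_exprD (F : finFieldType) n (A B : 'M[F]_n.+1) e :
  A * B = B * A -> (A + B) ^+ (#|F| ^ e)%N = A ^+ (#|F| ^ e) + B ^+ (#|F| ^ e).
Proof.
move=> cAB; have [p p_pr pF] := finPcharP F.
have [w ->] := finField_card_pnat pF; rewrite -expnM.
have pM : p \in [pchar 'M[F]_n.+1] by rewrite pchar_lalg.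
elim: (w * e)%N => [|j IH]; first by rewrite expn0 !expr1.
rewrite expnSr !exprM IH -!(pFrobenius_autE pM) pFrobenius_autD_comm //.
by apply: commrX; apply/commr_sym/commrX.
Qed.

Lemma dvdn_pred_exp q D e : (1 < q)%N -> (0 < D)%N ->
  (q ^ D - 1 %| q ^ e - 1)%N = (D %| e)%N.
Proof.
move=> q1 D0; apply/idP/idP => [|/dvdnP[m ->]]; last first.
  by rewrite !subn1 mulnC expnM dvdn_pred_predX.
rewrite {1}(divn_eq e D) => h.
have d1 : (q ^ D - 1 %| q ^ (e %/ D * D) - 1)%N.
  by rewrite !subn1 mulnC expnM dvdn_pred_predX.
have : (q ^ D - 1 %| q ^ (e %% D) - 1)%N.
  have pos k : (0 < q ^ k)%N by rewrite expn_gt0 ltnW.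
  have e1 : (q ^ (e %/ D * D + e %% D) - 1 =
    (q ^ (e %/ D * D) - 1) * q ^ (e %% D) + (q ^ (e %% D) - 1))%N.
    rewrite expnD mulnBl mul1n addnBA // subnK // leq_pmull //.
  by move: h; rewrite e1 dvdn_addr // dvdn_mulr.
have lt : (q ^ (e %% D) < q ^ D)%N by rewrite ltn_exp2l // ltn_pmod.
move/dvdn_leq; rewrite subn_gt0 -{1}(expn0 q) ltn_exp2l // lt0n /dvdn.
case: eqVneq => // _ /(_ isT).
rewrite leqNgt ltn_sub2r ?ltnS //.
by rewrite -{1}(expn0 q) ltn_exp2l.
Qed.

Section Degree.
Variables (aT : finGroupType) (F : finFieldType).
Hypothesis cA : abelian [set: aT].
Let q := #|F|.
Let q_gt1 : (1 < q)%N. Proof. exact: finNzRing_gt1. Qed.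

(* The endomorphisms of X form a field K with q ^ n elements, spanned by the X a;
   the q ^ e-Frobenius of K is the identity as soon as it fixes every X a, and
   K^* is cyclic of order q ^ n - 1. *)
Lemma irred_degree n (X : aT -> 'M[F]_n) e : irred X ->
  (n %| e)%N = [forall a, X (a ^+ (q ^ e - 1))%g == 1%:M].
Proof.
case: n X => [|n] X irX; first by case: irX.
have [rX _ _] := irX; have /is_repP[X1 XM] := rX.
have XX a k : X (a ^+ k)%g = X a ^+ k.
  by elim: k => [|k IH]; rewrite ?X1 // expgS exprS XM IH.
pose K := [set g : GL n.+1 F | val g \in mxhom X X].
have KE g : (g \in K) = (val g \in mxhom X X) by rewrite [g \in K]in_set.
have gK : group_set K.
  apply/group_setP; split; first by rewrite KE; apply: mxhom1.
  by move=> g h; rewrite !KE => hg hh; apply: mxhom_comp hg hh.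
pose KG := Group gK.
have cK : #|KG| = (q ^ n.+1 - 1)%N.
  have <- : #|mxhom X X :\ 0| = (q ^ n.+1 - 1)%N.
    by rewrite -(card_irred_end cA irX) (cardsD1 0 (mxhom X X)) mxhom0 addKn.
  rewrite -(card_imset _ val_inj); apply: eq_card => B; rewrite in_setD1.
  apply/imsetP/andP => [[g]|[nzB hB]].
    rewrite KE => hg ->; split=> //; apply: contraTneq (valP g) => /= ->.
    by rewrite unitmxE det0 unitr0.
  have uB := irred_mxhom_unit irX hB nzB.
  by exists (Sub B uB : GL n.+1 F); rewrite ?KE.
have abK : abelian KG.
  apply/centsP=> g; rewrite KE => hg h; rewrite KE => hh.
  by apply: val_inj; apply: (irred_end_comm cA irX).
have valM (g h : GL n.+1 F) : val (g * h)%g = val g * val h by [].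
have valX (g : GL n.+1 F) k : val (g ^+ k)%g = val g ^+ k.
  by elim: k => [|k IH] //; rewrite expgS exprS valM IH.
apply/idP/forallP => [ne a|h].
  have uXa : X a \in unitmx.
    case: (mulmx1_unit (_ : X a *m X a^-1%g = 1%:M)) => //.
    by rewrite -XM mulgV X1.
  pose g : GL n.+1 F := Sub (X a) uXa.
  have gK' : g \in KG by rewrite KE; apply: rep_in_hom.
  rewrite XX -[X a]/(val g) -valX; apply/eqP.
  have /dvdnP[m ->] : (#|KG| %| q ^ e - 1)%N by rewrite cK dvdn_pred_exp.
  by rewrite mulnC expgM expg_cardG // expg1n.
have cycK : cyclic KG.
  apply: (@div_ring_mul_group_cyclic _ KG 'M[F]_n.+1 (fun g => val g)) => //.
  move=> g /setD1P[g1]; rewrite KE => hg.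
  apply: (irred_mxhom_unit irX); first exact: mxhomB hg (mxhom1 X).
  by apply: contraNneq g1 => /eqP; rewrite subr_eq0 => /eqP e1;
    apply/eqP/val_inj.
have [g gen] := cyclicP cycK.
have gK' : g \in KG by rewrite gen cycle_id.
have og : #[g] = (q ^ n.+1 - 1)%N by rewrite -cK gen.
rewrite -(@dvdn_pred_exp q n.+1 e) // -og order_dvdn; apply/eqP/val_inj;
  rewrite valX.
have : val g ^+ (q ^ e) = val g.
  have : val g \in mxhom X X by move: gK'; rewrite KE.
  case/(irred_end cA irX) => c ->.
  have Fr a : (c a *: X a) ^+ (q ^ e) = c a *: X a.
    rewrite exprZn -{2}[(q ^ e)%N](@subnK 1) ?expn_gt0 ?(ltnW q_gt1) //.
    rewrite exprD expr1 -XX (eqP (h a)) mul1r; congr (_ *: _).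
    elim: e {h gen} => [|e IH]; first by rewrite expr1.
    by rewrite expnSr exprM IH expf_card.
  rewrite -big_enum /=; elim: (enum aT) => [|a s IH].
    by rewrite big_nil expr0n expn_eq0 /= eqn0Ngt (ltnW q_gt1).
  rewrite big_cons mx_comm_exprD ?IH ?Fr //.
  rewrite mulr_sumr mulr_suml; apply: eq_bigr => b _.
  rewrite -!scalerAl -!scalerAr !scalerA [c b * c a]mulrC; congr (_ *: _).
  exact: (rep_comm cA).
rewrite -{1}[(q ^ e)%N](@subnK 1) ?expn_gt0 ?(ltnW q_gt1) // exprD expr1.
have ug : val g \is a GRing.unit := valP g.
by rewrite -[RHS]mul1r => /(mulIr ug).
Qed.

End Degree.

(** * Irreducibles trivial on a given subgroup *)

Section Count.
Variables (aT : finGroupType) (F : finFieldType).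
Hypothesis nzA : #|aT|%:R != 0 :> F.
Hypothesis cA : abelian [set: aT].
Variables (I : finType) (dg : I -> nat) (sg : forall i, aT -> 'M[F]_(dg i)).
Hypothesis irr_sg : forall i, irred (sg i).
Hypothesis sg_inj : forall i j, i != j -> #|mxhom (sg i) (sg j)| = 1%N.
Hypothesis sg_complete : forall n (X : aT -> 'M[F]_n), is_rep X -> (0 < n)%N ->
  exists i, #|mxhom (sg i) X| != 1%N.
Let q := #|F|.
Let q_gt1 : (1 < q)%N. Proof. exact: finNzRing_gt1. Qed.

(** Splitting off sg i lowers the degree by dg i and removes the factor |End(sg i)| = q^(dg i) from
    the product. *)
Lemma prod_card_mxhom n (X : aT -> 'M[F]_n) : is_rep X ->
  (\prod_i #|mxhom (sg i) X| = q ^ n)%N.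
Proof.
have [k] := ubnP n; elim: k => // k IH in n X *; rewrite ltnS => le_nk rX.
have [n0|n_gt0] := posnP n.
  subst n; rewrite expn0 big1 // => i _.
  rewrite -(cards1 (0 : 'M[F]_(dg i, 0))); apply: eq_card => B.
  by rewrite [B]thinmx0 mxhom0 inE eqxx.
have [i hi] := sg_complete rX n_gt0.
have nt : mxhom (sg i) X != [set 0] by apply: contraNneq hi => ->;
  rewrite cards1.
have [n' [e [B [C [hB hC BC]]]]] := mxhom_nontrivial_split nzA (irr_sg i) rX nt.
subst n; have [g [X' [ug rX' _ _ eX]]] := mxhom_split rX hB hC BC.
have D0 : (0 < dg i)%N by case: (irr_sg i).
rewrite (eq_bigr (fun j => (#|mxhom (sg j) (sg i)| * #|mxhom (sg j) X'|)%N)).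
  have lt : (n' < k)%N by apply: leq_trans le_nk; rewrite -add1n leq_add2r.
  rewrite big_split /= (IH n' X' lt rX').
  rewrite (bigD1 i) //= big1 ?muln1 => [|j ji]; last by rewrite sg_inj.
  by rewrite (card_irred_end cA) // expnD.
by move=> j _; rewrite (card_mxhom_conj_dsum _ ug eX).
Qed.

Variable N : {group aT}.

(* The permutation module on the cosets of N contains each irreducible on which
   N acts trivially exactly once, and no other. *)
Definition cosrep (a : aT) : 'M[F]_#|{: coset_of N}| :=
  \matrix_(x, y) (enum_val x * coset N a == enum_val y)%g%:R.

Let inN a : a \in 'N(N).
Proof. by apply: (subsetP (sub_abelian_norm cA _)); rewrite ?inE ?subsetT. Qed.

Lemma is_rep_cosrep : is_rep cosrep.
Proof.
apply/is_repP; split.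
  by apply/matrixP=> x y; rewrite !mxE morph1 mulg1 (inj_eq enum_val_inj).
move=> a b; apply/matrixP=> x y; rewrite !mxE.
rewrite (bigD1 (enum_rank (enum_val x * coset N a)%g)) //=
  !mxE enum_rankK eqxx mul1r.
rewrite big1 ?addr0 => [|z zx].
  by rewrite morphM ?mulgA //; apply: inN.
rewrite !mxE (_ : (_ == _) = false) ?mul0r //.
by apply: contraNF zx => /eqP->; rewrite enum_valK.
Qed.

Definition trivial_on n (X : aT -> 'M[F]_n) := [forall a in N, X a == 1%:M].

(** Frobenius reciprocity: an intertwiner is determined by its column at the trivial coset, which N
    must fix. If some z in N acts nontrivially, X z - 1 is invertible by Schur's lemma and kills
    that column; otherwise the column is arbitrary. *)
Lemma card_mxhom_cosrep n (X : aT -> 'M[F]_n) : irred X ->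
  #|mxhom X cosrep| = if trivial_on X then (q ^ n)%N else 1%N.
Proof.
move=> irX; have [rX n_gt0 _] := irX; have /is_repP[X1 XM] := rX.
have XV a : X a^-1%g *m X a = 1%:M by rewrite -XM mulVg X1.
pose c a := enum_rank (coset N a).
have colmul (B : 'M[F]_(n, #|{: coset_of N}|)) a b :
    col (c b) (B *m cosrep a) = col (c (b * a^-1)%g) B.
  apply/colP=> i; rewrite !mxE (bigD1 (c (b * a^-1)%g)) //= big1 ?addr0.
    rewrite mxE enum_rankK -morphM ?inN // mulgKV enum_rankK eqxx mulr1 //.
  move=> z zc; rewrite mxE (_ : (_ == _) = false) ?mulr0 //.
  apply: contraNF zc => /eqP h; rewrite -(inj_eq enum_val_inj) enum_rankK.
  rewrite morphM ?inN // morphV ?inN //; apply/eqP/(canRL (mulgK _)).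
  by rewrite h enum_rankK.
have homc B : B \in mxhom X cosrep ->
    forall a, col (c a) B = X a^-1%g *m col (c 1%g) B.
  move=> /mxhomP hB a; rewrite !colE !mulmxA hB -!colE colmul.
  by rewrite invgK mul1g.
have inj : {in mxhom X cosrep &, injective (fun B => col (c 1%g) B)}.
  move=> B C hB hC /= e; apply/matrixP=> i y.
  have [a ey] : exists a, y = c a.
    by exists (repr (enum_val y)); rewrite /c coset_reprK enum_valK.
  by have /colP/(_ i) : col y B = col y C;
    [rewrite ey (homc B hB) (homc C hC) e | rewrite !mxE].
case: ifP => [/forall_inP triv|/negbT ntriv].
  rewrite -(card_in_imset inj).
  have -> : (q ^ n)%N = #|[set: 'cV[F]_n]| by rewrite cardsT card_mx muln1.
  apply: eq_card => w; rewrite inE; apply/imsetP.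
  have Xcos a b : coset N a = coset N b -> X a^-1%g = X b^-1%g.
    move=> /(kercoset_rcoset (inN a) (inN b))[z Nz ->]; rewrite invMg XM.
    have /triv/eqP-> : z^-1%g \in N by rewrite groupV.
    by rewrite mulmx1.
  pose B : 'M[F]_(n, #|{: coset_of N}|) :=
    \matrix_(i, y) (X (repr (enum_val y : coset_of N))^-1%g *m w) i 0.
  have Bc a : col (c a) B = X a^-1%g *m w.
    apply/colP=> i; rewrite [LHS]mxE [LHS]mxE enum_rankK; congr ((_ *m _) _ _).
    by apply: Xcos; rewrite coset_reprK.
  exists B; last by rewrite Bc invg1 X1 mul1mx.
  apply/mxhomP=> a; apply/matrixP=> i y.
  have [b ey] : exists b, y = c b.
    by exists (repr (enum_val y)); rewrite /c coset_reprK enum_valK.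
  have /colP/(_ i) : col y (X a *m B) = col y (B *m cosrep a).
    by rewrite ey colmul Bc colE -mulmxA -colE Bc mulmxA -XM invMg invgK.
  by rewrite !mxE.
rewrite -(cards1 (0 : 'M[F]_(n, #|{: coset_of N}|))); apply: eq_card => B.
rewrite [RHS]inE; apply/idP/eqP => [hB|->]; last exact: mxhom0.
apply: inj => //; first exact: mxhom0.
move: ntriv; rewrite negb_forall_in => /exists_inP[z Nz Xz].
have h : X z - 1%:M \in mxhom X X by apply: mxhomB;
  [apply: (rep_in_hom cA) | apply: mxhom1].
have u : X z - 1%:M \in unitmx by apply: (irred_mxhom_unit irX h);
  rewrite subr_eq0.
apply: (can_inj (mulKmx u)); rewrite mulmxBl mul1mx.
have -> : col (c 1%g) 0 = 0 :> 'cV[F]_n by apply/colP=> i; rewrite !mxE.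
rewrite mulmx0 -[z]invgK -homc //; apply/eqP; rewrite subr_eq0; apply/eqP.
by congr (col _ _); rewrite /c morph1 coset_id // groupV.
Qed.

Lemma sum_degree_trivial :
  (\sum_(i | trivial_on (sg i)) dg i = #|[set: aT] : N|)%N.
Proof.
have := prod_card_mxhom is_rep_cosrep.
rewrite (eq_bigr (fun i => q ^ (if trivial_on (sg i) then dg i else 0))%N).
  rewrite -expn_sum -big_mkcond => /(expnI q_gt1) ->.
  by rewrite -cardsT -quotientT card_quotient //; apply/subsetP=> a _;
    apply: inN.
by move=> i _; rewrite card_mxhom_cosrep //; case: ifP.
Qed.

End Count.

(** * The logarithm of the series, by orders of characters *)

Definition hom_series (aT : finGroupType) (F : finFieldType) (n : nat) : rat :=
  #|homs aT (GL n F)|%:R / (gl_order #|F| n)%:R.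

Lemma card_homs_GL (aT : finGroupType) (F : finFieldType) n :
  #|homs aT (GL n F)| = #|[set X : {ffun aT -> 'M[F]_n} | is_rep X]|.
Proof.
pose f (h : {ffun aT -> GL n F}) : {ffun aT -> 'M[F]_n} :=
  [ffun a => val (h a)].
have inj : injective f.
  by move=> h h' /ffunP e; apply/ffunP=> a; apply: val_inj; have := e a;
    rewrite !ffunE.
rewrite -(card_imset _ inj); apply: eq_card => X; rewrite inE.
apply/imsetP/is_repP => [[h]|[X1 XM]].
  rewrite inE => /morphicP hM ->; split.
    rewrite ffunE; have := hM 1%g 1%g; rewrite !inE mulg1 => /(_ isT isT) h1.
    suff -> : h 1%g = 1%g by [].
    by apply: (mulgI (h 1%g)); rewrite -h1 mulg1.
  by move=> a b; rewrite !ffunE hM ?inE.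
have uX a : X a \in unitmx.
  case: (mulmx1_unit (_ : X a *m X a^-1%g = 1%:M)) => //.
  by rewrite -XM mulgV X1.
exists [ffun a => Sub (X a) (uX a) : GL n F]; last first.
  by apply/ffunP=> a; rewrite !ffunE.
rewrite inE; apply/morphicP=> a b _ _; rewrite !ffunE.
by apply: val_inj; rewrite /= XM.
Qed.

Lemma hom_series0 aT F : hom_series aT F 0 = 1.
Proof.
rewrite /hom_series gl_order0 divr1 card_homs_GL (_ : #|_| = 1%N) //.
rewrite -(cards1 (finfun (fun _ : aT => 0 : 'M[F]_0))); apply: eq_card => X.
rewrite !inE (_ : X == _); last by apply/eqP/ffunP=> a; rewrite ffunE flatmx0.
by apply/is_repP; split=> *; rewrite [LHS]flatmx0 flatmx0.
Qed.

(* The coefficient of x^k in (1/e) log F_{q^e}(x^e), where F_Q is gl_series Q: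
   the contribution of one character whose Frobenius orbit has size e. *)
Definition orbit_log (q e k : nat) : rat :=
  log_coef (subst e (gl_series (q ^ e))) k / e%:R.

(** Truncated subtraction matters: the order is d for 1 <= j <= lam and then grows by a factor p at
    each step. *)
Definition ord_mod (p d lam j : nat) : nat :=
  if j is 0 then 1 else d * p ^ (j - lam).

(* Divisibility states that ord_mod p d lam j is the order of q modulo p^j. *)
Definition ord_mod_spec (p q d lam : nat) : Prop :=
  (0 < d)%N /\ forall j e, (0 < e)%N ->
    (p ^ j %| q ^ e - 1)%N = (ord_mod p d lam j %| e)%N.

(** For abelian groups this is also the number of characters of order dividing p^j, the role in
    which it is used; [index_power_group] provides the duality. *)
Definition num_pow1 (p : nat) (aT : finGroupType) (j : nat) : nat :=
  #|[set a : aT | a ^+ (p ^ j) == 1]%g|.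

Section Powers.
Variables (aT : finGroupType).
Hypothesis cA : abelian [set: aT].

Lemma power_morphM m : {in [set: aT] &,
  {morph (fun x : aT => x ^+ m)%g : x y / (x * y)%g}}.
Proof. by move=> x y _ _; apply: expgMn; apply: (centsP cA); rewrite inE. Qed.

Canonical power_morphism m := Morphism (power_morphM m).

Definition power_group m : {group aT} := (power_morphism m @* [set: aT])%G.

Lemma power_groupP m x : reflect (exists a, x = (a ^+ m)%g)
  (x \in power_group m).
Proof.
apply: (iffP morphimP) => [[a _ _ ->]|[a ->]]; first by exists a.
by exists a; rewrite ?inE.
Qed.

Lemma index_power_group m : #|[set: aT] : power_group m| =
  #|[set a : aT | a ^+ m == 1]%g|.
Proof.
have e : 'ker (power_morphism m) = [set a : aT | a ^+ m == 1]%g.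
  by apply/setP=> a; rewrite !inE.
rewrite -divgS ?subsetT // card_morphim setIT -e.
by rewrite -(Lagrange (subsetT ('ker (power_morphism m)))) mulnK ?indexg_gt0.
Qed.
End Powers.

Section LgGen.
Variables (aT : finGroupType) (F : finFieldType) (p t d lam : nat).
Hypothesis p_pr : prime p.
Hypothesis pF : ~~ (p %| #|F|)%N.
Hypothesis cA : abelian [set: aT].
Hypothesis expA : forall a : aT, (a ^+ (p ^ t) = 1)%g.
Hypothesis q_lte : ord_mod_spec p #|F| d lam.
Let q := #|F|.

Lemma pgroup_card_nz : #|aT|%:R != 0 :> F.
Proof.
have pA : p.-group [set: aT].
  rewrite -pnat_exponent; have : (exponent [set: aT] %| p ^ t)%N.
    by apply/exponentP=> a _; apply: expA.
  by move/pnat_dvd; apply; rewrite pnatX pnat_id.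
have [l l_pr lF] := finPcharP F; rewrite -pcharf'_nat -cardsT.
apply: sub_in_pnat pA => r _; rewrite !inE => /eqP->.
apply/negP=> /andP[_ /eqP pF0]; move/negP: pF; apply.
have pF' : p \in [pchar F] by rewrite inE p_pr pF0 eqxx.
have [w e] := finField_card_pnat pF'; rewrite e.
case: w e => [|w] e; last by rewrite expnS dvdn_mulr.
by have := finNzRing_gt1 F; rewrite e expn0.
Qed.

(** Group the irreducibles by the order p^j of their characters. Their degree is the order of q
    modulo p^j, and the degrees up to level j add up to [num_pow1 p aT j]. *)
Lemma log_coef_hom_series k : log_coef (hom_series aT F) k =
  \sum_(j < t.+1) ((num_pow1 p aT j)%:R -
    (if j : nat is j'.+1 then num_pow1 p aT j' else 0%N)%:R)
     * orbit_log q (ord_mod p d lam j) k.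
Proof.
have nzA := pgroup_card_nz.
have [I [dg [sg [irr_sg sg_inj sg_complete]]]] := irreps_exist nzA.
have end_sg i := card_irred_end cA (irr_sg i).
have GenE : hom_series aT F =1 mass sg set0.
  move=> n; rewrite /hom_series /mass card_homs_GL; congr (_%:R / _).
  apply: eq_card => X; rewrite !inE; case: is_rep => //=.
  by apply/esym/forall_inP=> j; rewrite inE.
have -> : log_coef (hom_series aT F) k = log_coef (mass sg set0) k.
  by rewrite /log_coef (@eq_logder (hom_series aT F) (mass sg set0) k) //
    mass_at0.
rewrite (log_coef_mass nzA irr_sg end_sg sg_inj sg_complete).
pose T j i := trivial_on (power_group cA (p ^ j)) (sg i).
have TP j i : reflect (forall a, sg i (a ^+ (p ^ j))%g = 1%:M) (T j i).
  apply: (iffP forall_inP) => [h a|h x /power_groupP[a ->]]; last by rewrite h.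
  by apply/eqP/h/power_groupP; exists a.
have sg1 i : sg i 1%g = 1%:M by case: (irr_sg i) => /is_repP[].
have sgM i a b : sg i (a * b)%g = sg i a *m sg i b.
  by case: (irr_sg i) => /is_repP[].
have Tt i : T t i by apply/TP=> a; rewrite expA.
have sgd i m m' : (m %| m')%N -> (forall a, sg i (a ^+ m)%g = 1%:M) ->
    forall a, sg i (a ^+ m')%g = 1%:M.
  by move=> /dvdnP[c ->] h a; rewrite expgM h.
have Tmono i j j' : (j <= j')%N -> T j i -> T j' i.
  by move=> le /TP h; apply/TP; apply: sgd h; apply: dvdn_exp2l.
have lev_ex i : exists j, T j i by exists t.
(* The characters contained in sg i have order p^(lev i). *)
pose lev i := ex_minn (lev_ex i).
have levP i j : T j i = (lev i <= j)%N.
  rewrite /lev; case: ex_minnP => m Tm mmin; apply/idP/idP => [/mmin//|le].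
  exact: Tmono le Tm.
have lev_t i : (lev i < t.+1)%N by rewrite ltnS -levP.
have dgE i : dg i = ord_mod p d lam (lev i).
  have [d0 lteq] := q_lte.
  have D0 : (0 < dg i)%N by case: (irr_sg i).
  have o0 : (0 < ord_mod p d lam (lev i))%N.
    by case: (lev i) => //= j; rewrite muln_gt0 d0 expn_gt0 prime_gt0.
  have key e : (0 < e)%N -> (dg i %| e)%N = (ord_mod p d lam (lev i) %| e)%N.
    move=> e0; rewrite -lteq // (irred_degree cA e (irr_sg i)) -/q.
    apply/forallP/idP => [h|dv a]; last first.
      by apply/eqP; move: a; apply: sgd dv _; apply/TP; rewrite levP.
    (* The powers of exponents q^e - 1 and p^t act trivially, hence by Bezout so do those of
       exponent p^m, their gcd. Thus lev i <= m, and p^(lev i) divides q^e - 1. *)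
    have [m le_mt gE] := (dvdn_pfactor (gcdn (q ^ e - 1) (p ^ t)) t p_pr)
      (dvdn_gcdr _ _).
    have u0 : (0 < q ^ e - 1)%N.
      by rewrite subn_gt0 -(exp1n e) ltn_exp2r // finNzRing_gt1.
    case: (egcdnP (p ^ t) u0) => km kn Eg _.
    have Tm : T m i.
      apply/TP=> a; rewrite -gE.
      have := sgd i _ _ (dvdn_mull km (dvdnn (q ^ e - 1)%N))
        (fun b => eqP (h b)) a.
      by rewrite Eg expgD sgM mulnC expgM expA expg1n sg1 mul1mx.
    move: Tm; rewrite levP => le; apply: dvdn_trans (dvdn_exp2l p le) _.
    by rewrite -gE dvdn_gcdl.
  by apply/eqP; rewrite eqn_dvd key // dvdnn -key // dvdnn.
have sumT j : (\sum_(i | T j i) dg i = num_pow1 p aT j)%N.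
  by rewrite (sum_degree_trivial nzA cA irr_sg sg_inj sg_complete)
    index_power_group.
(* The logarithm of one factor is shared equally among the dg i characters of the orbit. *)
have orbit_logE i : log_coef (subst (dg i) (gl_series (#|F| ^ dg i))) k =
    (dg i)%:R * orbit_log q (ord_mod p d lam (lev i)) k.
  rewrite -dgE /orbit_log mulrC mulfVK // pnatr_eq0 -lt0n; by case: (irr_sg i).
rewrite (eq_bigr _ (fun i _ => orbit_logE i)).
rewrite (partition_big (fun i => Ordinal (lev_t i)) xpredT) //=.
apply: eq_bigr => j _.
rewrite (eq_bigr (fun i => (dg i)%:R * orbit_log q (ord_mod p d lam j) k));
  last first.
  by move=> i /eqP <-.
rewrite -mulr_suml; congr (_ * _); rewrite -natr_sum.
have -> : (\sum_(i | Ordinal (lev_t i) == j) dg i =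
  \sum_(i | lev i == j) dg i)%N by [].
rewrite -sumT; case: (nat_of_ord j) => [|j'].
  rewrite subr0; congr (_%:R); apply: eq_bigl => i.
  by rewrite levP leqn0.
have -> : (\sum_(i | T j'.+1 i) dg i =
    \sum_(i | T j' i) dg i + \sum_(i | lev i == j'.+1) dg i)%N.
  rewrite (bigID (fun i => T j' i) (fun i => T j'.+1 i)) /=; congr (_ + _)%N.
    by apply: eq_bigl => i; apply: andb_idl; apply: Tmono.
  by apply: eq_bigl => i; rewrite !levP -ltnNge eqn_leq.
by rewrite sumT natrD addrAC subrr add0r.
Qed.

End LgGen.

(** * Orders modulo prime powers *)

Section LTE.
Variable p : nat.
Hypothesis p_pr : prime p.

Lemma expn_1D b i : exists x, ((1 + b) ^ i = 1 + i * b + b ^ 2 * x)%N.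
Proof.
elim: i => [|i [x e]]; first by exists 0%N; rewrite expn0 mul0n muln0 !addn0.
by exists (i + x + b * x)%N; rewrite expnS e; nia.
Qed.

(** The b-linear term is kept because it decides the valuation of the sum when k = p. *)
Lemma sum_expn_1D b k :
  exists x, (\sum_(i < k) (1 + b) ^ i = k + b * 'C(k, 2) + b ^ 2 * x)%N.
Proof.
elim: k => [|k [x e]]; first by exists 0%N; rewrite big_ord0 bin0n !muln0.
have [y e'] := expn_1D b k; exists (x + y)%N.
rewrite big_ord_recr /= e e' binS bin1; nia.
Qed.

Lemma logn_expn_sub1_coprime a u : (1 < a)%N -> (p %| a - 1)%N ->
  ~~ (p %| u)%N ->
  logn p (a ^ u - 1) = logn p (a - 1).
Proof.
move=> a1 pa pu; have u0 : (0 < u)%N by case: u pu => //; rewrite dvdn0.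
rewrite !subn1 predn_exp lognM ?subn1; last 2 first.
- by rewrite -subn1 subn_gt0.
- by case: u pu u0 => // u _ _; rewrite big_ord_recl expn0.
rewrite [X in (_ + X)%N](_ : _ = 0%N) ?addn0 //; apply: logn_coprime.
have [x e] := sum_expn_1D (a - 1) u; rewrite subnKC ?(ltnW a1) // in e.
rewrite prime_coprime // e dvdn_addl; last first.
  by rewrite expnS -mulnA dvdn_mulr.
by rewrite dvdn_addl // dvdn_mulr.
Qed.

Lemma logn_expn_sub1_p a : (1 < a)%N -> (p %| a - 1)%N ->
    (3 <= p)%N \/ (2 <= logn p (a - 1))%N ->
  logn p (a ^ p - 1) = (logn p (a - 1)).+1.
Proof.
move=> a1 pa hp; have p0 := prime_gt0 p_pr.
have am0 : (0 < a - 1)%N by rewrite subn_gt0.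
have -> : (a ^ p - 1 = (a - 1) * \sum_(i < p) a ^ i)%N by rewrite !subn1
  predn_exp.
rewrite lognM //; last first.
  by case: (p) p0 => // u _; rewrite big_ord_recl expn0.
rewrite -[RHS]addn1; congr (_ + _)%N.
have [x e] := sum_expn_1D (a - 1) p; rewrite subnKC ?(ltnW a1) // in e.
(* For p >= 3 one factor p comes from the binomial coefficient; otherwise a - 1 is divisible by p^2.
   This is where the assumption on p and lambda_0 enters. *)
have d2 : (p ^ 2 %| (a - 1) * 'C(p, 2))%N.
  case: hp => [p3|l2].
    by apply: dvdn_mul => //; apply: prime_dvd_bin.
  by rewrite dvdn_mulr // pfactor_dvdn.
have [y ey] : exists y, (\sum_(i < p) a ^ i = p * (1 + p * y))%N.
  case/dvdnP: d2 => y1 e1; case/dvdnP: pa => y2 e2.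
  by exists (y1 + y2 ^ 2 * x)%N; rewrite e e1 e2; nia.
rewrite ey lognM // logn_prime // eqxx logn_coprime //.
by rewrite prime_coprime // dvdn_addl ?dvdn1 ?dvdn_mulr // neq_ltn prime_gt1
  ?orbT.
Qed.

Lemma logn_expn_sub1 a m : (1 < a)%N -> (p %| a - 1)%N ->
    (3 <= p)%N \/ (2 <= logn p (a - 1))%N -> (0 < m)%N ->
  logn p (a ^ m - 1) = (logn p (a - 1) + logn p m)%N.
Proof.
move=> a1 pa hp m0; have [u cop em] := pfactor_coprime p_pr m0.
have pu : ~~ (p %| u)%N by rewrite -prime_coprime.
have gt1 k : (1 < a ^ p ^ k)%N by rewrite -(exp1n (p ^ k)) ltn_exp2r // expn_gt0
  prime_gt0.
have key k : (logn p (a ^ p ^ k - 1) = logn p (a - 1) + k)%N.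
  elim: k => [|k IH]; first by rewrite expn0 expn1 addn0.
  have l1 : (0 < logn p (a - 1))%N by rewrite logn_gt0 mem_primes p_pr subn_gt0
    a1 pa.
  rewrite expnSr expnM logn_expn_sub1_p ?IH ?addnS //.
    have : (p ^ 1 %| a ^ p ^ k - 1)%N.
      by rewrite pfactor_dvdn ?subn_gt0 // IH ltn_addr.
    by rewrite expn1.
  by case: hp => hp; [left | right; rewrite ltn_addr].
rewrite {1}em mulnC expnM logn_expn_sub1_coprime ?key //.
have : (p ^ 1 %| a ^ p ^ logn p m - 1)%N.
  rewrite pfactor_dvdn ?subn_gt0 // key ltn_addr //.
  by rewrite logn_gt0 mem_primes p_pr subn_gt0 a1 pa.
by rewrite expn1.
Qed.

Lemma primitive_root_Fp_expn q d e : (0 < q)%N ->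
  d.-primitive_root (q%:R : 'F_p) ->
  (p %| q ^ e - 1)%N = (d %| e)%N.
Proof.
move=> q0 hd; rewrite (prim_order_dvd hd) -natrX -subr_eq0.
have q1 : (1 <= q ^ e)%N by rewrite expn_gt0 q0.
by rewrite -[X in _ - X]/(1%:R) -natrB // (dvdn_pcharf (pchar_Fp p_pr)).
Qed.

Lemma ord_mod_spec_lam q d : (1 < q)%N -> d.-primitive_root (q%:R : 'F_p) ->
    (3 <= p)%N \/ (2 <= lam p q d 0)%N ->
  ord_mod_spec p q d (lam p q d 0) /\ ~~ (p %| d)%N.
Proof.
move=> q1 hd hp; have d0 := prim_order_gt0 hd.
have q0 := ltnW q1; have key e := primitive_root_Fp_expn e q0 hd.
rewrite /lam expn0 muln1 in hp *.
have a1 : (1 < q ^ d)%N by rewrite -(exp1n d) ltn_exp2r.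
have pa : (p %| q ^ d - 1)%N by rewrite key.
split; last first.
  have qz : (q%:R : 'F_p) != 0.
    apply/eqP=> q0'; have := prim_expr_order hd; rewrite q0' expr0n.
    by rewrite eqn0Ngt d0 => /eqP; rewrite eq_sym oner_eq0.
  have : (d %| p.-1)%N.
    rewrite (prim_order_dvd hd); apply/eqP/(mulfI qz); rewrite mulr1 -exprS.
    by rewrite prednK ?prime_gt0 //; have := expf_card (q%:R : 'F_p);
      rewrite card_Fp.
  move=> dp; apply/negP=> /dvdn_trans/(_ dp)/dvdn_leq.
  have := prime_gt1 p_pr; lia.
split=> // -[|j] e e0; first by rewrite expn0 !dvd1n.
have ge1 : (0 < q ^ e - 1)%N by rewrite subn_gt0 -(exp1n e) ltn_exp2r.
have [/dvdnP[m em]|nd] := boolP (d %| e)%N; last first.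
  rewrite (_ : (_ %| q ^ e - 1)%N = false).
    by apply/esym; apply: contraNF nd; apply: dvdn_trans; apply: dvdn_mulr.
  apply: contraNF nd; rewrite -key; apply: dvdn_trans.
  by rewrite expnS dvdn_mulr.
have m0 : (0 < m)%N by case: m em e0 => //; rewrite mul0n => ->.
rewrite pfactor_dvdn // em mulnC expnM logn_expn_sub1 // /ord_mod.
by rewrite dvdn_pmul2l // pfactor_dvdn // leq_subLR.
Qed.
End LTE.

(** * Valuations of exponential series *)

Section Numerics.
Variable p : nat.
Hypothesis p_pr : prime p.
Let p_gt1 := prime_gt1 p_pr.
Let p_gt0 := prime_gt0 p_pr.

Lemma logn_fact_trunc n N : (n <= N)%N ->
  logn p n`! = (\sum_(1 <= k < N.+1) n %/ p ^ k)%N.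
Proof.
move=> le; rewrite logn_fact // [RHS](@big_cat_nat _ _ _ n.+1) //=.
rewrite [X in (_ + X)%N]big1_seq ?addn0 // => k;
  rewrite mem_index_iota => /andP[_ /andP[lt _]].
by rewrite divn_small // (leq_trans lt) // ltnW // ltn_expl.
Qed.

Lemma logn_fact_step n : logn p n`! = (n %/ p + logn p (n %/ p)`!)%N.
Proof.
rewrite (@logn_fact_trunc (n %/ p) n) ?leq_div //.
rewrite (@logn_fact_trunc n n.+1) // big_nat_recl //; congr (_ + _)%N.
by apply: eq_bigr => k _; rewrite expnS divnMA.
Qed.

Lemma logn_fact_lt n : (0 < n)%N -> (logn p n`! < n)%N.
Proof.
elim/ltn_ind: n => n IH n0; rewrite logn_fact_step.
have lt : (n %/ p < n)%N by rewrite ltn_Pdiv.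
have [->|d0] := posnP (n %/ p); first by rewrite fact0 logn1.
have := IH _ lt d0; have := leq_trunc_div n p; nia.
Qed.

Lemma logn_factD m n : (logn p m`! + logn p n`! <= logn p (m + n)`!)%N.
Proof.
rewrite -lognM ?fact_gt0 // dvdn_leq_log ?fact_gt0 //.
by rewrite -(bin_fact (leq_addr n m)) addKn dvdn_mull.
Qed.

(** The integer (w m)! / ((w!)^m m!) counts the partitions of a set of w m elements into m blocks of
    size w; the induction adds one block. *)
Lemma logn_factM w m : (0 < w)%N ->
  (m * logn p w`! + logn p m`! <= logn p (w * m)`!)%N.
Proof.
case: w => [//|w] _.
elim: m => [|m IH]; first by rewrite mul0n muln0 fact0 logn1.
pose N := (w.+1 * m + w)%N.
have e : ((w.+1 * m.+1)`! = (w.+1 * m)`! * w.+1`! * (m.+1 * 'C(N, w)))%N.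
  have -> : (w.+1 * m.+1 = N.+1)%N by rewrite /N; lia.
  rewrite -(@bin_fact N.+1 w.+1) ?ltnS ?leq_addl //.
  have -> : (N.+1 - w.+1 = w.+1 * m)%N by rewrite subSS /N addnK.
  have h : ('C(N.+1, w.+1) = m.+1 * 'C(N, w))%N.
    apply/eqP; rewrite -(@eqn_pmul2l w.+1) // -mul_bin_diag mulnA.
    by apply/eqP; congr (_ * _)%N; rewrite /N; lia.
  by rewrite h; lia.
have C0 : (0 < 'C(N, w))%N by rewrite bin_gt0 leq_addl.
move: (fact_gt0 w.+1) IH; rewrite e mulSn (factS m); set W := w.+1`!;
  clearbody W.
by move=> W0; rewrite !lognM ?muln_gt0 ?fact_gt0 ?W0 ?C0 //; lia.
Qed.

(** For p = w = 2 and t = 1 the bound fails by one, which is the source of the exception p = 2, a_l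
    = -1. *)
Lemma p_small_bound w t : (p ^ t %| w)%N -> (1 < w)%N -> (p, w) <> (2, 2)%N ->
  (t + 1 <= w - 1)%N.
Proof.
move=> dv w1 ne; have le := dvdn_leq (ltnW w1) dv.
have [p3|p2] := leqP 3 p.
  have : (2 * t + 1 <= p ^ t)%N.
    elim: t {dv le} => [|t IH]; first by rewrite expn0.
    by rewrite expnS; nia.
  lia.
have ep : p = 2%N by apply/eqP; rewrite eqn_leq p_gt1 -ltnS p2.
case: t => [|[|t]] in dv le *; first lia.
  have w2 : w <> 2%N by move=> e; apply: ne; rewrite ep e.
  lia.
have : (t.+2 + 2 <= 2 ^ t.+2)%N by elim: t {dv le} => // t IH; rewrite expnS;
  lia.
rewrite -ep; lia.
Qed.

Lemma p_small_bound_weak w t : (p ^ t %| w)%N -> (1 < w)%N -> (t <= w - 1)%N.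
Proof.
move=> dv w1; have le := dvdn_leq (ltnW w1) dv.
have := ltn_expl t p_gt1; lia.
Qed.

Variable a : int.


(** The valuation of c^M / M! when v_p(c) = a. *)
Definition threshold (M : nat) : int := a * M%:Z - (logn p M`!)%:Z.

Lemma threshold_add M N : threshold (M + N) <= threshold M + threshold N.
Proof. by rewrite /threshold; have := logn_factD M N; lia. Qed.

Hypothesis a_neg : a <= -1.

Lemma threshold_le M N : threshold (M + N) <= threshold M - N%:Z.
Proof.
rewrite /threshold; have := logn_factD M N.
have : a * N%:Z <= - N%:Z by rewrite -mulN1r ler_wpM2r.
lia.
Qed.

Variables (d l i0 : nat).
Hypothesis d_gt0 : (0 < d)%N.
Hypothesis pd : ~~ (p %| d)%N.
Hypothesis a_small : i0 = l \/ -2 <= a.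

Lemma exp_bound k m : (0 < k)%N -> (d * p ^ i0 %| k)%N -> k <> (d * p ^ l)%N ->
  let M := ((k * m) %/ (d * p ^ l))%N in
  let e := m%:Z * (a + 2 * l%:Z - 2 * (logn p k)%:Z) - (logn p m`!)%:Z in
  threshold M <= e /\ ((d * p ^ l %| k * m)%N -> (0 < m)%N ->
    ~ (p = 2%N /\ a = -1) ->
                 threshold M + 1 <= e).
Proof.
move=> k0 dk kD M e.
have /dvdnP[k' ek'] : (d %| k)%N by apply: dvdn_trans dk; apply: dvdn_mulr.
rewrite mulnC in ek'; have k'0 : (0 < k')%N by move: k0; rewrite ek';
  case: k' ek' => //; rewrite muln0.
have vk : logn p k = logn p k' by rewrite ek' lognM // logn_coprime
  ?prime_coprime.
have i0k : (i0 <= logn p k')%N.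
  by rewrite -pfactor_dvdn // -(dvdn_pmul2l d_gt0) -ek'.
have MM : M = ((k' * m) %/ p ^ l)%N by rewrite /M ek' -mulnA divnMl.
have dM : (d * p ^ l %| k * m)%N = (p ^ l %| k' * m)%N.
  by rewrite ek' -mulnA dvdn_pmul2l.
rewrite dM {dM}; rewrite /e vk; clearbody M e; clear vk.
(* Case k' = p^l w with w > 1. By [logn_factM] it suffices that -a (w - 1) + v_p(w!) >= 2 v_p(w),
   with a surplus of 1 for strictness. *)
have [le|lt] := leqP l (logn p k').
  have /dvdnP[w ew] : (p ^ l %| k')%N by rewrite pfactor_dvdn.
  have w0 : (0 < w)%N by move: k'0; rewrite ew; case: w ew.
  have w1 : (1 < w)%N.
    by rewrite ltn_neqAle w0 andbT; apply/eqP=> w1; apply: kD;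
      rewrite ek' ew -w1 mul1n.
  have vw : logn p k' = (logn p w + l)%N.
    by rewrite ew lognM ?expn_gt0 ?p_gt0 // pfactorK.
  have MM' : M = (w * m)%N.
    by rewrite MM ew mulnAC mulnK // expn_gt0 p_gt0.
  have A := logn_factM m w0.
  have B : (logn p w <= logn p w`!)%N.
    by rewrite dvdn_leq_log ?fact_gt0 // dvdn_fact // w0 leqnn.
  have pt : (p ^ logn p w %| w)%N by rewrite pfactor_dvdn.
  rewrite /threshold MM' vw; set t := logn p w in B pt *.
  set f := logn p w`! in A B *.
  have C : a * (w * m)%N%:Z = a * w%:Z * m%:Z by rewrite PoszM mulrA.
  have Pw : w%:Z - 1 <= - a * (w%:Z - 1).
    by rewrite -[leLHS]mul1r ler_wpM2r //; lia.
  have fin (c : int) : 0 <= - a * (w%:Z - 1) + f%:Z - 2 * t%:Z - c ->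
      a * w%:Z * m%:Z - (logn p (w * m)`!)%:Z + m%:Z * c
      <= m%:Z * (a + 2 * l%:Z - 2 * (t + l)%N%:Z) - (logn p m`!)%:Z.
    move=> E; have := mulr_ge0 (isT : 0 <= m%:Z) E; move: A.
    rewrite !mulrDr !mulrN; move: (logn p (w * m)`!) => X A' E'; clear - A' E';
      lia.
  rewrite C; split=> [|_ m0 nexc].
    have D := p_small_bound_weak pt w1.
    by rewrite -[leLHS]addr0 -(mulr0 m%:Z); apply: fin; clear - D Pw B w1; lia.
  have E : 2 * t%:Z + 1 <= - a * (w%:Z - 1) + f%:Z.
    have [[ep ew2]|ne] := eqVneq (p, w) (2, 2)%N.
      have a2 : a <= -2 by have : a <> -1 by [move=> ea; apply: nexc]; lia.
      have t1 : t = 1%N by rewrite /t ew2 ep.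
      have B' : (1 <= f)%N by move: B; rewrite t1.
      have -> : - a * (w%:Z - 1) = - a by rewrite ew2 mulr1.
      by rewrite t1; clear - a2 B'; lia.
    have D := p_small_bound pt w1 (elimN eqP ne); clear - D Pw B w1; lia.
  apply: le_trans (fin 1 _); last lia.
  by rewrite mulr1 lerD2l.
(* Now i0 <= v_p(k) < l, so a >= -2 and the bound a + 2 l - 2 v_p(k) for theta_k is nonnegative. *)
have a2 : -2 <= a by case: a_small => // e0; lia.
rewrite /threshold.
have [v ev] : exists v, (logn p k' = v)%N by exists (logn p k').
rewrite ev in lt *.
have aM : a * M%:Z <= 0.
  by rewrite mulr_le0_ge0 //; apply: le_trans a_neg _.
(* If it is positive, it outweighs the factorial, as v_p(m!) < m, while the threshold is at most
   0. *)
have [e1|e0] := lerP 1 (a + 2 * l%:Z - 2 * v%:Z).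
  case: (posnP m) => [m0|m0].
    rewrite m0 fact0 logn1 mul0r; split=> //; clear - aM; lia.
  have := logn_fact_lt m0; set e2 := a + _ - _ in e1 *.
  have me : m%:Z <= m%:Z * e2 by rewrite -[leLHS]mulr1 ler_wpM2l.
  move: (logn p m`!) (logn p M`!) => x y lt'; clear - lt' me aM; split; lia.
(* If it is 0, then a = -2 and v_p(k) = l - 1. With m' = floor(m / p), the factorial costs m' +
   v_p(m'!), whereas the threshold is at most -2 m' - v_p(m'!). *)
have -> : a + 2 * l%:Z - 2 * v%:Z = 0 by clear - e0 a2 lt; lia.
have ea : a = -2 by clear - e0 a2 lt; lia.
have el : l = v.+1 by clear - e0 a2 lt; lia.
rewrite mulr0 (logn_fact_step m).
have /dvdnP[u eu] : (p ^ v %| k')%N by rewrite pfactor_dvdn // ev.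
have u0 : (0 < u)%N by move: k'0; rewrite eu; case: u eu.
have MMu : M = ((u * m) %/ p)%N.
  by rewrite MM el eu expnS mulnAC divnMr // expn_gt0 p_gt0.
have le : (m %/ p <= M)%N by rewrite MMu leq_div2r // leq_pmull.
have := threshold_le (m %/ p) (M - m %/ p);
  rewrite subnKC // /threshold ea => h.
move: (logn p (m %/ p)`!) (logn p M`!) h => x y h.
split; first by clear - h le; lia.
rewrite el eu expnS mulnAC dvdn_pmul2r ?expn_gt0 ?p_gt0 // Euclid_dvdM // =>
  dv m0 _.
have pm : (p %| m)%N.
  case/orP: dv => // pu.
  have : (p ^ v.+1 %| k')%N by rewrite eu expnS dvdn_pmul2r ?expn_gt0 ?p_gt0.
  by rewrite pfactor_dvdn // ev ltnn.
have : (0 < m %/ p)%N by rewrite divn_gt0 // dvdn_leq.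
by clear - h le; lia.
Qed.

End Numerics.

(** The series exp(c X^k), with c the argument [x]. *)
Definition exp_monomial (k : nat) (x : rat) : nat -> rat :=
  subst k (fun m => x ^+ m / m`!%:R).

Lemma exp_monomial0 k x : exp_monomial k x 0 = 1.
Proof. by rewrite /exp_monomial subst0 expr0 fact0 divr1. Qed.

Lemma logder_exp x k : logder (fun m => x ^+ m / m`!%:R) k = x * (k == 1%N)%:R.
Proof.
apply: (@logder_unique _ (fun j => x * (j == 1%N)%:R) k) => // n _.
rewrite /conv; case: n => [|n].
  by rewrite big_ord1 mul0r mulr0 mul0r.
rewrite !big_ord_recl big1 /= => [|i _]; last by rewrite mulr0 mul0r.
rewrite mulr0 mul0r add0r addr0 mulr1 subSS subn0 factS natrM invfM exprS.
by rewrite mulrCA mulVKf ?pnatr_eq0 // mulrA.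
Qed.

Lemma log_coef_exp_monomial k x n : (0 < k)%N ->
  log_coef (exp_monomial k x) n = x * (n == k)%:R.
Proof.
move=> k0; rewrite /exp_monomial log_coef_subst //.
case: ifP => [/dvdnP[m ->]|nd]; last first.
  by rewrite (_ : (n == k) = false) ?mulr0 //; apply: contraFF nd => /eqP->.
have -> : (m * k == k)%N = (m == 1)%N by rewrite -{2}[k]mul1n eqn_pmul2r.
rewrite mulnK // /log_coef logder_exp.
by case: eqP => [->|]; rewrite ?mulr0 ?mul0r ?divr1.
Qed.

(** * Classes of series stable under products *)

Section Classes.
Variables (p : nat) (a : int) (D : nat).
Hypothesis p_pr : prime p.
Hypothesis a_neg : a <= -1.
Hypothesis D_gt0 : (0 < D)%N.
Local Notation thr := (threshold p a).

(* [thr (n %/ D)] is the valuation of the coefficient of x^n in exp(c x^D) for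
   v_p(c) = a and D dividing n. *)
Definition bounded (f : nat -> rat) : Prop := forall n,
  vge p (thr (n %/ D)) (f n).

(** Factors too small to disturb the leading coefficients: an [exact] series times a [sharp] one is
    [exact]. The dominant exponential will be exact and every other factor sharp. *)
Definition sharp (f : nat -> rat) : Prop := [/\ f 0%N = 1, bounded f
  & forall n, (0 < n)%N -> (D %| n)%N -> vge p (thr (n %/ D) + 1) (f n)].

Definition exact (f : nat -> rat) : Prop := [/\ f 0%N = 1, bounded f
  & forall n, (D %| n)%N -> veq p (thr (n %/ D)) (f n)].

(** The witness k is the carry in adding the residues of i and n - i modulo D. *)
Lemma div_split n i : (i <= n)%N -> exists2 k,
  (n %/ D = i %/ D + (n - i) %/ D + k)%N &
  (D %| n)%N -> ~~ (D %| i)%N -> (0 < k)%N.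
Proof.
move=> le; exists (D <= i %% D + (n - i) %% D)%N.
  by rewrite -{1}(subnKC le) divnD.
move=> dn di; rewrite lt0b; apply: dvdn_leq.
  by rewrite addn_gt0 lt0n; move: di; rewrite /dvdn => ->.
by rewrite /dvdn modnDm subnKC.
Qed.

Lemma thr_conv n i : (i <= n)%N ->
  thr (n %/ D) <= thr (i %/ D) + thr ((n - i) %/ D).
Proof.
move=> le; have [k -> _] := div_split le.
have h1 := threshold_le p_pr a_neg (i %/ D + (n - i) %/ D)%N k.
have h2 := threshold_add p_pr a (i %/ D)%N ((n - i) %/ D)%N; lia.
Qed.

Lemma thr_conv_strict n i : (i <= n)%N -> (D %| n)%N -> ~~ (D %| i)%N ->
  thr (n %/ D) + 1 <= thr (i %/ D) + thr ((n - i) %/ D).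
Proof.
move=> le dn di; have [k -> /(_ dn di) k0] := div_split le.
have h1 := threshold_le p_pr a_neg (i %/ D + (n - i) %/ D)%N k.
have h2 := threshold_add p_pr a (i %/ D)%N ((n - i) %/ D)%N; lia.
Qed.

Lemma bounded_conv f g : bounded f -> bounded g -> bounded (conv f g).
Proof.
move=> hf hg n; apply: (vge_sum p_pr) => i _;
  have le : (i <= n)%N by rewrite -ltnS.
by apply: (vgeW p_pr (thr_conv le)); apply: vgeM.
Qed.

Lemma sharp_bounded f : sharp f -> bounded f. Proof. by case. Qed.

Lemma sharp_conv f g : sharp f -> sharp g -> sharp (conv f g).
Proof.
move=> [f0 hf sf] [g0 hg sg]; split; first by rewrite conv0 f0 g0 mulr1.
  exact: bounded_conv.
move=> n n0 dn; apply: (vge_sum p_pr) => i _;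
  have le : (i <= n)%N by rewrite -ltnS.
have [di|di] := boolP (D %| i)%N; last first.
  by apply: (vgeW p_pr (thr_conv_strict le dn di)); apply: vgeM.
have [i0|i0] := posnP i; first by rewrite i0 f0 mul1r subn0; apply: sg.
apply: (@vgeW _ p_pr _ (thr (i %/ D) + 1 + thr ((n - i) %/ D))).
  by rewrite [leRHS]addrAC lerD2r thr_conv.
by apply: vgeM => //; apply: sf.
Qed.

(** When D divides n, only the term with i = n attains the threshold; the others gain one from a
    carry or from the sharpness of g. *)
Lemma exact_conv f g : exact f -> sharp g -> exact (conv f g).
Proof.
move=> [f0 hf ef] [g0 hg sg]; split; first by rewrite conv0 f0 g0 mulr1.
  exact: bounded_conv.
move=> n dn; rewrite /conv big_ord_recr /= subnn g0 mulr1 addrC.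
apply: (veqD p_pr); first exact: ef.
apply: (vge_sum p_pr) => i _; have lt := ltn_ord i; have le := ltnW lt.
have [di|di] := boolP (D %| i)%N; last first.
  by apply: (vgeW p_pr (thr_conv_strict le dn di)); apply: vgeM.
apply: (@vgeW _ p_pr _ (thr (i %/ D) + (thr ((n - i) %/ D) + 1))).
  by rewrite [leRHS]addrA lerD2r thr_conv.
apply: (vgeM p_pr (hf i)).
by apply: sg; rewrite ?subn_gt0 // dvdn_sub.
Qed.

(** As [thr M <= - M], integral coefficients lie above the threshold, strictly when M > 0. *)
Lemma integral_sharp f : f 0%N = 1 -> (forall n, pint p (f n)) -> sharp f.
Proof.
move=> f0 hf; have hf0 n : vge p 0 (f n) by apply: pint_vge.
have thr0 M : thr M + M%:Z <= 0.
  have := threshold_le p_pr a_neg 0 M;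
    rewrite add0n /threshold mulr0 fact0 logn1; lia.
split=> // [n|n n0 dn]; apply: (vgeW p_pr _ (hf0 n)).
  by move: (n %/ D)%N => M; have := thr0 M; move: (thr M) => t; lia.
have : (0 < n %/ D)%N by rewrite divn_gt0 // dvdn_leq.
by move: (n %/ D)%N => M; have := thr0 M; move: (thr M) => t; lia.
Qed.

End Classes.

Section ExpMain.
Variables (p : nat) (a : int) (d l i0 : nat) (theta : nat -> rat).
Hypothesis p_pr : prime p.
Hypothesis a_neg : a <= -1.
Hypothesis d_gt0 : (0 < d)%N.
Hypothesis pd : ~~ (p %| d)%N.
Hypothesis a_small : i0 = l \/ -2 <= a.
Local Notation D := (d * p ^ l)%N.
Hypothesis th_ge : forall k, (0 < k)%N ->
  vge p (a + 2 * l%:Z - 2 * (logn p k)%:Z) (theta k).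
Hypothesis th_supp : forall k, (0 < k)%N -> ~~ (d * p ^ i0 %| k)%N ->
  theta k = 0.
Hypothesis th_D : veq p a (theta D).

Let D_gt0 : (0 < D)%N.
Proof. by rewrite muln_gt0 d_gt0 expn_gt0 prime_gt0. Qed.

Lemma vgeX e x m : vge p e x -> vge p (m%:Z * e) (x ^+ m).
Proof.
move=> h; elim: m => [|m IH]; first by rewrite mul0r expr0;
  apply/pint_vge/(pint_nat p_pr 1).
by rewrite exprS intS mulrDl mul1r; apply: vgeM.
Qed.

Lemma veqX e x m : veq p e x -> veq p (m%:Z * e) (x ^+ m).
Proof.
move=> h; elim: m => [|m IH].
  by rewrite mul0r expr0; have := veq_p p_pr 0; rewrite expr0z.
by rewrite exprS intS mulrDl mul1r; apply: veqM.
Qed.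

Lemma veq_fact m : veq p (- (logn p m`!)%:Z) (m`!%:R : rat)^-1.
Proof. by apply/veqV/veq_nat => //; apply: fact_gt0. Qed.

Lemma exp_monomial_theta k n : (0 < k)%N -> k <> D ->
  vge p (threshold p a (n %/ D)) (exp_monomial k (theta k) n) /\
  (~ (p = 2%N /\ a = -1) -> (0 < n)%N -> (D %| n)%N ->
   vge p (threshold p a (n %/ D) + 1) (exp_monomial k (theta k) n)).
Proof.
move=> k0 kD; rewrite /exp_monomial /subst; case: ifP => [/dvdnP[m ->]|_];
  last first.
  by split=> *; apply: vge0.
rewrite mulnK // [(m * k)%N]mulnC.
have [dk|ndk] := boolP (d * p ^ i0 %| k)%N; last first.
  rewrite th_supp //; case: m => [|m]; last first.
    by rewrite expr0n mul0r; split=> *; apply: vge0.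
  rewrite muln0 div0n /threshold mulr0 fact0 logn1 expr0 divr1; split=> //.
  by apply/pint_vge/(pint_nat p_pr 1).
have [h1 h2] := exp_bound p_pr a_neg d_gt0 pd a_small m k0 dk kD.
have hv : vge p (m%:Z * (a + 2 * l%:Z - 2 * (logn p k)%:Z) - (logn p m`!)%:Z)
   (theta k ^+ m / m`!%:R).
  by apply: vgeM => //; [apply/vgeX/th_ge | apply/veq_vge/veq_fact].
split; first exact: (vgeW p_pr h1 hv).
move=> nexc; rewrite muln_gt0 k0 /= => m0 dv.
by apply: (vgeW p_pr _ hv); apply: h2.
Qed.

Lemma exp_monomial_theta_D : exact p a D (exp_monomial D (theta D)).
Proof.
have key n : (D %| n)%N ->
  veq p (threshold p a (n %/ D)) (exp_monomial D (theta D) n).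
  move=> dn; rewrite /exp_monomial /subst dn /threshold mulrC.
  by apply: veqM => //; [apply: veqX | apply: veq_fact].
split=> //; first exact: exp_monomial0.
move=> n; have [dn|nd] := boolP (D %| n)%N; first by apply/veq_vge/key.
by rewrite /exp_monomial /subst (negPf nd); apply: vge0.
Qed.

Definition exp_monomials (s : seq nat) : nat -> rat :=
  foldr (fun k f => conv (exp_monomial k (theta k)) f) (fun n => (n == 0%N)%:R)
    s.

Lemma exp_monomials0 s : exp_monomials s 0 = 1.
Proof. by elim: s => //= k s IH; rewrite conv0 exp_monomial0 IH mulr1. Qed.

Lemma logder_one k : logder (fun n => (n == 0%N)%:R) k = 0.
Proof.
apply: (@logder_unique _ (fun=> 0) k) => // n _.
rewrite /conv big1 => [|i _]; last by rewrite mul0r.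
by case: n => [|n]; rewrite ?mul0r ?mulr0.
Qed.

Lemma log_coef_exp_monomials s n : all (leq 1) s ->
  log_coef (exp_monomials s) n = \sum_(k <- s) theta k * (n == k)%:R.
Proof.
elim: s => [_|k s IH /= /andP[k0 s0]];
  first by rewrite big_nil /log_coef logder_one mul0r.
by rewrite big_cons log_coef_conv ?exp_monomial0 ?exp_monomials0 //
  log_coef_exp_monomial // IH.
Qed.

Lemma bounded_one : bounded p a D (fun n => (n == 0%N)%:R).
Proof.
by apply/sharp_bounded/integral_sharp => // n; apply: pint_nat.
Qed.

Lemma exp_monomials_bounded s : all (leq 1) s ->
  bounded p a D (exp_monomials s).
Proof.
elim: s => [_|k s IH /= /andP[k0 s0]]; first exact: bounded_one.
apply: bounded_conv (IH s0) => // n; have [->|/eqP kD] := eqVneq k D.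
  by case: exp_monomial_theta_D.
by case: (exp_monomial_theta n k0 kD).
Qed.

Lemma exp_monomials_sharp s : ~ (p = 2%N /\ a = -1) -> all (leq 1) s ->
  D \notin s ->
  sharp p a D (exp_monomials s).
Proof.
move=> nexc; elim: s => [_ _|k s IH /= /andP[k0 s0]].
  by apply: integral_sharp => // n; apply: pint_nat.
rewrite in_cons negb_or => /andP[kD Ds]; apply: sharp_conv (IH s0 Ds) => //.
have h n := exp_monomial_theta n k0 (fun e => elimN eqP kD (esym e)).
by split=> [|n|n n0 dn]; [exact: exp_monomial0 | case: (h n) | case: (h n) => _;
  apply].
Qed.

Theorem exp_main (G J : nat -> rat) n :
    G 0%N = 1 -> J 0%N = 1 -> (forall k, (k <= n)%N -> pint p (J k)) ->
    (forall k, (0 < k <= n)%N -> log_coef G k = log_coef J k + theta k) ->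
  vge p (threshold p a (n %/ D)) (G n) /\
  ((D %| n)%N -> ~ (p = 2%N /\ a = -1) -> veq p (threshold p a (n %/ D)) (G n)).
Proof.
move=> G0 J0 Jn lgG.
(* Integrality is assumed only up to degree n; the cut-off series is integral in all degrees. *)
pose J' k := if (k <= n)%N then J k else 0.
have J'0 : J' 0%N = 1 by rewrite /J'.
have J'int k : pint p (J' k).
  by rewrite /J'; case: ifP => [/Jn //|_]; apply: (pint_nat p_pr 0).
have J's : sharp p a D J' by apply: integral_sharp.
(* D is put back separately below, even if D > n, when it affects only degrees beyond n. *)
pose s := [seq k <- iota 1 n | k != D].
have s0 : all (leq 1) s.
  by apply/allP=> k; rewrite mem_filter mem_iota => /and3P[].
have Ds : D \notin s by rewrite mem_filter eqxx.
have us : uniq (D :: s) by rewrite /= Ds filter_uniq ?iota_uniq.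
have Ds0 : all (leq 1) (D :: s) by rewrite /= s0 D_gt0.
have GE k : (k <= n)%N -> G k = conv J' (exp_monomials (D :: s)) k.
  apply: log_coef_inj => // [|j /andP[j0 jn]];
    first by rewrite conv0 J'0 exp_monomials0 mulr1.
  rewrite log_coef_conv ?exp_monomials0 // lgG ?j0 ?jn //; congr (_ + _).
    rewrite /log_coef (@eq_logder J' J n) // => i le; rewrite /J' le //.
  rewrite log_coef_exp_monomials // (bigD1_seq j) //=; last first.
    by rewrite in_cons mem_filter mem_iota j0 add1n ltnS jn; case: eqVneq.
  rewrite eqxx mulr1 big1 ?addr0 // => i; rewrite eq_sym => /negPf->.
  by rewrite mulr0.
rewrite GE //; split.
  by apply: bounded_conv (exp_monomials_bounded Ds0) _ => //; case: J's.
move=> dn nexc; have E : exact p a D (conv (exp_monomials (D :: s)) J').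
  apply: exact_conv J's => //; apply: exact_conv exp_monomial_theta_D _ => //.
  exact: exp_monomials_sharp.
by rewrite convC; case: E => _ _; apply.
Qed.

End ExpMain.

(** * The logarithm of the series of the inverse orders of GL_n *)

Lemma finField_exp (F : finFieldType) m : (0 < m)%N ->
  exists F' : finFieldType, #|F'| = (#|F| ^ m)%N.
Proof.
move=> m0; have [l l_pr lF] := finPcharP F.
have [w e] := finField_card_pnat lF.
have w0 : (0 < w)%N.
  by case: w e => // e; have := finNzRing_gt1 F; rewrite e expn0.
have wm0 : (0 < w * m)%N by rewrite muln_gt0 w0.
have [F' _ cF'] := PrimePowerField l_pr wm0.
by exists F'; rewrite cF' e expnM.
Qed.

Lemma card_GL_group (F : finFieldType) n : #|[set: GL n F]| = gl_order #|F| n.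
Proof.
rewrite -card_GLset -[LHS](card_imset _ val_inj); apply: eq_card => A.
rewrite inE; apply/imsetP/idP => [[g _ ->]|uA]; first exact: (valP g).
by exists (Sub A uA : GL n F).
Qed.

Lemma abelian_prod (A B : finGroupType) : abelian [set: A] ->
  abelian [set: B] ->
  abelian [set: (A * B)%type].
Proof.
move=> cA cB; apply/centsP=> -[a b] _ [a' b'] _; rewrite /commute.
have h1 : (a * a' = a' * a)%g by apply: (centsP cA); rewrite inE.
have h2 : (b * b' = b' * b)%g by apply: (centsP cB); rewrite inE.
by congr (_, _).
Qed.

Lemma expg_pair (A B : finGroupType) (a : A) (b : B) n :
  ((a, b) ^+ n = (a ^+ n, b ^+ n))%g.
Proof. by elim: n => [|n IH] //; rewrite !expgS IH. Qed.

Lemma num_pow1_prod p (A B : finGroupType) j :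
  num_pow1 p (A * B)%type j = (num_pow1 p A j * num_pow1 p B j)%N.
Proof.
rewrite /num_pow1 -cardsX; apply: eq_card => -[a b]; rewrite !inE expg_pair.
by rewrite /eq_op.
Qed.

Section Cyclic.
Variables (p t : nat).
Hypothesis p_pr : prime p.
Hypothesis t_gt0 : (0 < t)%N.

Lemma Zp_gt1 : (1 < p ^ t)%N.
Proof. by rewrite -(expn0 p) ltn_exp2l ?prime_gt1. Qed.

Lemma abelian_Zp : abelian [set: 'Z_(p ^ t)].
Proof. exact: FinRing.zmod_abelian. Qed.

Lemma card_Zp_pow : #|[set: 'Z_(p ^ t)]| = (p ^ t)%N.
Proof. by rewrite cardsT card_ord Zp_cast ?Zp_gt1. Qed.

Lemma expg_Zp (x : 'Z_(p ^ t)) : (x ^+ (p ^ t) = 1)%g.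
Proof. by have := expg_cardG (in_setT x); rewrite card_Zp_pow. Qed.

Lemma num_pow1_Zp j : num_pow1 p 'Z_(p ^ t) j = (p ^ minn j t)%N.
Proof.
have [le|lt] := leqP j t; last first.
  rewrite /num_pow1 -[RHS]card_Zp_pow; apply: eq_card => x; rewrite !inE.
  by rewrite -(subnKC (ltnW lt)) expnD expgM expg_Zp expg1n eqxx.
have e := index_power_group abelian_Zp (p ^ j).
rewrite /num_pow1 -e -divgS ?subsetT // card_Zp_pow.
have gen : [set: 'Z_(p ^ t)] = <[Zp1 : 'Z_(p ^ t)]>%g by rewrite -Zp_cycle.
have -> : #|power_group abelian_Zp (p ^ j)| = (p ^ (t - j))%N.
  have := morphim_cycle (power_morphism abelian_Zp (p ^ j)) (in_setT Zp1).
  rewrite -gen /power_group /= => ->; rewrite -orderE orderXdiv.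
    by rewrite orderE -gen card_Zp_pow expnB ?prime_gt0.
  by rewrite orderE -gen card_Zp_pow dvdn_exp2l.
by rewrite -expnB ?leq_subr ?prime_gt0 // subKn.
Qed.
End Cyclic.

Lemma hom_series_pint p (F : finFieldType) (A0 : finGroupType) n : prime p ->
  exists t0, forall t, (t0 <= t)%N -> (0 < t)%N ->
    forall m, (m <= n)%N -> pint p (hom_series ('Z_(p ^ t) * A0)%type F m).
Proof.
(* The sum serves as a common upper bound for the valuations of |GL_m(F)|, m <= n. *)
move=> p_pr; exists (\sum_(m < n.+1) logn p (gl_order #|F| m))%N =>
  t le t0 m mn.
have g0 : (0 < gl_order #|F| m)%N by rewrite gl_order_gt0 ?finNzRing_gt1.
have le' : (logn p (gl_order #|F| m) <= t)%N.
  apply: leq_trans le; have mn' : (m < n.+1)%N by [].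
  by rewrite (bigD1 (Ordinal mn')) //= leq_addr.
have := @part_dvd_homs (p ^ t) A0 (GL m F) (Zp_gt1 p_pr t0) p t p_pr erefl.
rewrite card_GL_group p_part dvdn_exp2l // => /(_ isT)/dvdnP[c ec].
have [u cop eu] := pfactor_coprime p_pr g0.
rewrite /hom_series ec {2}eu; exists c%:Z, u%:Z; split.
  by rewrite dvdzE -prime_coprime.
rewrite !natrM invfM -mulrA [X in _ * X]mulrCA divff ?mulr1 //.
by rewrite pnatr_eq0 expn_eq0 negb_and -lt0n prime_gt0.
Qed.

Lemma logder_pint p f n : prime p -> f 0%N = 1 ->
  (forall k, (k <= n)%N -> pint p (f k)) ->
  forall k, (k <= n)%N -> pint p (logder f k).
Proof.
move=> p_pr f0 hf k; elim/ltn_ind: k => k IH kn.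
have := logderE k f0; rewrite /conv big_ord_recr /= subnn f0 mulr1 => e.
have -> : logder f k = k%:R * f k - \sum_(i < k) logder f i *
  f (k - i)%N by rewrite e addrC addrK.
apply/vge_pint/vgeB => //; first by apply/pint_vge/pintM => //;
  [apply: pint_nat | apply: hf].
apply: (vge_sum p_pr) => i _; apply/pint_vge/pintM => //.
  by apply: IH (ltn_ord i) _; apply: leq_trans (ltnW (ltn_ord i)) kn.
by apply/hf/(leq_trans (leq_subr _ _)).
Qed.

Lemma log_coef_pint p f n k : prime p -> f 0%N = 1 ->
  (forall k, (k <= n)%N -> pint p (f k)) ->
  (0 < k <= n)%N -> vge p (- (logn p k)%:Z) (log_coef f k).
Proof.
move=> p_pr f0 hf /andP[k0 kn]; rewrite -[X in vge _ X]add0r.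
apply: (vgeM p_pr); first by apply/pint_vge/(logder_pint p_pr f0 hf).
by apply/veq_vge/veqV/veq_nat.
Qed.

(** The exponent d p^i absorbs d and up to i factors p of the order, so base change only alters the
    parameters. *)
Lemma ord_mod_specX p q d lam i : prime p -> ord_mod_spec p q d lam ->
  ord_mod_spec p (q ^ (d * p ^ i)) 1 (lam + i).
Proof.
move=> p_pr [d0 h]; split=> // j e e0; have p0 := prime_gt0 p_pr.
rewrite -expnM h ?muln_gt0 ?d0 ?expn_gt0 ?p0 //.
case: j => [|j]; first by rewrite !dvd1n.
rewrite /ord_mod mul1n -mulnA dvdn_pmul2l // subnDA; set m := (j.+1 - lam)%N.
have [le|lt] := leqP m i.
  rewrite (_ : m - i = 0)%N ?expn0 ?dvd1n; last by apply/eqP; rewrite subn_eq0.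
  by rewrite dvdn_mulr // dvdn_exp2l.
by rewrite -{1}(subnKC (ltnW lt)) expnD dvdn_pmul2l // expn_gt0 p0.
Qed.

Lemma sum_telescope (c : nat -> nat) m :
  \sum_(j < m.+1) ((c j)%:R - (if j : nat is j'.+1 then c j' else 0%N)%:R) =
    (c m)%:R :> rat.
Proof.
elim: m => [|m IH]; first by rewrite big_ord1 subr0.
by rewrite big_ord_recr /= IH addrC subrK.
Qed.

(** The trivial factor ['I_1] puts the cyclic group in the product form required by
    [hom_series_pint]. *)
Definition cyc_series (p t : nat) (F : finFieldType) :=
  hom_series ('Z_(p ^ t) * 'I_1)%type F.

Lemma orbit_logE q e k : orbit_log q e k =
  (if (e %| k)%N then log_coef (gl_series (q ^ e)) (k %/ e) else 0) / e%:R.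
Proof.
case: e => [|e]; first by rewrite /orbit_log invr0 !mulr0.
by rewrite /orbit_log log_coef_subst ?gl_series0.
Qed.

Lemma orbit_log1 q k : orbit_log q 1 k = log_coef (gl_series q) k.
Proof. by rewrite orbit_logE dvd1n divn1 divr1 expn1. Qed.

(** Base change to F_(q^e) divides orbit sizes and degrees by e; the factor e compensates for the
    normalization by orbit size. *)
Lemma orbit_log_comp q e f k : (0 < e)%N -> (e %| k)%N ->
  orbit_log (q ^ e) f (k %/ e) = e%:R * orbit_log q (e * f) k.
Proof.
move=> e0 dv; rewrite !orbit_logE -expnM -divnMA dvdn_divRL // [(f * e)%N]mulnC.
have nz : (e%:R : rat) != 0 by rewrite pnatr_eq0 -lt0n.
by rewrite natrM invfM mulrCA mulVKf.
Qed.

Section LowerBound.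
Variable p : nat.
Hypothesis p_pr : prime p.
Let p_gt0 := prime_gt0 p_pr.
Let pnz : (p%:R : rat) != 0. Proof. by rewrite pnatr_eq0 -lt0n. Qed.

Lemma log_coef_cyc_series (F : finFieldType) mu t k : ~~ (p %| #|F|)%N ->
  ord_mod_spec p #|F| 1 mu ->
    (0 < t)%N ->
  log_coef (cyc_series p t F) k = \sum_(j < t.+1)
    ((p ^ j)%:R - (if j : nat is j'.+1 then p ^ j' else 0)%N%:R) *
      orbit_log #|F| (p ^ (j - mu)) k.
Proof.
move=> pF hF t0.
have cA : abelian [set: ('Z_(p ^ t) * 'I_1)%type].
  by apply: abelian_prod; apply: FinRing.zmod_abelian.
have xA (a : ('Z_(p ^ t) * 'I_1)%type) : (a ^+ (p ^ t) = 1)%g.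
  by case: a => a b; rewrite expg_pair expg_Zp //; congr (_, _); apply: ord1.
rewrite /cyc_series (log_coef_hom_series p_pr pF cA xA hF);
  apply: eq_bigr => -[j lj] _ /=.
have cj i : (i <= t)%N -> num_pow1 p ('Z_(p ^ t) * 'I_1)%type i = (p ^ i)%N.
  move=> le; rewrite num_pow1_prod num_pow1_Zp // (minn_idPl le)
    (_ : num_pow1 _ 'I_1 _ = 1%N) ?muln1 //.
  rewrite /num_pow1 -[RHS](card_ord 1) -cardsT; apply: eq_card => x;
    rewrite !inE.
  by apply/eqP; rewrite [LHS]ord1 [RHS]ord1.
congr ((_ - _) * orbit_log _ _ _).
- by rewrite cj.
- by case: j lj => // j lj; rewrite cj // ltnW.
by case: j {lj} => //= j; rewrite mul1n.
Qed.

(** Subtract 1/p times the formula for the cyclic series over F' in degree k/p from the one over F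
    in degree k. What survives is p^mu times log F_Q in degree k minus 1/p times log F_(Q^p) in
    degree k/p. *)
Lemma log_coef_gl_series_rec (F F' : finFieldType) mu t k : ~~ (p %| #|F|)%N ->
  ord_mod_spec p #|F| 1 mu ->
    #|F'| = (#|F| ^ p)%N -> (mu <= t)%N -> (0 < t)%N -> (p %| k)%N ->
  log_coef (gl_series #|F|) k = p%:R^-1 *
    log_coef (gl_series (#|F| ^ p)) (k %/ p)
    + (p ^ mu)%:R^-1 * (log_coef (cyc_series p t F) k - p%:R^-1 *
      log_coef (cyc_series p t F') (k %/ p)).
Proof.
move=> pF hF eF' mut t0 pk.
have pF' : ~~ (p %| #|F'|)%N.
  by rewrite eF' Euclid_dvdX // negb_and pF.
have hF' : ord_mod_spec p #|F'| 1 mu.+1.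
  by have := ord_mod_specX 1 p_pr hF; rewrite mul1n expn1 eF' addn1.
rewrite (log_coef_cyc_series _ pF hF t0) (log_coef_cyc_series _ pF' hF' t0)
  mulr_sumr -sumrB.
pose w j : rat := (p ^ j)%:R - (if j is j'.+1 then p ^ j' else 0)%N%:R.
pose b i := orbit_log #|F| (p ^ i) k.
rewrite (eq_bigr (fun j : 'I_t.+1 =>
  w j * (b (j - mu)%N - b ((j - mu.+1).+1)))); last first.
  move=> j _; rewrite /w mulrBr; congr (_ - _); rewrite eF' orbit_log_comp //.
  by rewrite /b expnS mulrCA mulKf.
rewrite -(big_mkord xpredT
  (fun j => w j * (b (j - mu)%N - b ((j - mu.+1).+1)))).
(* For j > mu the two orbit sizes coincide. For j <= mu the truncated subtractions leave b 0 - b 1,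
   and the weights of these j add up to p^mu. *)
rewrite (@big_cat_nat _ _ _ mu.+1) //= [X in _ * (_ + X)]big1_seq; last first.
  move=> j; rewrite mem_index_iota => /andP[_ /andP[lt _]].
  by rewrite subnSK // subrr mulr0.
rewrite addr0 big_mkord (eq_bigr (fun j : 'I_mu.+1 => w j * (b 0%N - b 1%N)));
  last first.
  move=> j _; have := ltn_ord j; rewrite ltnS => le.
  have -> : (j - mu = 0)%N by apply/eqP; rewrite subn_eq0.
  by have -> : (j - mu.+1 = 0)%N by apply/eqP; rewrite subn_eq0 ltnW.
rewrite -mulr_suml /w (sum_telescope (fun j => p ^ j)%N) mulKf; last first.
  by rewrite pnatr_eq0 expn_eq0 negb_and -lt0n p_gt0.
rewrite /b expn0 expn1 orbit_log1 [in X in _ = _ + (_ - X)]orbit_logE pk.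
by rewrite [_^-1 * _]mulrC addrC subrK.
Qed.

Lemma logn_q_sub1 q mu : ord_mod_spec p q 1 mu -> (1 < q)%N ->
  logn p (q - 1) = mu.
Proof.
move=> [_ h] q1; have q0 : (0 < q - 1)%N by rewrite subn_gt0.
have key j : (j <= logn p (q - 1))%N = (j <= mu)%N.
  rewrite -pfactor_dvdn // -{1}(expn1 q) h //; case: j => [|j];
    first by rewrite dvd1n.
  have e1 x : (p ^ x == 1)%N =
    (x == 0)%N by rewrite -(expn0 p) eqn_exp2l ?prime_gt1.
  by rewrite /ord_mod mul1n dvdn1 e1 subn_eq0.
by apply/eqP; rewrite eqn_leq key leqnn -key leqnn.
Qed.

Lemma veq_expnV mu : veq p (- mu%:Z) ((p ^ mu)%:R^-1 : rat).
Proof.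
apply: veqV => //; rewrite -{1}(pfactorK mu p_pr).
by apply: veq_nat => //; rewrite expn_gt0 p_gt0.
Qed.

(** Induction on v_p(k), with F varying: the step passes to the extension F' of degree p and to k /
    p. *)
Lemma log_coef_gl_series_bound v : forall (F : finFieldType) mu k,
  ~~ (p %| #|F|)%N ->
    ord_mod_spec p #|F| 1 mu -> (0 < k)%N -> logn p k = v ->
  vge p (- mu%:Z - 2 * v%:Z) (log_coef (gl_series #|F|) k) /\
  (k = p ^ v -> veq p (- mu%:Z - 2 * v%:Z) (log_coef (gl_series #|F|) k))%N.
Proof.
elim: v => [|v IH] F mu k pF hF k0 vk.
  have pk : ~~ (p %| k)%N.
    by rewrite -[p in (p %| _)%N]expn1 pfactor_dvdn // vk.
  rewrite mulr0 subr0; split.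
    have [t0 ht] := hom_series_pint F 'I_1 k p_pr.
    pose t := (t0 + mu + 1)%N; have t_gt0 : (0 < t)%N by rewrite /t addn1.
    have h : vge p 0 (log_coef (cyc_series p t F) k).
      have := @log_coef_pint p (cyc_series p t F) k k p_pr (hom_series0 _ _);
        rewrite vk oppr0.
      by apply; [move=> i; apply: ht => //;
        rewrite /t -addnA leq_addr | rewrite k0 leqnn].
    (* In degrees prime to p only orbits of size 1, those with j <= mu, contribute. *)
    have e : log_coef (cyc_series p t F) k = (p ^ mu)%:R *
      log_coef (gl_series #|F|) k.
      rewrite (log_coef_cyc_series _ pF hF t_gt0)
        -(sum_telescope (fun j => p ^ j)%N mu) mulr_suml.
      pose w j : rat := (p ^ j)%:R - (if j is j'.+1 then p ^ j' else 0)%N%:R.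
      rewrite -(big_mkord xpredT
        (fun j => w j * orbit_log #|F| (p ^ (j - mu)) k)).
      rewrite (@big_cat_nat _ _ _ mu.+1) //=; last by rewrite /t; lia.
      rewrite [X in _ + X]big1_seq ?addr0; last first.
        move=> j; rewrite mem_index_iota => /andP[_ /andP[lt _]].
        rewrite orbit_logE ifN ?mul0r ?mulr0 //; apply: contra pk;
          apply: dvdn_trans.
        by rewrite -(subnSK lt) expnS dvdn_mulr.
      rewrite big_mkord; apply: eq_bigr => j _; have := ltn_ord j;
        rewrite ltnS => le.
      have -> : (j - mu = 0)%N by apply/eqP; rewrite subn_eq0.
      by rewrite expn0 orbit_log1.
    have -> : log_coef (gl_series #|F|) k = (p ^ mu)%:R^-1 *
      log_coef (cyc_series p t F) k.
      by rewrite e mulKf // pnatr_eq0 expn_eq0 negb_and -lt0n p_gt0.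
    by rewrite -[X in vge _ X]addr0; apply: vgeM h => //;
      apply/veq_vge/veq_expnV.
  move=> ->; rewrite expn0 /log_coef divr1.
  have -> : logder (gl_series #|F|) 1 = (#|F| - 1)%N%:R^-1.
    have := logderE 1 (gl_series0 #|F|);
      rewrite /conv !big_ord_recl big_ord0 /= logder_0 mul0r add0r addr0.
    rewrite /bump /= subnn gl_series0 mul1r mulr1 => <-.
    by rewrite /gl_series gl_orderS gl_order0 mul1n expn1 muln1.
  have q1 := finNzRing_gt1 F.
  rewrite -{1}(logn_q_sub1 hF q1); apply/veqV/veq_nat => //.
  by rewrite subn_gt0.
have [F' eF'] := finField_exp F p_gt0.
have pF' : ~~ (p %| #|F'|)%N by rewrite eF' Euclid_dvdX // negb_and pF.
have hF' : ord_mod_spec p #|F'| 1 mu.+1.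
  by have := ord_mod_specX 1 p_pr hF; rewrite mul1n expn1 eF' addn1.
have pk : (p %| k)%N by rewrite -[p in (p %| _)%N]expn1 pfactor_dvdn // vk.
have kp0 : (0 < k %/ p)%N by rewrite divn_gt0 // dvdn_leq.
have vkp : logn p (k %/ p) =
  v by rewrite logn_div // vk logn_prime // eqxx subn1.
have [IH1 IH2] := IH F' mu.+1 (k %/ p)%N pF' hF' kp0 vkp.
have [t1 ht1] := hom_series_pint F 'I_1 k p_pr;
  have [t2 ht2] := hom_series_pint F' 'I_1 k p_pr.
pose t := (t1 + t2 + mu + 1)%N; have t_gt0 : (0 < t)%N by rewrite /t addn1.
have mut : (mu <= t)%N by rewrite /t; lia.
have t1t : (t1 <= t)%N by rewrite /t; lia.
have t2t : (t2 <= t)%N by rewrite /t; lia.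
have E1 : vge p (- v.+1%:Z) (log_coef (cyc_series p t F) k).
  rewrite -vk; apply: (@log_coef_pint p _ k) => //; first exact: hom_series0.
    exact: ht1.
  by rewrite k0 leqnn.
have E2 : vge p (- v%:Z) (log_coef (cyc_series p t F') (k %/ p)).
  rewrite -vkp; apply: (@log_coef_pint p _ k) => //; first exact: hom_series0.
    exact: ht2.
  by rewrite kp0 leq_div.
have vp : veq p (- 1) (p%:R^-1 : rat).
  by apply: veqV => //; have := veq_p p_pr 1; rewrite expr1z.
have vpm := veq_expnV mu.
rewrite (log_coef_gl_series_rec pF hF eF' mut t_gt0 pk) -eF'.
(* Integrality of the cyclic series costs only v_p(k) = v + 1 instead of twice that, so the
   remainder lies strictly above the main term and equality propagates. *)
have rem : vge p (- mu%:Z - v.+1%:Z)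
   ((p ^ mu)%:R^-1 * (log_coef (cyc_series p t F) k - p%:R^-1 *
     log_coef (cyc_series p t F') (k %/ p))).
  apply: (vgeM p_pr); first exact: veq_vge.
  apply: vgeB => //; have := vgeM p_pr (veq_vge vp) E2.
  by rewrite (_ : -1 - v%:Z = - v.+1%:Z) //; lia.
have eqe : - mu%:Z - 2 * v.+1%:Z = -1 + (- mu.+1%:Z - 2 * v%:Z) by lia.
split.
  apply: vgeD => //.
    by rewrite eqe; apply: (vgeM p_pr) IH1; apply: veq_vge.
  by apply: (vgeW p_pr _ rem); lia.
move=> ek; apply: (veqD p_pr).
  rewrite eqe; apply: (veqM p_pr) vp _; apply: IH2.
  by rewrite ek expnS mulKn.
by apply: (vgeW p_pr _ rem); lia.
Qed.

End LowerBound.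

(** * The logarithm of the series of an abelian p-group *)

Lemma leq_card_homs_isog (G G' H : finGroupType) :
  [set: G] \isog [set: G'] -> (#|homs G' H| <= #|homs G H|)%N.
Proof.
case/isogP=> f injf imf.
pose c (h : {ffun G' -> H}) : {ffun G -> H} := [ffun x => h (f x)].
have injc : injective c.
  move=> h h' /ffunP e; apply/ffunP=> y.
  have : y \in f @* [set: G] by rewrite imf inE.
  by case/morphimP=> x _ _ ->; have := e x; rewrite !ffunE.
rewrite -(card_imset _ injc); apply/subset_leq_card/subsetP=> g.
case/imsetP=> h /homsP hM ->; apply/homsP=> a b.
by rewrite !ffunE morphM ?inE // hM.
Qed.

Lemma card_homs_isog (G G' H : finGroupType) :
  [set: G] \isog [set: G'] -> #|homs G H| = #|homs G' H|.
Proof.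
move=> iso; apply/eqP; rewrite eqn_leq !leq_card_homs_isog //.
by rewrite isog_sym.
Qed.

Lemma card_homs_gt0 (G H : finGroupType) : (0 < #|homs G H|)%N.
Proof.
by apply/card_gt0P; exists [ffun=> 1%g]; apply/homsP=> a b;
  rewrite !ffunE mulg1.
Qed.

Lemma abelian_pgroup_abelian p r k : abelian [set: abelian_pgroup p r k].
Proof.
apply/centsP=> f _ g _; apply/ffunP=> x; rewrite !ffunE.
exact: addrC.
Qed.

Lemma abelian_pgroup_exp p r k (f : abelian_pgroup p r k) : prime p ->
  (f ^+ (p ^ r) = 1)%g.
Proof.
move=> p_pr.
have fX m x : (f ^+ m)%g x = (f x ^+ m)%g.
  by elim: m => [|m IH]; rewrite ?ffunE // !expgS ffunE IH.
apply/ffunP=> x; rewrite fX ffunE.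
have le : ((tag x).+1 <= r)%N by [].
have -> : (p ^ r = p ^ (tag x).+1 * p ^ (r - (tag x).+1))%N.
  by rewrite -expnD subnKC.
by rewrite expgM expg_Zp // expg1n.
Qed.

(** * Valuation of the order of GL_n *)

Section LognGL.
Variables (p q d lam : nat).
Hypothesis p_pr : prime p.
Hypothesis q_gt1 : (1 < q)%N.
Hypothesis pq : ~~ (p %| q)%N.
Hypothesis q_lte : ord_mod_spec p q d lam.

Lemma logn_expq_sub1 e : (0 < e)%N ->
  logn p (q ^ e - 1) = if (d %| e)%N then (lam + logn p (e %/ d))%N else 0%N.
Proof.
case: q_lte => d0 h e0.
have q0 : (0 < q ^ e - 1)%N by rewrite subn_gt0 -(exp1n e) ltn_exp2r.
have key j : (j <= logn p (q ^ e - 1))%N = (ord_mod p d lam j %| e)%N.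
  by rewrite -pfactor_dvdn // h.
case: ifP => [/dvdnP[m em]|nd].
  have m0 : (0 < m)%N by case: m em e0 => // ->.
  have key' j : (j <= logn p (q ^ e - 1))%N = (j <= lam + logn p m)%N.
    rewrite key; case: j => [|j]; first by rewrite dvd1n.
    by rewrite /ord_mod em mulnC dvdn_pmul2r // pfactor_dvdn // leq_subLR.
  by rewrite em mulnK // -em; apply/eqP; rewrite eqn_leq key' leqnn -key' leqnn.
have := key 1%N; rewrite /ord_mod (_ : (_ %| e)%N = false).
  by case: (logn p _).
by apply: contraFF nd; apply: dvdn_trans; apply: dvdn_mulr.
Qed.

Lemma logn_gl n : logn p (gl_order q n) =
  (lam * (n %/ d) + logn p (n %/ d)`!)%N.
Proof.
have d0 : (0 < d)%N by case: q_lte.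
elim: n => [|n IH]; first by rewrite gl_order0 div0n muln0 fact0 logn1.
have q0 : (0 < q ^ n.+1 - 1)%N by rewrite subn_gt0 -(exp1n n.+1) ltn_exp2r.
have qn0 : (0 < q ^ n)%N by rewrite expn_gt0 ltnW.
have lq : logn p (q ^ n) = 0%N.
  by rewrite logn_coprime // coprimeXr // prime_coprime.
rewrite gl_orderS lognM ?gl_order_gt0 ?muln_gt0 ?q0 // lognM // IH lq addn0
  logn_expq_sub1 //.
rewrite divnS //; case: (d %| n.+1)%N; last by rewrite add0n addn0.
rewrite add1n factS (lognM p (ltn0Sn _) (fact_gt0 _)) mulnS.
by move: (logn p (n %/ d)`!) (logn p (n %/ d).+1) => x y; lia.
Qed.

(** Legendre's recursion unrolled l times; the remaining factorial will cancel the one in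
    [threshold]. *)
Lemma logn_gl_trunc n l : logn p (gl_order q n) = (lam * (n %/ d)
  + \sum_(1 <= i < l.+1) n %/ (d * p ^ i) + logn p (n %/ (d * p ^ l))`!)%N.
Proof.
rewrite logn_gl -addnA; congr (_ + _)%N.
elim: l => [|l IH]; first by rewrite big_geq // expn0 muln1.
rewrite IH [in RHS]big_nat_recr //= -addnA; congr (_ + _)%N.
by rewrite (logn_fact_step p_pr) expnSr mulnA -divnMA.
Qed.
End LognGL.

Section AlBound.
Variables (p : nat) (F : finFieldType) (d lam : nat).
Hypothesis p_pr : prime p.
Hypothesis pF : ~~ (p %| #|F|)%N.
Hypothesis pd : ~~ (p %| d)%N.
Hypothesis q_lte : ord_mod_spec p #|F| d lam.

(** Over Q = q^e with e = d p^i, the losses are lam + i from Q - 1, 2 (v_p(k) - i) from the degree k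
    / e and i from 1 / e. Their sum is independent of i. *)
Lemma orbit_log_bound i k : (0 < k)%N ->
  vge p (- lam%:Z - 2 * (logn p k)%:Z) (orbit_log #|F| (d * p ^ i) k) /\
  (forall v, k = d * p ^ v -> i <= v ->
     veq p (- lam%:Z - 2 * v%:Z) (orbit_log #|F| (d * p ^ i) k))%N.
Proof.
move=> k0; have d0 : (0 < d)%N by case: q_lte.
have p0 := prime_gt0 p_pr; set e := (d * p ^ i)%N.
have e0 : (0 < e)%N by rewrite muln_gt0 d0 expn_gt0 p0.
have [dv|ndv] := boolP (e %| k)%N; last first.
  rewrite orbit_logE (negPf ndv) mul0r; split; first exact: vge0.
  move=> v ek le; case/negP: ndv; rewrite ek /e dvdn_pmul2l //.
  exact: dvdn_exp2l.
have [F' eF'] := finField_exp F e0.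
have pF' : ~~ (p %| #|F'|)%N by rewrite eF' Euclid_dvdX // negb_and pF.
have hF' : ord_mod_spec p #|F'| 1 (lam + i) by rewrite eF';
  apply: ord_mod_specX.
have ke0 : (0 < k %/ e)%N by rewrite divn_gt0 // dvdn_leq.
have ve : logn p e = i.
  by rewrite /e lognM ?expn_gt0 ?p0 // pfactorK // logn_coprime ?prime_coprime.
have lei : (i <= logn p k)%N by rewrite -ve dvdn_leq_log.
have vk : logn p (k %/ e) = (logn p k - i)%N by rewrite logn_div // ve.
have [b1 b2] := log_coef_gl_series_bound p_pr pF' hF' ke0 vk.
have vie : veq p (- i%:Z) (e%:R^-1 : rat) by rewrite -{1}ve; apply/veqV/veq_nat.
rewrite orbit_logE dv -eF'; split.
  apply: (vgeW p_pr _ (vgeM p_pr b1 (veq_vge vie))); clear - lei; lia.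
move=> v ek le.
have vkv : logn p k = v.
  by rewrite ek lognM ?expn_gt0 ?p0 // pfactorK // logn_coprime ?prime_coprime.
rewrite (_ : - lam%:Z - 2 * v%:Z =
   (- (lam + i)%N%:Z - 2 * (logn p k - i)%N%:Z) + - i%:Z);
     last by clear - vkv le; lia.
apply: veqM => //; apply: b2; rewrite vkv ek /e divnMl // -expnB //.
Qed.
End AlBound.

(** These are the facts [exp_main] needs, with i0 = r + 1 - lam0. Only in the two middle cases can l
    exceed i0, and there a_l is -1 or -2. *)
Lemma l_al_props r s lam0 l al : (l, al) = l_al r s lam0 ->
  [/\ al <= -1, al = r%:Z + s%:Z - lam0%:Z - 2 * l%:Z,
      (r.+1 - lam0 <= l)%N & (r.+1 - lam0 = l)%N \/ -2 <= al].
Proof.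
rewrite /l_al; case: ltnP => [h1 [-> ->]|h1].
  by split; [lia | lia | lia | left; lia].
case: leqP => h2.
  have := odd_double_half (r + s - lam0)%N; case: odd => e [-> ->].
    by split; [lia | lia | lia | right].
  by split; [lia | lia | lia | right].
by case=> -> ->; split; [lia | lia | lia | left; lia].
Qed.

(** * The correction term theta *)

Section Theta.
Variables (p : nat) (F : finFieldType) (d lam r s t l : nat).
Hypothesis p_pr : prime p.
Hypothesis pF : ~~ (p %| #|F|)%N.
Hypothesis pd : ~~ (p %| d)%N.
Hypothesis q_lte : ord_mod_spec p #|F| d lam.
Hypothesis rt : (r < t)%N.
Hypothesis le_l : (r.+1 - lam <= l)%N.

(** The weight is the number of characters of C_(p^t) x G_0 whose first component has order p^j. For
    j > r they have order p^j themselves, because p^r kills G_0. *)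
Definition theta (k : nat) : rat :=
  - \sum_(r.+1 <= j < t.+1) ((p ^ j)%:R - (p ^ j.-1)%:R) * (p ^ s)%:R
      * orbit_log #|F| (d * p ^ (j - lam)) k.

Lemma veq_weight j : (0 < j)%N ->
  veq p ((j.-1 + s)%N%:Z) (((p ^ j)%:R - (p ^ j.-1)%:R) * (p ^ s)%:R : rat).
Proof.
case: j => // j _ /=; rewrite expnS natrM -[X in _ - X]mul1r -mulrBl -mulrA
  -natrM -expnD.
rewrite -[X in veq _ X]add0r; apply: veqM => //; last first.
  rewrite -{1}(pfactorK (j + s) p_pr); apply: veq_nat => //.
  by rewrite expn_gt0 prime_gt0.
have -> : (p%:R - 1 : rat) = (p - 1)%N%:R by rewrite natrB ?prime_gt0.
apply: veq_ndvd => //; apply/negP=> /dvdn_leq; have := prime_gt1 p_pr; clear;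
  lia.
Qed.

Lemma theta_term j k : (r < j)%N -> (0 < k)%N ->
  vge p (j.-1%:Z + s%:Z - lam%:Z - 2 * (logn p k)%:Z)
    (((p ^ j)%:R - (p ^ j.-1)%:R) * (p ^ s)%:R *
      orbit_log #|F| (d * p ^ (j - lam)) k).
Proof.
move=> rj k0; have [b _] := orbit_log_bound p_pr pF pd q_lte (j - lam) k0.
have j0 := leq_ltn_trans (leq0n r) rj.
rewrite (_ : _ - _ - _ = (j.-1 + s)%N%:Z + (- lam%:Z - 2 * (logn p k)%:Z));
  last first.
  by rewrite PoszD !addrA.
by apply: (vgeM p_pr) b; apply/veq_vge/veq_weight.
Qed.

Lemma theta_ge k : (0 < k)%N ->
  vge p (r%:Z + s%:Z - lam%:Z - 2 * (logn p k)%:Z) (theta k).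
Proof.
move=> k0; apply/vgeN => //; rewrite big_seq_cond; apply: (vge_sum p_pr) => j.
rewrite andbT mem_index_iota => /andP[rj _].
apply: (vgeW p_pr _ (theta_term rj k0)); clear - rj; lia.
Qed.

Lemma theta_supp k : (0 < k)%N -> ~~ (d * p ^ (r.+1 - lam) %| k)%N ->
  theta k = 0.
Proof.
move=> k0 nd; rewrite /theta big1_seq ?oppr0 // => j.
rewrite andTb mem_index_iota => /andP[rj _];
  rewrite orbit_logE ifN ?mul0r ?mulr0 //.
apply: contra nd; apply: dvdn_trans; apply: dvdn_mul => //.
by apply: dvdn_exp2l; apply: leq_sub2r.
Qed.

(** The term j = r + 1 alone has minimal valuation, and [le_l] puts d p^l in the range where its
    valuation is known exactly. *)
Lemma theta_D : veq p (r%:Z + s%:Z - lam%:Z - 2 * l%:Z) (theta (d * p ^ l)%N).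
Proof.
have d0 : (0 < d)%N by case: q_lte.
have p0 := prime_gt0 p_pr.
have D0 : (0 < d * p ^ l)%N by rewrite muln_gt0 d0 expn_gt0 p0.
have vD : logn p (d * p ^ l) = l.
  by rewrite lognM ?expn_gt0 ?p0 // pfactorK // logn_coprime ?prime_coprime.
apply: veqN => //; rewrite big_ltn //; apply: (veqD p_pr).
  have [_ b] := orbit_log_bound p_pr pF pd q_lte (r.+1 - lam) D0.
  have := veqM p_pr (veq_weight (ltn0Sn r)) (b l erefl le_l).
  by rewrite /= PoszD !addrA.
rewrite big_seq_cond; apply: (vge_sum p_pr) => j.
rewrite andbT mem_index_iota => /andP[rj _].
apply: (vgeW p_pr _ (theta_term (ltnW rj) D0)); rewrite vD; clear - rj; lia.
Qed.

Variables (G0 : finGroupType).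
Hypothesis r_gt0 : (0 < r)%N.
Hypothesis cG0 : abelian [set: G0].
Hypothesis xG0 : forall b : G0, (b ^+ (p ^ r) = 1)%g.
Hypothesis G0_card : #|G0| = (p ^ s)%N.

Lemma num_pow1_Zp_times m j : (0 < m)%N ->
  num_pow1 p ('Z_(p ^ m) * G0)%type j = (p ^ minn j m * num_pow1 p G0 j)%N.
Proof. by move=> m0; rewrite num_pow1_prod num_pow1_Zp. Qed.

Lemma num_pow1_G0_top j : (r <= j)%N -> num_pow1 p G0 j = (p ^ s)%N.
Proof.
move=> le; rewrite /num_pow1 -G0_card -cardsT; apply: eq_card => b;
  rewrite !inE.
by rewrite -(subnKC le) expnD expgM xG0 expg1n eqxx.
Qed.

(** Up to j = r both groups have equally many characters of order p^j; beyond r the smaller group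
    has none, and those of the larger one make up theta. *)
Lemma log_coef_hom_series_theta k :
  log_coef (hom_series ('Z_(p ^ r) * G0)%type F) k =
    log_coef (hom_series ('Z_(p ^ t) * G0)%type F) k + theta k.
Proof.
have t0 : (0 < t)%N by apply: leq_trans rt.
have c m : abelian [set: ('Z_(p ^ m) * G0)%type].
  by apply: abelian_prod => //; apply: FinRing.zmod_abelian.
have x m : (0 < m)%N -> (m <= t)%N -> forall a : ('Z_(p ^ m) * G0)%type,
  (a ^+ (p ^ t) = 1)%g.
  move=> m0 mt [a b]; rewrite expg_pair; congr (_, _).
    by rewrite -(subnKC mt) expnD expgM expg_Zp // expg1n.
  by rewrite -(subnKC (ltnW rt)) expnD expgM xG0 expg1n.
rewrite (log_coef_hom_series p_pr pF (c r) (x r r_gt0 (ltnW rt)) q_lte).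
rewrite (log_coef_hom_series p_pr pF (c t) (x t t0 (leqnn t)) q_lte).
apply/eqP; rewrite addrC -subr_eq -sumrB; apply/eqP.
pose w m j : rat := (num_pow1 p ('Z_(p ^ m) * G0)%type j)%:R
  - (if j is j'.+1 then num_pow1 p ('Z_(p ^ m) * G0)%type j' else 0)%N%:R.
pose b j := orbit_log #|F| (ord_mod p d lam j) k.
rewrite -(big_mkord xpredT (fun j => w r j * b j - w t j * b j)).
rewrite (@big_cat_nat _ _ _ r.+1) //=; last exact: ltnW.
rewrite big1_seq ?add0r; last first.
  move=> j; rewrite andTb mem_index_iota => /andP[_ lj]; rewrite -mulrBl.
  suff -> : w r j = w t j by rewrite subrr mul0r.
  have e i : (i <= r)%N -> num_pow1 p ('Z_(p ^ r) * G0)%type i =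
    num_pow1 p ('Z_(p ^ t) * G0)%type i.
    move=> le; rewrite !num_pow1_Zp_times // (minn_idPl le) (minn_idPl _) //.
    exact: leq_trans le (ltnW rt).
  rewrite /w e //; congr (_ - _%:R); case: j lj => // j lj.
  by apply: e; apply: ltnW.
rewrite /theta -sumrN; apply: eq_big_nat => -[//|j] /andP[rj jt].
rewrite ltnS in rj; rewrite ltnS in jt.
rewrite /w /b /= !num_pow1_Zp_times // !num_pow1_G0_top // ?(leqW rj) //.
rewrite (minn_idPr rj) (minn_idPr (leqW rj)) (minn_idPl jt)
  (minn_idPl (ltnW jt)).
by rewrite !natrM subrr mul0r add0r -mulrBl.
Qed.
End Theta.

(** * Proof of the valuation bound *)

Lemma isog_pow1 (G H : finGroupType) m : [set: G] \isog [set: H] ->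
  (forall x : G, x ^+ m = 1)%g -> (forall y : H, y ^+ m = 1)%g.
Proof.
case/isogP=> f injf imf xG y; have : y \in f @* [set: G] by rewrite imf inE.
by case/morphimP=> x _ _ ->; rewrite -morphX ?inE // xG morph1.
Qed.

Theorem theorem2p18 (p : nat) (p_prime : prime p)
  (r : nat) (r_gt0 : (0 < r)%N) (k : nat -> nat) (kr_gt0 : (0 < k r)%N)
  (G : finGroupType) (G_prod : [set: G] \isog [set: abelian_pgroup p r k])
  (G0 : finGroupType) (G_split : [set: G] \isog [set: 'Z_(p ^ r) * G0])
  (s : nat) (G0_card : #|G0| = (p ^ s)%N)
  (q : nat) (F : finFieldType) (F_card : #|F| = q) (p_ndvd_q : ~~ (p %| q)%N)
  (d : nat) (d_order : d.-primitive_root (q%:R : 'F_p))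
  (p_lam0 : (3 <= p)%N \/ (2 <= lam p q d 0)%N)
  (l : nat) (al : int) (l_al_eq : (l, al) = l_al r s (lam p q d 0))
  (n : nat) :
  let v : int := (logn p #|homs G (GL n F)|)%:Z in
  let rhs : int := (lam p q d 0 * (n %/ d))%N%:Z
    + (\sum_(1 <= i < l.+1) n %/ (d * p ^ i))%N%:Z
    + al * (n %/ (d * p ^ l))%N%:Z in
  v >= rhs /\
  ((d * p ^ l %| n)%N -> ~ (p = 2%N /\ al = -1) -> v = rhs).
Proof.
move=> v rhs; have q_gt1 : (1 < q)%N by rewrite -F_card finNzRing_gt1.
have [q_lte pd] := ord_mod_spec_lam p_prime q_gt1 d_order p_lam0.
have [al_neg al_eq le_l al_small] := l_al_props l_al_eq.
have d0 : (0 < d)%N by case: q_lte.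
set la := lam p q d 0 in q_lte al_eq le_l al_small rhs *.
have iso : [set: abelian_pgroup p r k] \isog [set: 'Z_(p ^ r) * G0].
  by apply: isog_trans G_split; rewrite isog_sym.
have cA : abelian [set: ('Z_(p ^ r) * G0)%type].
  by rewrite -(isog_abelian iso) abelian_pgroup_abelian.
have cG0 : abelian [set: G0].
  apply/centsP=> b _ b' _.
  have h : commute ((1%g, b) : ('Z_(p ^ r) * G0)%type) (1%g, b').
    by apply: (centsP cA); rewrite inE.
  by case: h.
(* [G0] embeds in [abelian_pgroup p r k], whose exponent divides p^r. *)
have xG0 (b : G0) : (b ^+ (p ^ r) = 1)%g.
  have := isog_pow1 iso (fun f => abelian_pgroup_exp f p_prime) (1%g, b).
  by rewrite expg_pair => -[].
have pF : ~~ (p %| #|F|)%N by rewrite F_card.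
have F_lte : ord_mod_spec p #|F| d la by rewrite F_card.
(* t > r makes the term j = r + 1 of theta present, and t >= t0 makes the series of C_(p^t) x G_0
   integral up to degree n. *)
have [t0 ht] := hom_series_pint F G0 n p_prime; pose t := (t0 + r).+1.
have rt : (r < t)%N by rewrite ltnS leq_addl.
have t0t : (t0 <= t)%N by rewrite leqW // leq_addr.
pose A := ('Z_(p ^ r) * G0)%type.
have th_ge j : (0 < j)%N -> vge p (al + 2 * l%:Z - 2 * (logn p j)%:Z)
    (theta p F d la r s t j).
  by move=> j0; have := theta_ge r s t p_prime pF pd F_lte j0;
    rewrite al_eq subrK.
have th_D : veq p al (theta p F d la r s t (d * p ^ l)).
  by rewrite al_eq; apply: (theta_D s p_prime pF pd F_lte rt le_l).
have th_supp j := @theta_supp p F d la r s t j.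
have [b1 b2] := exp_main p_prime al_neg d0 pd al_small th_ge th_supp th_D
  (hom_series0 A F) (hom_series0 ('Z_(p ^ t) * G0)%type F) (ht t t0t (ltn0Sn _))
  (fun j _ => log_coef_hom_series_theta p_prime pF F_lte rt r_gt0 cG0 xG0
    G0_card j).
have gl_order0 : (0 < gl_order #|F| n)%N by rewrite gl_order_gt0 ?finNzRing_gt1.
have vgl := veq_nat p_prime gl_order0.
have hE : (#|homs G (GL n F)|%:R : rat) = hom_series A F n *
  (gl_order #|F| n)%:R.
  by rewrite /hom_series mulfVK ?pnatr_eq0 -?lt0n // (card_homs_isog _ G_split).
have vh : veq p v (#|homs G (GL n F)|%:R : rat).
  by apply: veq_nat => //; apply: card_homs_gt0.
have rhsE : threshold p al (n %/ (d * p ^ l)) + (logn p (gl_order #|F| n))%:Z =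
  rhs.
  rewrite (@logn_gl_trunc p #|F| d la p_prime _ pF F_lte n l) ?F_card // /rhs
    /threshold.
  rewrite !PoszD addrC -addrA; congr (_ + _).
  by rewrite addrC subrK.
split.
  apply: (vge_le_veq p_prime vh); rewrite hE -rhsE.
  exact: (vgeM p_prime b1 (veq_vge vgl)).
move=> dv nexc; apply: (veq_inj p_prime vh); rewrite hE -rhsE.
exact: (veqM p_prime (b2 dv nexc) vgl).
Qed.
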